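(* Let $p,q\in\mathbb{R}^2\setminus\{0\}$ with $p\neq q$ and $|p|=|q|<1$, and let $2\phi_0\in(0,2\pi)$ be the counterclockwise angle from $0p$ to $0q$. Consider the fixed-energy Kepler problem with unprescribed $\omega>0$ $$(P)\qquad \ddot x(t)=-\frac{x(t)}{|x(t)|^3}\ \text{ on }(-\omega,\omega),\qquad x(-\omega)=p,\ x(\omega)=q,\qquad \tfrac12|\dot x(t)|^2-\frac1{|x(t)|}=-1\ \text{ on }[-\omega,\omega],$$ and the solutions of $(P)$ named in the context. Then, with local minimality understood as in the context: 1. If $|p|=|q|<1/2$ (and $\phi_0\in(0,\pi)$), the solutions $x_{\mathrm{int}}^{+}$, $x_{\mathrm{int}}^{-}$ are local minimizers, while the solutions $x_{\mathrm{ext}}^{+}$, $x_{\mathrm{ext}}^{-}$ are not local minimizers. 2. If $|p|=|q|=1/2$, then: - if $\phi_0\in(0,\pi/2)$, the solutions $x^+$ and $x_{\mathrm{int}}$ are local minimizers, while $x^-$ and $x_{\mathrm{ext}}$ are not local minimizers; - if $\phi_0\in(\pi/2,\pi)$, the solutions $x^-$ and $x_{\mathrm{int}}$ are local minimizers, while $x^+$ and $x_{\mathrm{ext}}$ are not local minimizers. 3. If $1/2<|p|=|q|<1$, then: - if $\phi_0\in\left(0,\arcsin\frac{1-|p|}{|p|}\right)$, the solutions $x_{\mathrm{ext},1}^+$ and $x_{\mathrm{int},2}^-$ are local minimizers, while $x_{\mathrm{ext},2}^+$ and $x_{\mathrm{int},1}^-$ are not local minimizers; - if $\phi_0\in\left(\pi-\arcsin\frac{1-|p|}{|p|},\pi\right)$,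 the solutions $x_{\mathrm{ext},1}^-$ and $x_{\mathrm{int},2}^+$ are local minimizers, while $x_{\mathrm{ext},2}^-$ and $x_{\mathrm{int},1}^+$ are not local minimizers.
   Context: Identify $\mathbb{R}^2$ with $\mathbb{C}$; then $q=e^{2i\phi_0}p$. A solution of $(P)$ is a path $x:[-\omega,\omega]\to\mathbb{R}^2\setminus\{0\}$ of class $C^2$, for some $\omega>0$ depending on the solution. Writing $x=re^{i\phi}$ with $r>0$, its (conserved) angular momentum is $c_x=r^2\dot\phi$; write $x\in\mathcal{C}^+$ if $c_x>0$ and $x\in\mathcal{C}^-$ if $c_x<0$. Named solutions. All the solutions below are self-intersection free (injective on $[-\omega,\omega]$); they are determined by the following properties. - Case $|p|=|q|<1/2$: $x_{\mathrm{int}}^\pm\in\mathcal{C}^\pm$ with $|x_{\mathrm{int}}^\pm(t)|<|p|$ for all $t\in(-\omega,\omega)$; $x_{\mathrm{ext}}^\pm\in\mathcal{C}^\pm$ with $|x_{\mathrm{ext}}^\pm(t)|>|p|$ for all $t\in(-\omega,\omega)$. - Case $|p|=|q|=1/2$, $\phi_0\ne\pi/2$: $x^\pm\in\mathcal{C}^\pm$ with $|x^\pm(t)|=|p|$ for all $t\in(-\omega,\omega)$ (circular arcs); $x_{\mathrm{int}}$ with $|x_{\mathrm{int}}(t)|<|p|$ and $x_{\mathrm{ext}}$ with $|x_{\mathrm{ext}}(t)|>|p|$ for all $t\in(-\omega,\omega)$, where $x_{\mathrm{ext}}\in\mathcal{C}^+$, $x_{\mathrm{int}}\in\mathcal{C}^-$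 if $\phi_0\in(0,\pi/2)$, and $x_{\mathrm{ext}}\in\mathcal{C}^-$, $x_{\mathrm{int}}\in\mathcal{C}^+$ if $\phi_0\in(\pi/2,\pi)$. - Case $1/2<|p|=|q|<1$, $\phi_0\in(0,\arcsin\frac{1-|p|}{|p|})$: $x_{\mathrm{int},1}^-,x_{\mathrm{int},2}^-\in\mathcal{C}^-$ are the two solutions with $|x(t)|<|p|$ on $(-\omega,\omega)$, labelled so that $|x_{\mathrm{int},1}^-(0)|>|x_{\mathrm{int},2}^-(0)|$; $x_{\mathrm{ext},1}^+,x_{\mathrm{ext},2}^+\in\mathcal{C}^+$ are the two solutions with $|x(t)|>|p|$ on $(-\omega,\omega)$, labelled so that $|x_{\mathrm{ext},1}^+(0)|<|x_{\mathrm{ext},2}^+(0)|$. - Case $1/2<|p|=|q|<1$, $\phi_0\in(\pi-\arcsin\frac{1-|p|}{|p|},\pi)$: $x_{\mathrm{int},1}^+,x_{\mathrm{int},2}^+\in\mathcal{C}^+$ are the two solutions with $|x(t)|<|p|$ on $(-\omega,\omega)$, labelled so that $|x_{\mathrm{int},1}^+(0)|>|x_{\mathrm{int},2}^+(0)|$; $x_{\mathrm{ext},1}^-,x_{\mathrm{ext},2}^-\in\mathcal{C}^-$ are the two solutions with $|x(t)|>|p|$ on $(-\omega,\omega)$, labelled so that $|x_{\mathrm{ext},1}^-(0)|<|x_{\mathrm{ext},2}^-(0)|$. Local minimality. Let $\mathcal{H}=\{x\in\mathbb{R}^2\setminus\{0\}:|x|<1\}$, and let $$E(\gamma)=\int_0^1|\dot\gamma(s)|^2\left(\frac1{|\gamma(s)|}-1\right)ds$$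 on the Hilbert manifold of $H^1$-paths $\gamma:[0,1]\to\mathcal{H}$ with $\gamma(0)=p$, $\gamma(1)=q$ (with the $H^1$ topology). To a solution $x$ of $(P)$ one associates $\gamma(s)=x(t(s))$, $s\in[0,1]$, where $t(\cdot)$ is the inverse of $$s(t)=\frac1{S_x}\int_{-\omega}^t\left(\frac1{|x(\tau)|}-1\right)d\tau,\qquad S_x=\int_{-\omega}^{\omega}\left(\frac1{|x(\tau)|}-1\right)d\tau;$$ this $\gamma$ is a geodesic for the metric $\left(\frac1{|x|}-1\right)\langle\cdot,\cdot\rangle$ on $\mathcal{H}$ and a critical point of $E$. The solution $x$ is called a local minimizer (resp. not a local minimizer) if $\gamma$ is (resp. is not) a local minimizer of $E$ on this manifold. *)

(* Defs.v *)
From mathcomp Require Import all_boot all_order all_algebra.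
From mathcomp Require Import all_classical all_reals all_analysis.
Import Order.TTheory GRing.Theory Num.Theory numFieldNormedType.Exports.

Set Implicit Arguments.
Unset Strict Implicit.
Unset Printing Implicit Defensive.

Local Open Scope classical_set_scope.
Local Open Scope ring_scope.

(* The plane R^2 is R * R.  Its library norm is the sup norm, so the Euclidean
   norm is introduced separately; both induce the same topology and the same
   derivatives of paths. *)
Definition enorm (R : realType) (y : R * R) : R :=
  Num.sqrt (y.1 ^+ 2 + y.2 ^+ 2).

(* r e^{i phi} *)
Definition polar (R : realType) (r phi : R) : R * R :=
  (r * cos phi, r * sin phi).

(* e^{i a} y *)
Definition rotate_by (R : realType) (a : R) (y : R * R) : R * R :=
  (cos a * y.1 - sin a * y.2, sin a * y.1 + cos a * y.2).

(* Paths on a compact interval are total functions R -> R * R of which only the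
   values on the interval matter.  A path is C^2 on [-w, w], with velocity v
   and acceleration a, when x, v, a are continuous on the closed interval and
   x' = v, v' = a inside; v and a at the end points are then the one-sided
   derivatives. *)
Definition C2_path (R : realType) (w : R) (x v a : R -> R * R) : Prop :=
  [/\ {within `[- w, w], continuous x},
      {within `[- w, w], continuous v},
      {within `[- w, w], continuous a} &
      forall t : R, t \in `]- w, w[ ->
        is_derive t 1 x (v t) /\ is_derive t 1 v (a t)].

(* The Kepler problem with fixed energy -1 and free time w *)
Definition kepler_solution (R : realType) (p q : R * R)
    (w : R) (x : R -> R * R) : Prop :=
  0 < w /\
  (forall t : R, t \in `[- w, w] -> x t <> 0) /\
  x (- w) = p /\ x w = q /\
  exists v a : R -> R * R,
    [/\ C2_path w x v a,
        (forall t : R, t \in `]- w, w[ ->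
           a t = - ((enorm (x t) ^+ 3)^-1 *: x t)) &
        (forall t : R, t \in `[- w, w] ->
           2^-1 * enorm (v t) ^+ 2 - (enorm (x t))^-1 = -1)].

Definition self_intersection_free (R : realType) (w : R) (x : R -> R * R) :=
  {in `[- w, w] &, injective x}.

(* c = r^2 phi' for a continuous polar representation x = r e^{i phi} *)
Definition angular_momentum (R : realType) (w : R) (x : R -> R * R) (c : R) :
    Prop :=
  exists r phi dphi : R -> R,
    [/\ {within `[- w, w], continuous phi},
        (forall t : R, t \in `[- w, w] -> 0 < r t /\ x t = polar (r t) (phi t)) &
        (forall t : R, t \in `]- w, w[ ->
           is_derive t 1 phi (dphi t) /\ r t ^+ 2 * dphi t = c)].

Definition Cplus (R : realType) (w : R) (x : R -> R * R) : Prop :=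
  exists2 c, 0 < c & angular_momentum w x c.

Definition Cminus (R : realType) (w : R) (x : R -> R * R) : Prop :=
  exists2 c, c < 0 & angular_momentum w x c.

(* C is the orientation class, Cplus or Cminus. *)
Definition x_int (R : realType) (p q : R * R)
    (C : R -> (R -> R * R) -> Prop) (w : R) (x : R -> R * R) : Prop :=
  [/\ kepler_solution p q w x, self_intersection_free w x, C w x &
      forall t : R, t \in `]- w, w[ -> enorm (x t) < enorm p].

Definition x_ext (R : realType) (p q : R * R)
    (C : R -> (R -> R * R) -> Prop) (w : R) (x : R -> R * R) : Prop :=
  [/\ kepler_solution p q w x, self_intersection_free w x, C w x &
      forall t : R, t \in `]- w, w[ -> enorm p < enorm (x t)].

Definition x_circ (R : realType) (p q : R * R)
    (C : R -> (R -> R * R) -> Prop) (w : R) (x : R -> R * R) : Prop :=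
  [/\ kepler_solution p q w x, self_intersection_free w x, C w x &
      forall t : R, t \in `]- w, w[ -> enorm (x t) = enorm p].

(* (w1, x1) and (w2, x2) are the solutions labelled 1 and 2: 1 is the one
   which stays closer, at t = 0, to the circle |y| = |p|. *)
Definition x_int12 (R : realType) (p q : R * R)
    (C : R -> (R -> R * R) -> Prop)
    (w1 : R) (x1 : R -> R * R) (w2 : R) (x2 : R -> R * R) : Prop :=
  [/\ x_int p q C w1 x1, x_int p q C w2 x2 & enorm (x2 0) < enorm (x1 0)].

Definition x_ext12 (R : realType) (p q : R * R)
    (C : R -> (R -> R * R) -> Prop)
    (w1 : R) (x1 : R -> R * R) (w2 : R) (x2 : R -> R * R) : Prop :=
  [/\ x_ext p q C w1 x1, x_ext p q C w2 x2 & enorm (x1 0) < enorm (x2 0)].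

(* Conformal factor of the metric on the Hill region *)
Definition weight (R : realType) (y : R * R) : R := (enorm y)^-1 - 1.

Definition hill (R : realType) : set (R * R) :=
  [set y | y <> 0 /\ enorm y < 1].

Definition square_integrable01 (R : realType) (f : R -> R) : Prop :=
  measurable_fun (`[0, 1] : set R) f /\
  (@lebesgue_measure R).-integrable `[0, 1] (fun s => (f s ^+ 2)%:E).

(* g is an H^1 path on [0, 1] with (weak, a.e. unique) derivative dg: dg is
   square integrable and g - g(0) is its indefinite integral. *)
Definition H1_path (R : realType) (g dg : R -> R * R) : Prop :=
  [/\ square_integrable01 (fun s => (dg s).1),
      square_integrable01 (fun s => (dg s).2) &
      forall s : R, s \in `[0, 1] ->
        (g s).1 = (g 0).1 + \int[lebesgue_measure]_(u in `[0, s]) (dg u).1 /\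
        (g s).2 = (g 0).2 + \int[lebesgue_measure]_(u in `[0, s]) (dg u).2].

(* Points of the Hilbert manifold of H^1 paths from p to q in the Hill region,
   each given together with its derivative. *)
Definition admissible (R : realType) (p q : R * R) (g dg : R -> R * R) : Prop :=
  [/\ H1_path g dg, (forall s : R, s \in `[0, 1] -> hill (g s)), g 0 = p & g 1 = q].

Definition energy (R : realType) (g dg : R -> R * R) : \bar R :=
  (\int[lebesgue_measure]_(s in `[0%R, 1%R])
     (enorm (dg s) ^+ 2 * weight (g s))%:E)%E.

Definition H1_dist (R : realType) (g dg h dh : R -> R * R) : R :=
  Num.sqrt (\int[lebesgue_measure]_(s in `[0, 1])
              (enorm (g s - h s) ^+ 2 + enorm (dg s - dh s) ^+ 2)).

Definition energy_local_min (R : realType) (p q : R * R) (g : R -> R * R) :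
    Prop :=
  exists dg, admissible p q g dg /\
  exists2 e : R, 0 < e &
    forall h dh, admissible p q h dh -> H1_dist h dh g dg < e ->
      (energy g dg <= energy h dh)%E.

(* The change of parameter s(t) of a solution x, and the geodesic
   gamma(s) = x(t(s)), with t(.) the inverse of s(.) on [-w, w]. *)
Definition total_length (R : realType) (w : R) (x : R -> R * R) : R :=
  \int[lebesgue_measure]_(u in `[- w, w]) weight (x u).

Definition arc_param (R : realType) (w : R) (x : R -> R * R) (t : R) : R :=
  (total_length w x)^-1 *
  \int[lebesgue_measure]_(u in `[- w, t]) weight (x u).

Definition geodesic (R : realType) (w : R) (x : R -> R * R) (s : R) : R * R :=
  x ('pinv_(fun=> 0) `[- w, w] (arc_param w x) s).

Definition local_minimizer (R : realType) (p q : R * R)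
    (w : R) (x : R -> R * R) : Prop :=
  energy_local_min p q (geodesic w x).

(* Main.v *)
(* The Levi-Civita map x = v Z^2 turns the Kepler problem of energy -1 into the
   harmonic oscillator of energy 1/2, and the Jacobi metric (1/|x| - 1) |dx|^2
   into 4 (1 - |Z|^2) |dZ|^2. After a rotation v and possibly a reflection (the
   sign e of the angular momentum), a solution from p to q becomes
   Z(s) = (al cos s, be sin s) for -T <= s <= T, with al^2 + be^2 = 1 and
   0 < T < pi/2. Let theta(s) be the angle between Z'(s) and Z'(0); then
   theta(T) < pi/4 if and only if al < cos T.

   If al < cos T, the path is a local minimizer. With phi'(x) = sqrt (1 - x^2),
   the function S(Z) = phi(Z.1 + Z.2) - phi(Z.1 - Z.2) solves the eikonal
   equation |grad S|^2 = 4 (1 - |Z|^2), and its gradient is positively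
   proportional to Z' along the arc, so S calibrates it.
   If al > cos T, it is not: the normal variation with profile
   cos (2 theta(s)) - cos (2 theta(T)) makes the second variation negative.

   Finally let A = al^2 = |x(0)| and C = (cos T)^2. Both
   |p| = A C + (1 - A) (1 - C) and e |p| cos phi0 = A C - (1 - A) (1 - C) are
   symmetric in A and C, so A and C are the roots of a quadratic equation
   given by p, phi0 and e: two distinct solutions with the same orientation
   exchange A and C, and the one with the smaller |x(0)| is the minimizer.
   If |p| <= 1/2, then (2 A - 1) (2 C - 1) = 2 |p| - 1 <= 0 decides between
   A < C and C < A. *)
Require Import Defs.
From mathcomp Require Import all_boot all_order all_algebra.
From mathcomp Require Import all_classical all_reals all_analysis.
From mathcomp Require Import measurable_realfun.
From mathcomp Require Import ring lra.
Import Order.TTheory GRing.Theory Num.Theory numFieldNormedType.Exports.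
Local Open Scope classical_set_scope.
Local Open Scope ring_scope.

Set Implicit Arguments.
Unset Strict Implicit.
Unset Printing Implicit Defensive.

(** * Integrals over intervals and H^1 paths *)

(** Why [al < cos T] is the threshold: along the arc, 1 - (Z.1 + Z.2)^2 and 1 - (Z.1 - Z.2)^2 are
    the squares of be cos s - al sin s and be cos s + al sin s, whose product is cos^2 s - al^2.
    While both factors are positive they are the values of phi', so grad S follows Z'; once one of
    them is negative, the square root picks the wrong sign.

    The obstacle is that a competitor is only an H^1 path, and its square root under the Levi-Civita
    map is chosen point by point. The minimality proof therefore works with finite increments: |Z^2
    - W^2| = |Z - W| |Z + W| replaces the chain rule, the increment of S over a short interval is
    compared with the energy spent there up to an error eps |dh|^2, the intervals are chained, and
    eps tends to 0. The energy itself, not the length, is bounded below, through 2 L dS - L^2 du <=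
    (dS/du)^2 du with L the length of the arc.

    For the converse, [energy_local_min] quantifies the derivative of the path existentially, so an
    arbitrary weak derivative of the arc must be identified almost everywhere with the classical
    one. *)

Section tools.
Context {R : realType}.
Notation mu := (@lebesgue_measure R).

Lemma integral_derive (F f : R -> R) (a b : R) : a < b ->
  (forall t : R, t \in `]a, b[ -> is_derive t 1 F (f t)) ->
  {within `[a, b], continuous F} -> {within `[a, b], continuous f} ->
  (\int[mu]_(x in `[a, b]) (f x)%:E)%E = (F b - F a)%:E.
Proof.
move=> ab dF cF cf; rewrite (continuous_FTC2 (F := F) ab cf).
- by rewrite EFinB.
- have /(continuous_within_itvP _ ab)[_ cFa cFb] := cF.
  by split => // t tab; have [] := dF t tab.
- by move=> t tab; rewrite derive1E; have [_ ->] := dF t tab.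
Qed.

Lemma Rintegral_derive (F f : R -> R) (a b : R) : a <= b ->
  (forall t : R, t \in `]a, b[ -> is_derive t 1 F (f t)) ->
  {within `[a, b], continuous F} -> {within `[a, b], continuous f} ->
  \int[mu]_(x in `[a, b]) f x = F b - F a.
Proof.
rewrite le_eqVlt => /predU1P[<- _ _ _|ab dF cF cf].
  by rewrite set_itv1 Rintegral_set1 subrr.
by rewrite /Rintegral (integral_derive ab dF cF cf).
Qed.

Lemma integrable_itvS (f : R -> R) (a b c d : R) :
  mu.-integrable `[a, b] (EFin \o f) -> a <= c -> d <= b ->
  mu.-integrable `[c, d] (EFin \o f).
Proof.
move=> fi ac db; apply: integrableS fi => //.
by apply: subset_itv; rewrite bnd_simp.
Qed.

Lemma Rintegral_itv_diff (f : R -> R) (a b s t : R) :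
  mu.-integrable `[a, b] (EFin \o f) -> a <= s -> s <= t -> t <= b ->
  \int[mu]_(x in `[a, t]) f x - \int[mu]_(x in `[a, s]) f x =
  \int[mu]_(x in `[s, t]) f x.
Proof.
move=> fi as_ st tb.
have fi' := integrable_itvS fi (lexx a) tb.
rewrite (Rintegral_itvB fi') ?bnd_simp//.
rewrite Rintegral_itv_obnd_cbnd//.
apply: integrableS fi' => //.
by apply: subset_itv; rewrite bnd_simp.
Qed.

Lemma Rintegral_cst_itv (c s t : R) : s <= t ->
  \int[mu]_(x in `[s, t]) c = c * (t - s).
Proof.
move=> st; rewrite Rintegral_cst//; congr (_ * _).
apply: (etrans (congr1 fine (lebesgue_measure_itv `[s, t]))).
rewrite /= lte_fin.
case: (ltP s t) => [_ //|ts]; have -> : s = t by apply/eqP; rewrite eq_le st ts.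
by rewrite subrr.
Qed.

Lemma integrable_cst_itv (c s t : R) : mu.-integrable `[s, t] (EFin \o cst c).
Proof.
apply: continuous_compact_integrable; first exact: segment_compact.
by apply: continuous_subspaceT => x; exact: cvg_cst.
Qed.

Lemma integrable_addr (D : set (measurableTypeR R)) (f g : R -> R) : measurable D ->
  mu.-integrable D (EFin \o f) -> mu.-integrable D (EFin \o g) ->
  mu.-integrable D (EFin \o (fun x => f x + g x)).
Proof. by move=> mD fi gi; have := integrableD mD fi gi. Qed.

Lemma integrable_scaler (D : set (measurableTypeR R)) (c : R) (f : R -> R) : measurable D ->
  mu.-integrable D (EFin \o f) -> mu.-integrable D (EFin \o (fun x => c * f x)).
Proof. by move=> mD fi; have := integrableZl mD c fi. Qed.

(* Integrate [2 m f - m^2 <= f^2] with m the mean of f. *)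
Lemma sqr_Rintegral_le (f : R -> R) (s t : R) : s <= t ->
  mu.-integrable `[s, t] (EFin \o f) ->
  mu.-integrable `[s, t] (EFin \o (fun x => f x ^+ 2)) ->
  (\int[mu]_(x in `[s, t]) f x) ^+ 2 <=
  (t - s) * \int[mu]_(x in `[s, t]) (f x ^+ 2).
Proof.
rewrite le_eqVlt => /predU1P[<- _ _|st fi f2i].
  by rewrite set_itv1 !Rintegral_set1 expr0n/= subrr mul0r.
set I := Rintegral _ _ _; set J := Rintegral _ _ _.
have m_ (m : R) : 2 * m * I - m ^+ 2 * (t - s) <= J.
  rewrite /I /J -RintegralZl// -(Rintegral_cst_itv (m ^+ 2) (ltW st)).
  rewrite -RintegralB//; [|exact: integrable_scaler|exact: integrable_cst_itv].
  apply: le_Rintegral => //.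
  - apply: (integrable_addr _ (integrable_scaler (2 * m) _ fi)) => //.
    exact: (integrable_cst_itv (- m ^+ 2)).
  - move=> x _; have := sqr_ge0 (f x - m); nra.
have ts : 0 < t - s by rewrite subr_gt0.
have := m_ (I / (t - s)).
have -> : 2 * (I / (t - s)) * I - (I / (t - s)) ^+ 2 * (t - s) = I ^+ 2 / (t - s).
  by field; rewrite gt_eqF.
by rewrite ler_pdivrMr// mulrC.
Qed.

Lemma sqint_integrable (f : R -> R) : square_integrable01 f ->
  mu.-integrable `[0, 1] (EFin \o f).
Proof.
move=> [mf f2].
have i1 : mu.-integrable `[0, 1] (EFin \o (fun x => 1 + f x ^+ 2)).
  by apply: integrable_addr f2 => //; exact: (integrable_cst_itv 1).
apply: (le_integrable _ _ _ i1) => //; first exact/measurable_EFinP.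
move=> x _ /=; rewrite lee_fin (@ger0_norm _ (1 + _)) ?addr_ge0 ?sqr_ge0//.
rewrite -real_normK ?num_real//; have := sqr_ge0 (`|f x| - 1); nra.
Qed.

Lemma sqintD (f g : R -> R) : square_integrable01 f -> square_integrable01 g ->
  square_integrable01 (fun x => f x + g x).
Proof.
move=> [mf f2] [mg g2]; split; first exact: measurable_funD.
have i1 : mu.-integrable `[0, 1]
    (EFin \o (fun x => 2 * f x ^+ 2 + 2 * g x ^+ 2)).
  by apply: integrable_addr => //; exact: integrable_scaler.
apply: (le_integrable _ _ _ i1) => //.
  by apply/measurable_EFinP; apply: measurable_funX; exact: measurable_funD.
move=> x _ /=; rewrite lee_fin ger0_norm ?sqr_ge0// ger0_norm; last first.
  by rewrite addr_ge0// mulr_ge0// sqr_ge0.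
have := sqr_ge0 (f x - g x); nra.
Qed.

Lemma sqintN (f : R -> R) : square_integrable01 f ->
  square_integrable01 (fun x => - f x).
Proof.
move=> [mf f2]; split; first exact: measurableT_comp.
by apply: eq_integrable f2 => // x _; rewrite sqrrN.
Qed.

Lemma continuous_sqint (f : R -> R) : {within `[0, 1], continuous f} ->
  square_integrable01 f.
Proof.
move=> cf; split; first exact: subspace_continuous_measurable_fun.
apply: continuous_compact_integrable; first exact: segment_compact.
by move=> x; apply: cvgM; exact: cf.
Qed.

Lemma H1_path_diff (g dg : R -> R * R) (s t : R) : H1_path g dg ->
  0 <= s -> s <= t -> t <= 1 ->
  (g t).1 - (g s).1 = \int[mu]_(u in `[s, t]) (dg u).1 /\
  (g t).2 - (g s).2 = \int[mu]_(u in `[s, t]) (dg u).2.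
Proof.
move=> [/sqint_integrable i1 /sqint_integrable i2 gE] s0 st t1.
have [|-> ->] := gE t; first by rewrite in_itv/= t1 (le_trans s0).
have [|-> ->] := gE s; first by rewrite in_itv/= s0 (le_trans st).
rewrite -(Rintegral_itv_diff i1 s0 st t1) -(Rintegral_itv_diff i2 s0 st t1).
by split; ring.
Qed.

Lemma enorm_sq (y : R * R) : enorm y ^+ 2 = y.1 ^+ 2 + y.2 ^+ 2.
Proof. by rewrite /enorm sqr_sqrtr// addr_ge0 ?sqr_ge0. Qed.

Lemma enorm_ge0 (y : R * R) : 0 <= enorm y.
Proof. exact: sqrtr_ge0. Qed.

Lemma sqint_enorm (dg : R -> R * R) :
  square_integrable01 (fun s => (dg s).1) ->
  square_integrable01 (fun s => (dg s).2) ->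
  mu.-integrable `[0, 1] (EFin \o (fun s => enorm (dg s) ^+ 2)).
Proof.
move=> [_ i1] [_ i2].
apply: (eq_integrable _ _ _ _ (integrable_addr _ i1 i2)) => // x _ /=.
by rewrite enorm_sq.
Qed.

(** Cauchy-Schwarz in each coordinate. The integral is kept over [[s, t]] because the calibration
    argument compares an increment with the energy spent on the same short interval. *)
Lemma H1_path_holder (g dg : R -> R * R) (s t : R) : H1_path g dg ->
  0 <= s -> s <= t -> t <= 1 ->
  enorm (g t - g s) ^+ 2 <=
  (t - s) * \int[mu]_(u in `[s, t]) (enorm (dg u) ^+ 2).
Proof.
move=> Hg s0 st t1; have [E1 E2] := H1_path_diff Hg s0 st t1.
have [d1 d2 _] := Hg.
have i1 := integrable_itvS (sqint_integrable d1) s0 t1.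
have i2 := integrable_itvS (sqint_integrable d2) s0 t1.
have [_ /integrable_itvS/(_ s0 t1) j1] := d1.
have [_ /integrable_itvS/(_ s0 t1) j2] := d2.
have -> : \int[mu]_(u in `[s, t]) (enorm (dg u) ^+ 2) =
    \int[mu]_(u in `[s, t]) ((dg u).1 ^+ 2 + (dg u).2 ^+ 2).
  by apply: eq_Rintegral => x _; rewrite enorm_sq.
rewrite RintegralD// mulrDr enorm_sq /= E1 E2.
by apply: lerD; exact: sqr_Rintegral_le.
Qed.

Lemma H1_path_holder01 (g dg : R -> R * R) (s t : R) : H1_path g dg ->
  0 <= s -> s <= t -> t <= 1 ->
  enorm (g t - g s) ^+ 2 <= (t - s) * \int[mu]_(u in `[0, 1]) (enorm (dg u) ^+ 2).
Proof.
move=> Hg s0 st t1; have [d1 d2 _] := Hg; have i := sqint_enorm d1 d2.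
apply: (le_trans (H1_path_holder Hg s0 st t1)).
rewrite ler_wpM2l ?subr_ge0// -(Rintegral_itv_diff i s0 st t1).
apply: (@le_trans _ _ (\int[mu]_(u in `[0, t]) (enorm (dg u) ^+ 2))).
  by rewrite gerBl; apply: Rintegral_ge0 => u _; exact: sqr_ge0.
rewrite -subr_ge0 (Rintegral_itv_diff i (le_trans s0 st) t1 (lexx 1)).
by apply: Rintegral_ge0 => u _; exact: sqr_ge0.
Qed.

Lemma holder_continuous (f : R -> R) (M : R) :
  (forall s t, 0 <= s -> s <= t -> t <= 1 -> (f t - f s) ^+ 2 <= (t - s) * M) ->
  {within `[0, 1], continuous f}.
Proof.
move=> H; apply/subspace_continuousP => x x01; apply/cvgrPdist_lt => e e0.
rewrite near_withinE.
have M0 : 0 <= M by have := H 0 1 (lexx _) ler01 (lexx _); have := sqr_ge0 (f 1 - f 0); nra.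
(* [M] may be 0, so the radius of continuity is taken as e^2 / (M + 1). *)
have M1 : 0 < M + 1 by lra.
near=> t => /=; rewrite !in_itv/= => /andP[t0 t1].
have {}H : (f x - f t) ^+ 2 <= `|x - t| * M.
  move: x01; rewrite /= in_itv/= => /andP[x0 x1].
  have [xt|/ltW tx] := leP x t.
    rewrite distrC ger0_norm ?subr_ge0// -sqrrN opprB; exact: H.
  rewrite ger0_norm ?subr_ge0//; exact: H.
suff : `|f x - f t| < e by [].
rewrite -(@ltr_pXn2r _ 2) ?nnegrE ?(ltW e0)// real_normK ?num_real//.
apply: (le_lt_trans H).
have xt : `|x - t| < e ^+ 2 / (M + 1).
  near: t; apply: (@nbhsx_ballx _ _ x); first exact: divr_gt0 (exprn_gt0 _ e0) M1.
rewrite (@le_lt_trans _ _ (`|x - t| * (M + 1)))//.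
  by rewrite ler_wpM2l// lerDl.
by rewrite -ltr_pdivlMr.
Unshelve. all: by end_near. Qed.

Lemma H1_path_continuous (g dg : R -> R * R) : H1_path g dg ->
  {within `[0, 1], continuous (fun s => (g s).1)} /\
  {within `[0, 1], continuous (fun s => (g s).2)}.
Proof.
move=> Hg; have H s t := H1_path_holder01 Hg (s := s) (t := t).
split; apply: holder_continuous => s t s0 st t1; apply: le_trans (H _ _ s0 st t1);
  by rewrite enorm_sq /= ?lerDl ?lerDr sqr_ge0.
Qed.

Lemma H1_dist_integrable (g dg h dh : R -> R * R) : H1_path g dg -> H1_path h dh ->
  mu.-integrable `[0, 1] (EFin \o (fun s => enorm (h s - g s) ^+ 2)) /\
  mu.-integrable `[0, 1] (EFin \o (fun s => enorm (dh s - dg s) ^+ 2)).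
Proof.
move=> Hg Hh; have [g1 g2 _] := Hg; have [h1 h2 _] := Hh.
have d1 := sqintD h1 (sqintN g1); have d2 := sqintD h2 (sqintN g2).
split; last exact: (sqint_enorm (dg := fun s => dh s - dg s)).
have [cg1 cg2] := H1_path_continuous Hg; have [ch1 ch2] := H1_path_continuous Hh.
apply: (sqint_enorm (dg := fun s => h s - g s)); apply: continuous_sqint => x.
  by apply: cvgB; [exact: ch1|exact: cg1].
by apply: cvgB; [exact: ch2|exact: cg2].
Qed.

(* Both paths start at the same point, so the H^1 distance controls the
   uniform distance. *)
Lemma H1_dist_sup (g dg h dh : R -> R * R) (s : R) :
  H1_path g dg -> H1_path h dh -> g 0 = h 0 ->
  s \in `[0, 1] -> enorm (h s - g s) <= H1_dist h dh g dg.
Proof.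
move=> Hg Hh gh0; rewrite in_itv/= => /andP[s0 s1].
have [g1 g2 _] := Hg; have [h1 h2 _] := Hh.
have d1 := sqintD h1 (sqintN g1); have d2 := sqintD h2 (sqintN g2).
have [i0 i1] := H1_dist_integrable Hg Hh.
have Hd : H1_path (fun s => h s - g s) (fun s => dh s - dg s).
  split => // t t01.
  move: (t01); rewrite in_itv/= => /andP[t0 t1].
  have [E1 E2] := H1_path_diff Hg (lexx 0) t0 t1.
  have [F1 F2] := H1_path_diff Hh (lexx 0) t0 t1.
  have ig1 := integrable_itvS (sqint_integrable g1) (lexx 0) t1.
  have ig2 := integrable_itvS (sqint_integrable g2) (lexx 0) t1.
  have ih1 := integrable_itvS (sqint_integrable h1) (lexx 0) t1.
  have ih2 := integrable_itvS (sqint_integrable h2) (lexx 0) t1.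
  by rewrite /= !RintegralB// -E1 -E2 -F1 -F2 /=; split; ring.
have := H1_path_holder Hd (lexx 0) s0 s1.
have -> : h s - g s - (h 0 - g 0) = h s - g s by rewrite gh0 subrr subr0.
move=> /le_trans H; rewrite -[leLHS]ger0_norm ?enorm_ge0// -sqrtr_sqr ler_wsqrtr//.
apply: H; rewrite subr0.
have J0 : 0 <= \int[mu]_(u in `[0, s]) (enorm (dh u - dg u) ^+ 2).
  by apply: Rintegral_ge0 => u _; exact: sqr_ge0.
apply: (le_trans (ler_piMl J0 s1)).
apply: (@le_trans _ _ (\int[mu]_(u in `[0, 1]) (enorm (dh u - dg u) ^+ 2))).
  rewrite -subr_ge0 (Rintegral_itv_diff i1 s0 s1 (lexx 1)).
  by apply: Rintegral_ge0 => u _; exact: sqr_ge0.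
apply: le_Rintegral => //; first exact: integrable_addr.
by move=> x _; rewrite lerDr sqr_ge0.
Qed.

Lemma ae_neq (a : R) : {ae mu, forall s : R, s != a}.
Proof.
exists [set a]; split => //; first exact: lebesgue_measure_set1.
by move=> x /= /negP; rewrite negbK => /eqP.
Qed.

(** Almost every point is a Lebesgue point of [f], and there the indefinite integral has derivative
    [f]. This pins down every weak derivative of a path that is classically differentiable inside
    the interval. *)
Lemma weak_derivative_ae (f F dF : R -> R) :
  square_integrable01 f ->
  (forall s : R, s \in `[0, 1] -> F s = F 0 + \int[mu]_(u in `[0, s]) f u) ->
  (forall s : R, s \in `]0, 1[ -> is_derive s 1 F (dF s)) ->
  {ae mu, forall s : R, s \in `[0, 1] -> f s = dF s}.
Proof.
move=> /sqint_integrable fi FE FD.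
(* Extension by zero, to obtain a locally integrable function on the whole line. *)
pose f1 := f \_ `[0, 1].
have f1T : mu.-integrable setT (EFin \o f1).
  rewrite /f1 -restrict_EFin; apply/integrable_restrict => //.
  by rewrite setTI.
have f1i (A : set (measurableTypeR R)) : measurable A -> mu.-integrable A (EFin \o f1).
  by move=> mA; apply: (@integrableS _ _ _ mu setT).
have lf1 : locally_integrable [set: R] f1 by exact: integrable_locally_restrict.
apply: filterS3 (ae_neq 0) (ae_neq 1) (lebesgue_differentiation lf1).
  exact: (ae_filter_ringOfSetsType mu).
move=> s s0 s1 Ls s01.
have s01' : s \in `]0, 1[.
  by move: s01; rewrite !in_itv/= => /andP[a b]; rewrite !lt_neqAle eq_sym s0 a s1 b.
have [] := @FTC1_lebesgue_pt R f1 (BLeft 0) s (s + 1) _ _ _ Ls.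
- by rewrite ltrDl.
- by apply: f1i.
- by move: s01'; rewrite in_itv/= => /andP[h _]; rewrite /Order.lt/=.
move=> _; rewrite /f1 patchE mem_set//= => <-.
have [_ <-] := FD s s01'; rewrite derive1E.
have -> : F = (fun s => F s - F 0) + cst (F 0) by apply/funext => x /=; rewrite !fctE /=; ring.
rewrite deriveD//; last first.
  by apply: derivableB => //; have [] := FD s s01'.
rewrite derive_cst addr0; apply: near_eq_derive; near=> t.
have : t \in `]0, 1[ by near: t; exact: near_in_itvoo.
rewrite in_itv/= => /andP[t0 t1].
rewrite FE; last by rewrite in_itv/= !ltW.
rewrite addrAC subrr add0r; apply: eq_Rintegral => u; rewrite inE/= in_itv/= => /andP[u0 ut].
by rewrite patchE mem_set//= in_itv/= u0 (le_trans ut (ltW t1)).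
Unshelve. all: by end_near. Qed.

End tools.

(** * Continuity and monotonicity from derivatives *)

Section continuity.
Context {R : realType}.

Lemma is_derive_continuous (f df : R -> R) :
  (forall x : R, is_derive x 1 f (df x)) -> continuous f.
Proof.
move=> fd x; apply/differentiable_continuous/derivable1_diffP.
by have [] := fd x.
Qed.

(** The derivative is existential so that instance search can compute it: an explicit formula is
    shown continuous without its derivative being written down. *)
Lemma ex_derive_continuous (f : R -> R) :
  (forall x : R, exists d, is_derive x 1 f d) -> continuous f.
Proof.
move=> /(_ _)/cid-/all_sig[df fd]; exact: is_derive_continuous fd.
Qed.

Lemma continuous_within (A : set R) (f : R -> R) :
  continuous f -> {within A, continuous f}.
Proof. exact: continuous_subspaceT. Qed.

Lemma is_derive_monotone (f df : R -> R) :
  (forall x : R, is_derive x 1 f (df x)) -> (forall x, 0 < df x) ->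
  {mono f : x y / x <= y}.
Proof.
move=> fd df0; apply: le_mono => a b ab.
have [|c _ E] := MVT ab (df := df) (f := f).
  exact/continuous_within/is_derive_continuous.
by rewrite -subr_gt0 E mulr_gt0// subr_gt0.
Qed.

End continuity.

(** * The Levi-Civita map *)

Section levi.
Context {R : realType}.
Implicit Types (v Z W : R * R) (e : R).

(* The Levi-Civita map [Z |-> v (Z.1 + i e Z.2)^2] (with [e = -1] it also
   reverses the orientation), and its derivative. *)
Definition levi v e Z : R * R :=
  (v.1 * (Z.1 ^+ 2 - Z.2 ^+ 2) - v.2 * (2 * e * (Z.1 * Z.2)),
   v.2 * (Z.1 ^+ 2 - Z.2 ^+ 2) + v.1 * (2 * e * (Z.1 * Z.2))).

Definition dlevi v e Z W : R * R :=
  (v.1 * (2 * (Z.1 * W.1 - Z.2 * W.2)) - v.2 * (2 * e * (Z.1 * W.2 + Z.2 * W.1)),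
   v.2 * (2 * (Z.1 * W.1 - Z.2 * W.2)) + v.1 * (2 * e * (Z.1 * W.2 + Z.2 * W.1))).

Lemma enorm_levi v e Z : enorm v = 1 -> e ^+ 2 = 1 ->
  enorm (levi v e Z) = enorm Z ^+ 2.
Proof.
move=> /(congr1 (fun a => a ^+ 2)); rewrite enorm_sq expr1n => v1 e1.
apply/eqP; rewrite -(@eqrXn2 _ 2) ?enorm_ge0 ?sqr_ge0//; apply/eqP.
rewrite !enorm_sq /=.
transitivity ((v.1 ^+ 2 + v.2 ^+ 2) *
  ((Z.1 ^+ 2 - Z.2 ^+ 2) ^+ 2 + 4 * e ^+ 2 * Z.1 ^+ 2 * Z.2 ^+ 2)).
  by ring.
by rewrite v1 e1; ring.
Qed.

Lemma enorm_dlevi v e Z W : enorm v = 1 -> e ^+ 2 = 1 ->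
  enorm (dlevi v e Z W) ^+ 2 = 4 * enorm Z ^+ 2 * enorm W ^+ 2.
Proof.
move=> /(congr1 (fun a => a ^+ 2)); rewrite enorm_sq expr1n => v1 e1.
rewrite !enorm_sq /=.
transitivity ((v.1 ^+ 2 + v.2 ^+ 2) * (4 * (Z.1 * W.1 - Z.2 * W.2) ^+ 2 +
   4 * e ^+ 2 * (Z.1 * W.2 + Z.2 * W.1) ^+ 2)); first by ring.
by rewrite v1 e1; ring.
Qed.

(** The complex identity |Z^2 - W^2| = |Z - W| |Z + W|. It transfers estimates of increments between
    a path and its lift wherever |Z + W| is bounded below. *)
Lemma levi_sub v e Z W : enorm v = 1 -> e ^+ 2 = 1 ->
  enorm (levi v e Z - levi v e W) ^+ 2 = enorm (Z - W) ^+ 2 * enorm (Z + W) ^+ 2.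
Proof.
move=> /(congr1 (fun a => a ^+ 2)); rewrite enorm_sq expr1n => v1 e1.
rewrite !enorm_sq /=.
transitivity ((v.1 ^+ 2 + v.2 ^+ 2) * ((Z.1 ^+ 2 - Z.2 ^+ 2 - W.1 ^+ 2 + W.2 ^+ 2) ^+ 2 +
   4 * e ^+ 2 * (Z.1 * Z.2 - W.1 * W.2) ^+ 2)); first by ring.
by rewrite v1 e1; ring.
Qed.

(** Half-angle formulas: the squares of the two coordinates are (|y| + y.1) / 2 and (|y| - y.1) / 2,
    and the sign of y.2 fixes their relative sign. *)
Lemma complex_sqrt (y : R * R) :
  exists Z : R * R, Z.1 ^+ 2 - Z.2 ^+ 2 = y.1 /\ 2 * (Z.1 * Z.2) = y.2.
Proof.
have := enorm_sq y; set r := enorm y => rE.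
have r1 : 0 <= r by exact: enorm_ge0.
have ry : `|y.1| <= r.
  by rewrite -(@ler_pXn2r _ 2) ?nnegrE// real_normK ?num_real// rE lerDl sqr_ge0.
move: ry; rewrite ler_norml => /andP[ry1 ry2].
have a0 : 0 <= (r + y.1) / 2 by lra.
have b0 : 0 <= (r - y.1) / 2 by lra.
have ab : 2 * (Num.sqrt ((r + y.1) / 2) * Num.sqrt ((r - y.1) / 2)) = `|y.2|.
  rewrite -sqrtrM// -[RHS]sqrtr_sqr.
  have -> : y.2 ^+ 2 = 2 ^+ 2 * ((r + y.1) / 2 * ((r - y.1) / 2)) by field: rE.
  by rewrite (sqrtrM _ (sqr_ge0 2)) sqrtr_sqr ger0_norm.
have [y0|y0] := leP 0 y.2.
  exists (Num.sqrt ((r + y.1) / 2), Num.sqrt ((r - y.1) / 2)) => /=.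
  by rewrite !sqr_sqrtr// ab ger0_norm//; split=> //; lra.
exists (Num.sqrt ((r + y.1) / 2), - Num.sqrt ((r - y.1) / 2)) => /=.
rewrite sqrrN !sqr_sqrtr//; split; first by lra.
by rewrite mulrN mulrN ab ltr0_norm// opprK.
Qed.

Lemma levi_surj v e y : enorm v = 1 -> e ^+ 2 = 1 -> exists Z, levi v e Z = y.
Proof.
move=> /(congr1 (fun a => a ^+ 2)); rewrite enorm_sq expr1n => v1 e1.
(* Multiplication by the conjugate of [v] undoes the rotation, and the factor [e], its own inverse,
   undoes the reflection. *)
have [Z [Z1 Z2]] := complex_sqrt (v.1 * y.1 + v.2 * y.2, e * (v.1 * y.2 - v.2 * y.1)).
exists Z; rewrite /levi; have -> : 2 * e * (Z.1 * Z.2) = v.1 * y.2 - v.2 * y.1.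
  transitivity (e * (2 * (Z.1 * Z.2))); first by ring.
  by rewrite Z2 /= mulrA -expr2 e1 mul1r.
rewrite Z1 /= [RHS]surjective_pairing; congr (_, _).
  transitivity ((v.1 ^+ 2 + v.2 ^+ 2) * y.1); first by ring.
  by rewrite v1 mul1r.
transitivity ((v.1 ^+ 2 + v.2 ^+ 2) * y.2); first by ring.
by rewrite v1 mul1r.
Qed.

Lemma weight_levi v e Z : enorm v = 1 -> e ^+ 2 = 1 ->
  weight (levi v e Z) = (enorm Z ^+ 2)^-1 - 1.
Proof. by move=> v1 e1; rewrite /weight enorm_levi. Qed.

Variables (v : R * R) (e : R) (v1 : enorm v = 1) (e1 : e ^+ 2 = 1).
Variables (Y1 Y2 V1 V2 A1 A2 : R -> R).
Hypothesis Y1' : forall s : R, is_derive s 1 Y1 (V1 s).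
Hypothesis Y2' : forall s : R, is_derive s 1 Y2 (V2 s).
Hypothesis V1' : forall s : R, is_derive s 1 V1 (A1 s).
Hypothesis V2' : forall s : R, is_derive s 1 V2 (A2 s).

Let g s := levi v e (Y1 s, Y2 s).
Let dg s := dlevi v e (Y1 s, Y2 s) (V1 s, V2 s).

Lemma levi_path_derive (s : R) :
  is_derive s 1 (fun s => (g s).1) (dg s).1 /\
  is_derive s 1 (fun s => (g s).2) (dg s).2.
Proof.
split; rewrite /g /dg /levi /dlevi /=.
  by apply: is_derive_eq; rewrite /GRing.scale/=; ring.
by apply: is_derive_eq; rewrite /GRing.scale/=; ring.
Qed.

Lemma levi_path_continuous :
  continuous (fun s => (dg s).1) /\ continuous (fun s => (dg s).2).
Proof.
split; rewrite /dg /dlevi /=; apply: ex_derive_continuous => s; eexists; exact: _.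
Qed.

Lemma levi_path_H1 : H1_path g dg.
Proof.
have [c1 c2] := levi_path_continuous.
split; [exact/continuous_sqint/continuous_within..|].
move=> s; rewrite in_itv/= => /andP[s0 s1].
have -> : \int[lebesgue_measure]_(u in `[0, s]) (dg u).1 = (g s).1 - (g 0).1.
  apply: (Rintegral_derive (F := fun s => (g s).1)) => //.
  - by move=> t _; have [] := levi_path_derive t.
  - apply/continuous_within/ex_derive_continuous => t; exists (dg t).1.
    by have [] := levi_path_derive t.
  - exact: continuous_within.
have -> : \int[lebesgue_measure]_(u in `[0, s]) (dg u).2 = (g s).2 - (g 0).2.
  apply: (Rintegral_derive (F := fun s => (g s).2)) => //.
  - by move=> t _; have [] := levi_path_derive t.
  - apply/continuous_within/ex_derive_continuous => t; exists (dg t).2.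
    by have [] := levi_path_derive t.
  - exact: continuous_within.
by rewrite /g /levi /=; split; ring.
Qed.

Lemma levi_path_hill s : 0 < enorm (Y1 s, Y2 s) ^+ 2 < 1 -> hill (g s).
Proof.
move=> /andP[Y0 Yl1]; split; last by rewrite /g enorm_levi.
move=> gs0; have : enorm (g s) = 0 by rewrite gs0 /enorm /= expr0n /= addr0 sqrtr0.
by rewrite /g enorm_levi// => Y00; rewrite Y00 ltxx in Y0.
Qed.

Lemma levi_path_energy :
  (forall s, s \in `[0, 1] -> 0 < enorm (Y1 s, Y2 s) ^+ 2) ->
  energy g dg = (\int[lebesgue_measure]_(s in `[0%R, 1%R])
    (4 * (1 - enorm (Y1 s, Y2 s) ^+ 2) * enorm (V1 s, V2 s) ^+ 2)%:E)%E.
Proof.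
move=> Y0; apply: eq_integral => s; rewrite inE /= => s01; congr EFin.
rewrite /g /dg enorm_dlevi// weight_levi//.
have /gt_eqF/negbT Y00 := Y0 s s01; field.
by move: Y00; rewrite sqrf_eq0.
Qed.

End levi.

(** * Independence of the choice of the weak derivative *)

Section almost_everywhere.
Context {R : realType}.
Notation mu := (@lebesgue_measure R).

Lemma ae_eq_integral01 (f g : R -> R) :
  measurable_fun (`[0, 1] : set R) f -> measurable_fun (`[0, 1] : set R) g ->
  {ae mu, forall s : R, s \in `[0, 1] -> f s = g s} ->
  (\int[mu]_(s in `[0%R, 1%R]) (f s)%:E = \int[mu]_(s in `[0%R, 1%R]) (g s)%:E)%E.
Proof.
move=> mf mg fg; apply: ae_eq_integral => //; [exact/measurable_EFinP..|].
apply: filterS fg; first exact: (ae_filter_ringOfSetsType mu).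
by move=> s fg s01; rewrite fg.
Qed.

Lemma measurable_enorm_sq (dg : R -> R * R) :
  measurable_fun (`[0, 1] : set R) (fun s => (dg s).1) ->
  measurable_fun (`[0, 1] : set R) (fun s => (dg s).2) ->
  measurable_fun (`[0, 1] : set R) (fun s => enorm (dg s) ^+ 2).
Proof.
move=> m1 m2.
have -> : (fun s => enorm (dg s) ^+ 2) = (fun s => (dg s).1 ^+ 2 + (dg s).2 ^+ 2).
  by apply/funext => s; rewrite enorm_sq.
by apply: measurable_funD; apply: measurable_funX.
Qed.

Lemma H1_path_ae (g dg dh : R -> R * R) :
  H1_path g dg ->
  (forall s : R, s \in `]0, 1[ -> is_derive s 1 (fun s => (g s).1) (dh s).1) ->
  (forall s : R, s \in `]0, 1[ -> is_derive s 1 (fun s => (g s).2) (dh s).2) ->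
  {ae mu, forall s : R, s \in `[0, 1] -> dg s = dh s}.
Proof.
move=> [d1 d2 gE] h1 h2.
have e1 := weak_derivative_ae (F := fun s => (g s).1) d1 (fun s s01 => proj1 (gE s s01)) h1.
have e2 := weak_derivative_ae (F := fun s => (g s).2) d2 (fun s s01 => proj2 (gE s s01)) h2.
apply: filterS2 e1 e2; first exact: (ae_filter_ringOfSetsType mu).
move=> s e1 e2 s01.
by rewrite [LHS]surjective_pairing [RHS]surjective_pairing e1// e2.
Qed.

Lemma energy_ae (g dg dh : R -> R * R) :
  measurable_fun (`[0, 1] : set R) (fun s => (dg s).1) ->
  measurable_fun (`[0, 1] : set R) (fun s => (dg s).2) ->
  measurable_fun (`[0, 1] : set R) (fun s => (dh s).1) ->
  measurable_fun (`[0, 1] : set R) (fun s => (dh s).2) ->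
  measurable_fun (`[0, 1] : set R) (fun s => weight (g s)) ->
  {ae mu, forall s : R, s \in `[0, 1] -> dg s = dh s} ->
  energy g dg = energy g dh.
Proof.
move=> m1 m2 m3 m4 mw E; apply: ae_eq_integral01.
- by apply: measurable_funM => //; exact: measurable_enorm_sq.
- by apply: measurable_funM => //; exact: measurable_enorm_sq.
- apply: filterS E; first exact: (ae_filter_ringOfSetsType mu).
  by move=> s E s01; rewrite E.
Qed.

Lemma H1_dist_ae (h dh g dg dg' : R -> R * R) :
  H1_path h dh -> H1_path g dg -> H1_path g dg' ->
  {ae mu, forall s : R, s \in `[0, 1] -> dg s = dg' s} ->
  H1_dist h dh g dg = H1_dist h dh g dg'.
Proof.
move=> Hh Hg Hg' E; rewrite /H1_dist /Rintegral; congr (Num.sqrt (fine _)).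
have [[m1 _] [m2 _] _] := Hh; have [[m3 _] [m4 _] _] := Hg.
have [[m5 _] [m6 _] _] := Hg'.
have [ch1 ch2] := H1_path_continuous Hh; have [cg1 cg2] := H1_path_continuous Hg.
have mc (f : R -> R) : {within `[0, 1], continuous f} -> measurable_fun (`[0, 1] : set R) f.
  exact: subspace_continuous_measurable_fun.
apply: ae_eq_integral01.
- apply: measurable_funD; apply: measurable_enorm_sq; apply: measurable_funB => //; exact: mc.
- apply: measurable_funD; apply: measurable_enorm_sq; apply: measurable_funB => //; exact: mc.
- apply: filterS E; first exact: (ae_filter_ringOfSetsType mu).
  by move=> s E s01; rewrite E.
Qed.

End almost_everywhere.

(** * Arcs of oscillator trajectories *)

Section arc.
Context {R : realType}.
Implicit Types (al be s T : R).

(* On the oscillator trajectory [(al cos s, be sin s)] of energy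
   [al^2 + be^2 = 1], the conformal factor [1 - |Z|^2] equals the squared
   speed [lam]; [Lam] is an antiderivative of [2 lam], the Jacobi length. *)
Definition lam al be s := al ^+ 2 * sin s ^+ 2 + be ^+ 2 * cos s ^+ 2.

Definition Lam al be s := s + (be ^+ 2 - al ^+ 2) * (sin s * cos s).

Variables (al be : R).
Hypotheses (al0 : 0 < al) (be0 : 0 < be) (ab1 : al ^+ 2 + be ^+ 2 = 1).

Lemma sin_sq s : sin s ^+ 2 = 1 - cos s ^+ 2.
Proof. by rewrite -(cos2Dsin2 s) addrAC subrr add0r. Qed.

(** With C = cos^2 s, the difference is (al^2 - C)^2 + C (1 - C). The bound is symmetric in [al] and
    [be], so it also serves for |Z|^2, which is [lam] with the two exchanged. *)
Lemma lam_ge s : al ^+ 2 * be ^+ 2 <= lam al be s.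
Proof.
rewrite /lam sin_sq; have c0 := sqr_ge0 (cos s).
have c1 : cos s ^+ 2 <= 1 by rewrite -(cos2Dsin2 s) lerDl sqr_ge0.
have := sqr_ge0 (al ^+ 2 - cos s ^+ 2); have -> : be ^+ 2 = 1 - al ^+ 2 by rewrite -ab1 addrC addKr.
nra.
Qed.

Lemma lam_gt0 s : 0 < lam al be s.
Proof. by apply: lt_le_trans (lam_ge s); rewrite mulr_gt0 ?exprn_gt0. Qed.

Lemma is_derive_Lam s : is_derive s 1 (Lam al be) (2 * lam al be s).
Proof.
apply: is_derive_eq; rewrite /GRing.scale/= /lam.
transitivity (1 + (be ^+ 2 - al ^+ 2) * (cos s ^+ 2 - sin s ^+ 2)); first by ring.
by rewrite sin_sq -{1}ab1; ring.
Qed.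

Lemma Lam_le : {mono Lam al be : x y / x <= y}.
Proof.
apply: is_derive_monotone is_derive_Lam _ => s.
by rewrite mulr_gt0// lam_gt0.
Qed.

Lemma Lam_inj : injective (Lam al be).
Proof. exact: inc_inj Lam_le. Qed.

Lemma LamN s : Lam al be (- s) = - Lam al be s.
Proof. by rewrite /Lam sinN cosN; ring. Qed.

Lemma Lam0 : Lam al be 0 = 0.
Proof. by rewrite /Lam sin0 mul0r mulr0 addr0. Qed.

(** [Lam] stays within distance 1 of the identity, so the intermediate value theorem applies between
    -(|y| + 1) and |y| + 1. *)
Lemma Lam_surj y : exists s, Lam al be s = y.
Proof.
have H x : `|Lam al be x - x| <= 1.
  rewrite /Lam addrAC subrr add0r normrM -[leRHS]mulr1.
  have a0 := sqr_ge0 al; have b0 := sqr_ge0 be.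
  have H1 : `|be ^+ 2 - al ^+ 2| <= 1.
    by move: ab1 => H1; rewrite ler_norml; apply/andP; split; lra.
  apply: ler_pM => //.
  have := cos2Dsin2 x; have := sqr_ge0 (cos x + sin x).
  by have := sqr_ge0 (cos x - sin x); rewrite ler_norml => ? ? ?; apply/andP; split; nra.
have [M ME] : exists M : R, M = `|y| + 1 by eexists.
have M0 : - M <= M by have := normr_ge0 y; lra.
have [||s _ <-] := @IVT R (Lam al be) (- M) M y M0.
- exact/continuous_within/(is_derive_continuous is_derive_Lam).
- have := H M; have := H (- M); rewrite !ler_norml => /andP[? ?] /andP[? ?].
  have := lexx `|y|; rewrite {1}ler_norml => /andP[? ?].
  by rewrite ge_min le_max; apply/andP; split; apply/orP; [left|right]; lra.
by exists s.
Qed.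

(** [Lam] is the Jacobi length counted from s = 0, so [tau] is the constant-speed parameter of the
    arc: it runs from - T at 0 to T at 1, with the vertex at 1/2. It is the parameter of
    [geodesic]. *)
Lemma reparametrization (T : R) : exists tau : R -> R,
  (forall u, Lam al be (tau u) = (2 * u - 1) * Lam al be T) /\
  forall u : R, is_derive u 1 tau (Lam al be T * (lam al be (tau u))^-1).
Proof.
have /choice[inv invK] := Lam_surj.
have Kinv : cancel (Lam al be) inv by move=> x; apply: Lam_inj; rewrite invK.
exists (fun u => inv ((2 * u - 1) * Lam al be T)); split=> [u|u]; first exact: invK.
pose y := (2 * u - 1) * Lam al be T.
have dinv : is_derive ((2 * u - 1) * Lam al be T) 1 inv (2 * lam al be (inv y))^-1.
  rewrite -/y -{1}(invK y); apply: is_derive_inverse.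
  - by near=> x; exact: Kinv.
  - by near=> x; exact: (is_derive_continuous is_derive_Lam).
  - exact: is_derive_Lam.
  - by rewrite gt_eqF// mulr_gt0// lam_gt0.
have := is_derive1_comp (g := fun u => (2 * u - 1) * Lam al be T) (x := u) (f := inv) dinv.
move=> /(_ (2 * Lam al be T)) H; apply: is_derive_eq.
by rewrite -/y /GRing.scale/=; field; rewrite gt_eqF// lam_gt0.
Unshelve. all: by end_near. Qed.

Variable T : R.
Hypotheses (T0 : 0 < T).
Variable tau : R -> R.
Hypothesis tauE : forall u, Lam al be (tau u) = (2 * u - 1) * Lam al be T.

Lemma tau0 : tau 0 = - T.
Proof. by apply: Lam_inj; rewrite tauE LamN mulr0 sub0r mulN1r. Qed.

Lemma tau1 : tau 1 = T.
Proof. by apply: Lam_inj; rewrite tauE; ring. Qed.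

Lemma Lam_gt0 : 0 < Lam al be T.
Proof. by rewrite -Lam0 (leW_mono Lam_le). Qed.

Lemma tau_itv u : u \in `[0, 1] -> tau u \in `[- T, T].
Proof.
rewrite !in_itv/= => /andP[u0 u1]; rewrite -[_ <= tau u]Lam_le -[tau u <= _]Lam_le tauE LamN.
have := Lam_gt0; set L := Lam al be T => L0.
by apply/andP; split; nra.
Qed.


Hypothesis tau' : forall u : R,
  is_derive u 1 tau (Lam al be T * (lam al be (tau u))^-1).

Local Instance is_derive_lamV (s : R) : is_derive s 1 (fun s => (lam al be s)^-1)
  (- (lam al be s)^-1 ^+ 2 * (2 * (al ^+ 2 - be ^+ 2) * (sin s * cos s))).
Proof.
have l0 : lam al be s != 0 by rewrite gt_eqF// lam_gt0.
by apply: is_derive_eq; rewrite /GRing.scale/= exprVn; ring.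
Qed.

Section arc_path.
Variables (v : R * R) (e : R).
Hypotheses (v1 : enorm v = 1) (e1 : e ^+ 2 = 1).
Variables (z1 z2 w1 w2 a1 a2 : R -> R).
Hypothesis z1' : forall s : R, is_derive s 1 z1 (w1 s).
Hypothesis z2' : forall s : R, is_derive s 1 z2 (w2 s).
Hypothesis w1' : forall s : R, is_derive s 1 w1 (a1 s).
Hypothesis w2' : forall s : R, is_derive s 1 w2 (a2 s).

(** The path (z1, z2) is arbitrary because both the geodesic and its variations have this form, with
    the same [tau]. *)
Definition arc_path (u : R) := levi v e (z1 (tau u), z2 (tau u)).

Definition arc_vel (u : R) :=
  let r := Lam al be T * (lam al be (tau u))^-1 in
  dlevi v e (z1 (tau u), z2 (tau u)) (w1 (tau u) * r, w2 (tau u) * r).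

Lemma arc_vel_diff : exists a1 a2 : R -> R, forall u : R,
  is_derive u 1 (fun u => w1 (tau u) * (Lam al be T * (lam al be (tau u))^-1)) (a1 u) /\
  is_derive u 1 (fun u => w2 (tau u) * (Lam al be T * (lam al be (tau u))^-1)) (a2 u).
Proof.
have il (u : R) : is_derive u 1 (fun u => (lam al be (tau u))^-1) _ :=
  is_derive1_comp (is_derive_lamV (tau u)) (tau' u).
by eexists; eexists => u; split.
Qed.

Lemma arc_path_derive (u : R) :
  is_derive u 1 (fun u => (arc_path u).1) (arc_vel u).1 /\
  is_derive u 1 (fun u => (arc_path u).2) (arc_vel u).2.
Proof.
exact: (@levi_path_derive R v e (z1 \o tau) (z2 \o tau)).
Qed.

Lemma arc_path_H1 : H1_path arc_path arc_vel.
Proof.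
have [b1 [b2 b]] := arc_vel_diff.
apply: (@levi_path_H1 R v e (z1 \o tau) (z2 \o tau) _ _ b1 b2) => u.
- by have [] := b u.
- by have [] := b u.
Qed.

Lemma arc_path_hill u : 0 < z1 (tau u) ^+ 2 + z2 (tau u) ^+ 2 < 1 -> hill (arc_path u).
Proof.
by move=> H; apply: (@levi_path_hill R v e v1 e1 (z1 \o tau) (z2 \o tau)); rewrite enorm_sq.
Qed.

Lemma arc_path_energy :
  (forall u, u \in `[0, 1] -> 0 < z1 (tau u) ^+ 2 + z2 (tau u) ^+ 2) ->
  energy arc_path arc_vel = (\int[lebesgue_measure]_(u in `[0%R, 1%R])
    (4 * Lam al be T ^+ 2 *
     ((1 - (z1 (tau u) ^+ 2 + z2 (tau u) ^+ 2)) *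
     (w1 (tau u) ^+ 2 + w2 (tau u) ^+ 2) * (lam al be (tau u))^-1 ^+ 2))%:E)%E.
Proof.
move=> H; rewrite (@levi_path_energy R v e v1 e1 (z1 \o tau) (z2 \o tau))/=; last first.
  by move=> u u01; rewrite enorm_sq/= H.
apply: eq_integral => u _; congr EFin; rewrite !enorm_sq /=; ring.
Qed.

Lemma arc_path_weight : (forall u, 0 < z1 (tau u) ^+ 2 + z2 (tau u) ^+ 2) ->
  continuous (fun u => weight (arc_path u)).
Proof.
move=> H; have -> : (fun u => weight (arc_path u)) =
   (fun u => (z1 (tau u) ^+ 2 + z2 (tau u) ^+ 2)^-1 - 1).
  by apply/funext => u; rewrite weight_levi// enorm_sq.
apply: ex_derive_continuous => u.
have H0 : z1 (tau u) ^+ 2 + z2 (tau u) ^+ 2 != 0 by rewrite gt_eqF.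
by eexists; exact: _.
Qed.

End arc_path.

End arc.

(** * Second variation *)

Section variation.
Context {R : realType}.
Variables (al be T : R).
Hypotheses (al0 : 0 < al) (be0 : 0 < be) (ab1 : al ^+ 2 + be ^+ 2 = 1).
Hypotheses (T0 : 0 < T) (Tpi : T < pi / 2).

Let lam0 s : lam al be s != 0.
Proof. by rewrite gt_eqF// lam_gt0. Qed.

Local Instance lamV_derive (s : R) : is_derive s 1 (fun s => (lam al be s)^-1)
  (- (lam al be s)^-1 ^+ 2 * (2 * (al ^+ 2 - be ^+ 2) * (sin s * cos s))) :=
  is_derive_lamV al0 be0 ab1 s.

(* [cos (2 theta)] for the angle [theta] between the velocity at [s] and the
   one at [0], shifted to vanish at [s = T]. The normal variation with this
   profile makes the second variation negative if [theta(T) > pi/4]. *)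
Definition profile s := (be ^+ 2 * cos s ^+ 2 - al ^+ 2 * sin s ^+ 2) * (lam al be s)^-1
  - (be ^+ 2 * cos T ^+ 2 - al ^+ 2 * sin T ^+ 2) * (lam al be T)^-1.

Definition dprofile s := - (4 * al ^+ 2 * be ^+ 2) * (sin s * cos s) * (lam al be s)^-1 ^+ 2.

Local Notation F := profile.
Local Notation dF := dprofile.
Local Notation c0 := ((be ^+ 2 * cos T ^+ 2 - al ^+ 2 * sin T ^+ 2) * (lam al be T)^-1).

Local Instance profile_derive (s : R) : is_derive s 1 F (dF s).
Proof.
apply: is_derive_eq; rewrite /GRing.scale/= /dprofile.
transitivity (- (4 * al ^+ 2 * be ^+ 2) * (cos s ^+ 2 + sin s ^+ 2) * (sin s * cos s) *
  (lam al be s)^-1 ^+ 2); last by rewrite cos2Dsin2 mulr1.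
have := lam0 s; rewrite /lam => l0; field.
by rewrite !exprMn.
Qed.

Lemma profile_T : F T = 0.
Proof. by rewrite /profile subrr. Qed.

Lemma profileN s : F (- s) = F s.
Proof. by rewrite /profile /lam sinN cosN sqrrN. Qed.

Lemma dprofile_derive : exists a : R -> R, forall s : R, is_derive s 1 dF (a s).
Proof. by eexists => s; rewrite /dprofile. Qed.

(** Here sin (2 theta) = 2 al be sin s cos s / lam and d theta = al be ds / lam. Up to the exact
    derivative of the first term, the second variation is al be times the integral of F_theta^2 - 4
    F^2 in theta. As F = cos (2 theta) - c0 satisfies F_theta_theta + 4 F = - 4 c0, one has
    F_theta^2 - 4 F^2 + 4 c0^2 = (F F_theta + 2 c0 sin (2 theta))_theta, which gives the other two
    terms. *)
Definition bdry s := (al ^+ 2 - be ^+ 2) * (sin s * cos s) * F s ^+ 2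
  - 4 * al ^+ 2 * be ^+ 2 * (sin s * cos s * (lam al be s)^-1) * F s
  + 4 * al ^+ 2 * be ^+ 2 * c0 * (sin s * cos s * (lam al be s)^-1).

(** This is eta1^2 + eta2^2 for the variation field below, the coefficient of ep^2 in the squared
    speed of the varied arc. *)
Definition sqr_speed_var s := dF s ^+ 2 * lam al be s
  + 2 * F s * dF s * (al ^+ 2 - be ^+ 2) * (sin s * cos s)
   + F s ^+ 2 * (1 - lam al be s).

(* Up to the factor [1 / lam], the first three terms are the coefficient of
   [ep ^+ 2] in [variation_density]; the last one, which is nonnegative, turns
   them into the derivative of [bdry]. *)
Definition dbdry s := sqr_speed_var s - F s ^+ 2 * lam al be s
  - 4 * (al * be * F s) ^+ 2 * (lam al be s)^-1
  + 4 * al ^+ 2 * be ^+ 2 * c0 ^+ 2 * (lam al be s)^-1.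

Lemma bdry_derive (s : R) : is_derive s 1 bdry (dbdry s).
Proof.
(* Up to the factor 2 al be this is the derivative of sin (2 theta), with theta' = al be / lam and F
   + c0 = cos (2 theta). *)
have sc : is_derive s 1 (fun s => sin s * cos s * (lam al be s)^-1)
    ((F s + c0) * (lam al be s)^-1).
  apply: is_derive_eq; rewrite /GRing.scale/= /profile subrK.
  transitivity (((be ^+ 2 * cos s ^+ 2 - al ^+ 2 * sin s ^+ 2) * (cos s ^+ 2 + sin s ^+ 2)) *
     (lam al be s)^-1 ^+ 2); last by rewrite cos2Dsin2 mulr1 expr2 mulrA.
  have := lam0 s; rewrite /lam => l0; field.
  by rewrite !exprMn.
rewrite /bdry; apply: is_derive_eq; rewrite /GRing.scale/= /dbdry /sqr_speed_var.
have E1 : (al ^+ 2 - be ^+ 2) * (cos s ^+ 2 - sin s ^+ 2) = 1 - 2 * lam al be s.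
  transitivity ((al ^+ 2 + be ^+ 2) * (cos s ^+ 2 + sin s ^+ 2) - 2 * lam al be s).
    by rewrite /lam; ring.
  by rewrite ab1 cos2Dsin2 mulr1.
have E2 : dF s * lam al be s = - (4 * al ^+ 2 * be ^+ 2) * (sin s * cos s) * (lam al be s)^-1.
  by rewrite /dprofile; field; exact: lam0.
transitivity (((al ^+ 2 - be ^+ 2) * (cos s ^+ 2 - sin s ^+ 2)) * F s ^+ 2 +
  2 * F s * dF s * (al ^+ 2 - be ^+ 2) * (sin s * cos s)
  + dF s * (- (4 * al ^+ 2 * be ^+ 2) * (sin s * cos s) * (lam al be s)^-1)
  + 4 * al ^+ 2 * be ^+ 2 * (lam al be s)^-1 * (c0 ^+ 2 - F s ^+ 2)); first by ring.
by rewrite E1 -E2; ring.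
Qed.

(** The velocity (- al sin s, be cos s) turned by a right angle and scaled by the profile; (eta1,
    eta2) is the derivative of this field. *)
Definition xi1 s := be * cos s * F s.
Definition xi2 s := al * sin s * F s.
Definition eta1 s := - (be * sin s) * F s + be * cos s * dF s.
Definition eta2 s := al * cos s * F s + al * sin s * dF s.

(** An exact polynomial identity in [ep], not a Taylor expansion. The first-order term cancels
    pointwise: - 2 al be F from the conformal factor against + 2 al be F from the squared speed. *)
Lemma variation_density ep s :
  (1 - ((al * cos s + ep * xi1 s) ^+ 2 + (be * sin s + ep * xi2 s) ^+ 2)) *
  ((- (al * sin s) + ep * eta1 s) ^+ 2 + (be * cos s + ep * eta2 s) ^+ 2) *
  (lam al be s)^-1 ^+ 2 =
  1 + ep ^+ 2 * ((lam al be s)^-1 *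
        (sqr_speed_var s - F s ^+ 2 * lam al be s - 4 * (al * be * F s) ^+ 2 * (lam al be s)^-1))
    - ep ^+ 3 * (2 * (al * be * F s) * (sqr_speed_var s + F s ^+ 2 * lam al be s) *
        (lam al be s)^-1 ^+ 2)
    - ep ^+ 4 * (F s ^+ 2 * sqr_speed_var s * (lam al be s)^-1).
Proof.
have E1 : 1 - ((al * cos s + ep * xi1 s) ^+ 2 + (be * sin s + ep * xi2 s) ^+ 2) =
    lam al be s - 2 * ep * (al * be * F s) - ep ^+ 2 * F s ^+ 2 * lam al be s.
  rewrite /xi1 /xi2 /lam.
  transitivity (1 - (al ^+ 2 * cos s ^+ 2 + be ^+ 2 * sin s ^+ 2) -
     2 * ep * (al * be * F s) * (cos s ^+ 2 + sin s ^+ 2)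
       - ep ^+ 2 * F s ^+ 2 * (al ^+ 2 * sin s ^+ 2 + be ^+ 2 * cos s ^+ 2)); first by ring.
  rewrite cos2Dsin2 mulr1; congr (_ - _ - _).
  by rewrite -[X in X - _]mulr1 -[X in X * _ - _]ab1 -(cos2Dsin2 s); ring.
have E2 : (- (al * sin s) + ep * eta1 s) ^+ 2 + (be * cos s + ep * eta2 s) ^+ 2 =
    lam al be s + 2 * ep * (al * be * F s) + ep ^+ 2 * sqr_speed_var s.
  rewrite /eta1 /eta2 /sqr_speed_var.
  have -> : 1 - lam al be s = al ^+ 2 * cos s ^+ 2 + be ^+ 2 * sin s ^+ 2.
    by rewrite /lam -[X in X - _]mulr1 -[X in X * _ - _]ab1 -(cos2Dsin2 s); ring.
  transitivity (lam al be s + 2 * ep * (al * be * F s) * (cos s ^+ 2 + sin s ^+ 2) +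
    ep ^+ 2 * (dF s ^+ 2 * lam al be s + 2 * F s * dF s * (al ^+ 2 - be ^+ 2) * (sin s * cos s)
    + F s ^+ 2 * (al ^+ 2 * cos s ^+ 2 + be ^+ 2 * sin s ^+ 2))).
    by rewrite /lam; ring.
  by rewrite cos2Dsin2 mulr1.
rewrite E1 E2; field; exact: lam0.
Qed.

(** At both ends F vanishes and only the last term of [bdry] survives. Its sign is that of c0 = cos
    (2 theta(T)), whose numerator equals cos^2 T - al^2. *)
Lemma bdry_gap : cos T < al -> bdry T - bdry (- T) < 0.
Proof.
move=> cT; have T0' := T0; have Tpi' := Tpi;
  rewrite /bdry profileN profile_T /lam sinN cosN sqrrN -/(lam al be T).
have c1 : c0 < 0.
  have H : be ^+ 2 * cos T ^+ 2 - al ^+ 2 * sin T ^+ 2 = cos T ^+ 2 - al ^+ 2.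
    rewrite sin_sq; transitivity ((al ^+ 2 + be ^+ 2) * cos T ^+ 2 - al ^+ 2); first by ring.
    by rewrite ab1 mul1r.
  rewrite H pmulr_llt0 ?invr_gt0 ?lam_gt0// subr_lt0 ltr_pXn2r ?nnegrE ?(ltW al0)//.
  by rewrite cos_ge0_pihalf//; apply/andP; split; lra.
have s0 : 0 < sin T by rewrite sin_gt0_pi//; apply/andP; split; have := pi_gt0 R; lra.
have co : 0 < cos T by rewrite cos_gt0_pihalf//; apply/andP; split; lra.
rewrite [X in X < _](_ : _ = 8 * al ^+ 2 * be ^+ 2 * (sin T * cos T * (lam al be T)^-1) * c0);
  last by ring.
rewrite pmulr_rlt0// !mulr_gt0 ?exprn_gt0 ?invr_gt0 ?lam_gt0//.
Qed.

Lemma continuous_itv_bound (f : R -> R) :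
  (forall s : R, exists d, is_derive s 1 f d) ->
  exists2 K, 0 <= K & forall s, s \in `[- T, T] -> f s <= K.
Proof.
move=> /ex_derive_continuous cf.
have TT : - T <= T by have := T0; lra.
have [c _ H] := EVT_max TT (continuous_within cf).
by exists (Num.max 0 (f c)) => [|s /H fs]; rewrite le_max ?lexx// fs orbT.
Qed.

Lemma variation_density_le : exists2 K, 0 <= K & forall ep s, 0 < ep -> ep <= 1 ->
  s \in `[- T, T] ->
  (1 - ((al * cos s + ep * xi1 s) ^+ 2 + (be * sin s + ep * xi2 s) ^+ 2)) *
  ((- (al * sin s) + ep * eta1 s) ^+ 2 + (be * cos s + ep * eta2 s) ^+ 2) *
  (lam al be s)^-1 ^+ 2 <= 1 + ep ^+ 2 * ((lam al be s)^-1 * dbdry s) + ep ^+ 3 * K.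
Proof.
pose q3 s := 2 * (al * be * F s) * (sqr_speed_var s + F s ^+ 2 * lam al be s) * (lam al be s)^-1 ^+ 2.
pose q4 s := F s ^+ 2 * sqr_speed_var s * (lam al be s)^-1.
(* The squares dominate - q3 - ep q4 and, unlike absolute values, are differentiable, as
   [continuous_itv_bound] requires. *)
have [K K0 HK] : exists2 K, 0 <= K & forall s, s \in `[- T, T] -> 2 + q3 s ^+ 2 + q4 s ^+ 2 <= K.
  have [a aP] := dprofile_derive.
  have [b bP] : exists b : R -> R, forall s : R, is_derive s 1 sqr_speed_var (b s).
    by eexists => s; rewrite /sqr_speed_var /lam.
  have [b3 b3P] : exists b : R -> R, forall s : R, is_derive s 1 q3 (b s).
    by eexists => s; rewrite /q3 /lam.
  have [b4 b4P] : exists b : R -> R, forall s : R, is_derive s 1 q4 (b s).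
    by eexists => s; rewrite /q4.
  by apply: continuous_itv_bound => s; eexists.
exists K => // ep s e0 e1 /HK; rewrite variation_density -/(q3 s) -/(q4 s) => {}HK.
have q3K : - q3 s + ep * - q4 s <= K.
  have := sqr_ge0 (q3 s + 1); have := sqr_ge0 (q4 s + ep); nra.
have D0 : 0 <= ep ^+ 2 * ((lam al be s)^-1 * (4 * al ^+ 2 * be ^+ 2 * c0 ^+ 2 * (lam al be s)^-1)).
  have l0 : 0 <= (lam al be s)^-1 by rewrite invr_ge0 ltW// lam_gt0.
  rewrite [X in 0 <= X](_ : _ = (2 * ep * (lam al be s)^-1 * al * be * c0) ^+ 2) ?sqr_ge0//.
  by ring.
have := ler_wpM2l (ltW (exprn_gt0 3 e0)) q3K.
rewrite /dbdry; move: D0; set A := sqr_speed_var s - _ - _; set i := (lam _ _ _)^-1.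
nra.
Qed.

Lemma dlevi_sub v e (Z Y W V : R * R) : enorm v = 1 -> e ^+ 2 = 1 ->
  enorm (dlevi v e (Z + Y) (W + V) - dlevi v e Z W) ^+ 2 <=
  8 * (enorm Y ^+ 2 * enorm W ^+ 2 + enorm (Z + Y) ^+ 2 * enorm V ^+ 2).
Proof.
move=> v1 e1.
have -> : dlevi v e (Z + Y) (W + V) - dlevi v e Z W = dlevi v e Y W + dlevi v e (Z + Y) V.
  by rewrite /dlevi /=; congr (_, _) => /=; ring.
have E (a b : R * R) : enorm (a + b) ^+ 2 <= 2 * enorm a ^+ 2 + 2 * enorm b ^+ 2.
  rewrite !enorm_sq /=.
  have := sqr_ge0 (a.1 - b.1); have := sqr_ge0 (a.2 - b.2); nra.
apply: (le_trans (E _ _)); rewrite !enorm_dlevi//; lra.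
Qed.

(** * The geodesic and its variations as admissible paths *)

Variables (v : R * R) (e : R).
Hypotheses (v1 : enorm v = 1) (e1 : e ^+ 2 = 1).
Variable tau : R -> R.
Hypothesis tauE : forall u, Lam al be (tau u) = (2 * u - 1) * Lam al be T.
Hypothesis tau' : forall u : R,
  is_derive u 1 tau (Lam al be T * (lam al be (tau u))^-1).

Definition hooke_path := arc_path tau v e (fun s => al * cos s) (fun s => be * sin s).

Definition hooke_vel := arc_vel al be T tau v e (fun s => al * cos s) (fun s => be * sin s)
  (fun s => - (al * sin s)) (fun s => be * cos s).

Let z1' (s : R) : is_derive s 1 (fun s => al * cos s) (- (al * sin s)).
Proof. by apply: is_derive_eq; rewrite /GRing.scale/=; ring. Qed.

Let z2' (s : R) : is_derive s 1 (fun s => be * sin s) (be * cos s).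
Proof. by apply: is_derive_eq. Qed.

Let w1' (s : R) : is_derive s 1 (fun s => - (al * sin s)) (- (al * cos s)).
Proof. by apply: is_derive_eq. Qed.

Let w2' (s : R) : is_derive s 1 (fun s => be * cos s) (- (be * sin s)).
Proof. by apply: is_derive_eq; rewrite /GRing.scale/=; ring. Qed.

Lemma hooke_sq s : (al * cos s) ^+ 2 + (be * sin s) ^+ 2 = 1 - lam al be s.
Proof.
transitivity ((al ^+ 2 + be ^+ 2) * (cos s ^+ 2 + sin s ^+ 2) - lam al be s).
  by rewrite /lam; ring.
by rewrite ab1 cos2Dsin2 mulr1.
Qed.

Lemma hooke_sq_gt0 s : 0 < (al * cos s) ^+ 2 + (be * sin s) ^+ 2.
Proof.
(* |Z|^2 is [lam] with [al] and [be] exchanged. *)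
have := lam_gt0 be0 al0 (etrans (addrC _ _) ab1) s.
by rewrite /lam !exprMn addrC.
Qed.

Lemma hooke_H1 : H1_path hooke_path hooke_vel.
Proof. exact: (arc_path_H1 al0 be0 ab1 tau' _ _ z1' z2' w1' w2'). Qed.

Lemma hooke_hill u : hill (hooke_path u).
Proof.
apply: arc_path_hill => //; rewrite hooke_sq_gt0 hooke_sq.
by rewrite ltrBlDr ltrDl lam_gt0.
Qed.

Lemma hooke_admissible : admissible (hooke_path 0) (hooke_path 1) hooke_path hooke_vel.
Proof. by split => //; [exact: hooke_H1|move=> s _; exact: hooke_hill]. Qed.

Lemma hooke_energy : energy hooke_path hooke_vel = (4 * Lam al be T ^+ 2)%:E.
Proof.
rewrite arc_path_energy//; last by move=> u _; exact: hooke_sq_gt0.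
rewrite (eq_integral (EFin \o cst (4 * Lam al be T ^+ 2))); last first.
  move=> u _ /=; congr EFin; rewrite hooke_sq.
  have -> : (- (al * sin (tau u))) ^+ 2 + (be * cos (tau u)) ^+ 2 = lam al be (tau u).
    by rewrite /lam; ring.
  field; exact: lam0.
have G' (u : R) : is_derive u 1 (fun u => 4 * Lam al be T ^+ 2 * u) (4 * Lam al be T ^+ 2).
  by apply: is_derive_eq; rewrite /GRing.scale/=; ring.
have cG := is_derive_continuous G'.
have := integral_derive ltr01 (fun t _ => G' t) (continuous_within cG)
  (continuous_within (@cst_continuous _ _ (4 * Lam al be T ^+ 2))).
by rewrite mulr1 mulr0 subr0.
Qed.

Lemma hooke_vel_ae dg : H1_path hooke_path dg ->
  {ae @lebesgue_measure R, forall s : R, s \in `[0, 1] -> dg s = hooke_vel s}.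
Proof.
move=> Hg; apply: H1_path_ae Hg _ _ => s _.
  by have [] := arc_path_derive tau' v e z1' z2' s.
by have [] := arc_path_derive tau' v e z1' z2' s.
Qed.

Lemma hooke_energy_weak dg : H1_path hooke_path dg ->
  energy hooke_path dg = (4 * Lam al be T ^+ 2)%:E.
Proof.
move=> Hg; rewrite -hooke_energy; have E := hooke_vel_ae Hg.
have [[m1 _] [m2 _] _] := Hg; have [[m3 _] [m4 _] _] := hooke_H1.
apply: energy_ae => //.
apply: subspace_continuous_measurable_fun => //; apply: continuous_within.
by apply: arc_path_weight => // u; exact: hooke_sq_gt0.
Qed.


Lemma variation_sq ep s :
  (al * cos s + ep * xi1 s) ^+ 2 + (be * sin s + ep * xi2 s) ^+ 2 =
  1 - (lam al be s - 2 * ep * (al * be * F s) - ep ^+ 2 * F s ^+ 2 * lam al be s).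
Proof.
rewrite /xi1 /xi2.
transitivity (((al * cos s) ^+ 2 + (be * sin s) ^+ 2) +
     2 * ep * (al * be * F s) * (cos s ^+ 2 + sin s ^+ 2) + ep ^+ 2 * F s ^+ 2 * lam al be s).
  by rewrite /lam; ring.
by rewrite hooke_sq cos2Dsin2; ring.
Qed.

Lemma profile_le s : `|F s| <= 2.
Proof.
have H u : `|(be ^+ 2 * cos u ^+ 2 - al ^+ 2 * sin u ^+ 2) * (lam al be u)^-1| <= 1.
  rewrite normrM normfV (gtr0_norm (lam_gt0 al0 be0 ab1 u)) ler_pdivrMr ?lam_gt0// mul1r.
  have a0 : 0 <= al ^+ 2 * sin u ^+ 2 by rewrite mulr_ge0// sqr_ge0.
  have b0 : 0 <= be ^+ 2 * cos u ^+ 2 by rewrite mulr_ge0// sqr_ge0.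
  by rewrite ler_norml /lam; apply/andP; split; lra.
apply: (le_trans (ler_normB _ _)); have := H s; have := H T; lra.
Qed.

(** Since |F| <= 2, this bound on [ep] keeps al + ep be F and be + ep al F positive, so the varied
    arc avoids 0. It also keeps 2 ep al be F below al^2 be^2 / 2 <= lam / 2, so the arc stays in the
    unit disc. *)
Lemma variation_itv ep s : 0 < ep -> ep <= al * be / 8 ->
  0 < (al * cos s + ep * xi1 s) ^+ 2 + (be * sin s + ep * xi2 s) ^+ 2 < 1.
Proof.
move=> e0 eab; have := profile_le s; rewrite ler_norml => /andP[F1 F2].
have [a0 b0 ab] := And3 al0 be0 ab1.
have a1 : al <= 1 by have := sqr_ge0 al; have := sqr_ge0 be; nra.
have b1 : be <= 1 by have := sqr_ge0 al; have := sqr_ge0 be; nra.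
have eb : ep * be <= al / 8 by nra.
have ea : ep * al <= be / 8 by nra.
apply/andP; split.
  rewrite /xi1 /xi2.
  have -> : (al * cos s + ep * (be * cos s * F s)) ^+ 2
    + (be * sin s + ep * (al * sin s * F s)) ^+ 2
    = cos s ^+ 2 * (al + ep * be * F s) ^+ 2 + sin s ^+ 2 * (be + ep * al * F s) ^+ 2 by ring.
  have F2' : 0 <= F s + 2 by lra.
  have A0 : 0 < al + ep * be * F s.
    by have := mulr_ge0 (mulr_ge0 (ltW e0) (ltW b0)) F2'; lra.
  have B0 : 0 < be + ep * al * F s.
    by have := mulr_ge0 (mulr_ge0 (ltW e0) (ltW a0)) F2'; lra.
  have := exprn_gt0 2 A0; have := exprn_gt0 2 B0.
  set A := (_ + _) ^+ 2; set B := (_ + _) ^+ 2 => B1 A1.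
  have := cos2Dsin2 s; have := sqr_ge0 (cos s); have := sqr_ge0 (sin s) => s0 c0' cs.
  have [c2|c2] := lerP (1 / 2) (cos s ^+ 2); nra.
rewrite variation_sq; have := lam_ge ab1 s; set l := lam al be s => l1.
have P1 : 2 * ep * (al * be * F s) <= al ^+ 2 * be ^+ 2 / 2.
  have : ep * (al * be) <= al * be / 8 * (al * be) by rewrite ler_wpM2r// mulr_ge0// ltW.
  have : 0 <= ep * (al * be) by rewrite !mulr_ge0// ltW.
  nra.
have ab0 : 0 < al ^+ 2 * be ^+ 2 by rewrite mulr_gt0// exprn_gt0.
have ep8 : ep <= 1 / 8 by nra.
have e2 : ep ^+ 2 * F s ^+ 2 <= 1 / 16.
  have : ep ^+ 2 <= (1 / 8) ^+ 2 by rewrite ler_pXn2r// nnegrE ltW// ; lra.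
  have : F s ^+ 2 <= 4 by nra.
  have := sqr_ge0 (F s); have := sqr_ge0 ep; nra.
have : ep ^+ 2 * F s ^+ 2 * l <= 1 / 16 * l by rewrite ler_wpM2r// (le_trans _ l1)// ltW.
lra.
Qed.

Definition var_path ep := arc_path tau v e (fun s => al * cos s + ep * xi1 s)
  (fun s => be * sin s + ep * xi2 s).

Definition var_vel ep := arc_vel al be T tau v e (fun s => al * cos s + ep * xi1 s)
  (fun s => be * sin s + ep * xi2 s)
  (fun s => - (al * sin s) + ep * eta1 s) (fun s => be * cos s + ep * eta2 s).

Let xi1' (s : R) : is_derive s 1 xi1 (eta1 s).
Proof. by rewrite /xi1 /eta1; apply: is_derive_eq; rewrite /GRing.scale/=; ring. Qed.

Let xi2' (s : R) : is_derive s 1 xi2 (eta2 s).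
Proof. by rewrite /xi2 /eta2; apply: is_derive_eq; rewrite /GRing.scale/=; ring. Qed.

Let zeta1' ep (s : R) : is_derive s 1 (fun s => al * cos s + ep * xi1 s)
  (- (al * sin s) + ep * eta1 s).
Proof. by apply: is_derive_eq; rewrite /GRing.scale/= /eta1 /eta2; ring. Qed.

Let zeta2' ep (s : R) : is_derive s 1 (fun s => be * sin s + ep * xi2 s) (be * cos s + ep * eta2 s).
Proof. by apply: is_derive_eq; rewrite /GRing.scale/= /eta1 /eta2; ring. Qed.

Lemma eta_derive : exists a1 a2 : R -> R, forall s : R,
  is_derive s 1 eta1 (a1 s) /\ is_derive s 1 eta2 (a2 s).
Proof.
have [b bP] := dprofile_derive.
by eexists; eexists => s; rewrite /eta1 /eta2; split.
Qed.

Lemma var_vel_derive ep : exists a1 a2 : R -> R, forall s : R,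
  is_derive s 1 (fun s => - (al * sin s) + ep * eta1 s) (a1 s) /\
  is_derive s 1 (fun s => be * cos s + ep * eta2 s) (a2 s).
Proof.
have [b1 [b2 b]] := eta_derive.
have b1P s := (b s).1; have b2P s := (b s).2.
by eexists; eexists => s; split.
Qed.

Lemma var_H1 ep : H1_path (var_path ep) (var_vel ep).
Proof.
have [b1 [b2 b]] := var_vel_derive ep.
have b1P s := (b s).1; have b2P s := (b s).2.
exact: (arc_path_H1 al0 be0 ab1 tau' _ _ (zeta1' ep) (zeta2' ep) b1P b2P).
Qed.

Lemma var_admissible ep : 0 < ep -> ep <= al * be / 8 ->
  admissible (hooke_path 0) (hooke_path 1) (var_path ep) (var_vel ep).
Proof.
move=> e0 eab; split; first exact: var_H1.
- by move=> s _; apply: arc_path_hill => //; exact: variation_itv.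
- rewrite /var_path /hooke_path /arc_path (tau0 al0 be0 ab1 tauE).
  by rewrite /xi1 /xi2 profileN profile_T !mulr0 !addr0.
- rewrite /var_path /hooke_path /arc_path (tau1 al0 be0 ab1 tauE).
  by rewrite /xi1 /xi2 profile_T !mulr0 !addr0.
Qed.

Lemma var_energy : exists2 K, 0 <= K & forall ep, 0 < ep -> ep <= al * be / 8 -> ep <= 1 ->
  (energy (var_path ep) (var_vel ep) <=
   (4 * Lam al be T ^+ 2 * (1 + ep ^+ 2 * ((bdry T - bdry (- T)) / Lam al be T)
     + ep ^+ 3 * K))%:E)%E.
Proof.
have [K K0 HK] := variation_density_le; exists K => // ep e0 eab ep1.
have LT0 := Lam_gt0 al0 be0 ab1 T0.
rewrite arc_path_energy//; last by move=> u _; have /andP[] := variation_itv (tau u) e0 eab.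
(* An antiderivative of the pointwise bound: as tau' = Lam T / lam, the term dbdry / lam is the
   derivative of bdry (tau u) / Lam T. *)
pose G u := 4 * Lam al be T ^+ 2 * (u + ep ^+ 2 * bdry (tau u) / Lam al be T + ep ^+ 3 * K * u).
pose dG u := 4 * Lam al be T ^+ 2 *
  (1 + ep ^+ 2 * ((lam al be (tau u))^-1 * dbdry (tau u)) + ep ^+ 3 * K).
have G' (u : R) : is_derive u 1 G (dG u).
  have bd := bdry_derive; rewrite /G /dG; apply: is_derive_eq; rewrite /GRing.scale/=.
  by field; rewrite lam0 gt_eqF.
have [a aP] := dprofile_derive.
have [c cP] : exists c : R -> R, forall s : R, is_derive s 1 sqr_speed_var (c s).
  by eexists => s; rewrite /sqr_speed_var /lam.
have [c' cP'] : exists c : R -> R, forall s : R, is_derive s 1 dbdry (c s).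
  by eexists => s; rewrite /dbdry /lam -/(lam al be s).
have cG : continuous G by apply: ex_derive_continuous => u; exists (dG u).
have cdG : continuous dG.
  by apply: ex_derive_continuous => u; rewrite /dG; eexists.
have [b1 [b2 b]] := var_vel_derive ep.
have b1P s := (b s).1; have b2P s := (b s).2.
have := integral_derive ltr01 (fun t _ => G' t) (continuous_within cG) (continuous_within cdG).
have -> : G 1 - G 0 = 4 * Lam al be T ^+ 2 *
  (1 + ep ^+ 2 * ((bdry T - bdry (- T)) / Lam al be T) + ep ^+ 3 * K).
  by rewrite /G (tau0 al0 be0 ab1 tauE) (tau1 al0 be0 ab1 tauE); field; rewrite gt_eqF.
move=> <-; apply: ge0_le_integral => //.
- move=> u _; rewrite lee_fin; have /andP[_ /ltW z1] := variation_itv (tau u) e0 eab.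
  have q (x : R) := sqr_ge0 x.
  apply: mulr_ge0; [exact: mulr_ge0|apply: mulr_ge0; [|exact: q]].
  by apply: mulr_ge0; [rewrite subr_ge0|exact: addr_ge0].
- apply/measurable_EFinP; apply: subspace_continuous_measurable_fun => //.
  by apply/continuous_within/ex_derive_continuous => u; eexists.
- by apply/measurable_EFinP; apply: subspace_continuous_measurable_fun => //;
    exact: continuous_within.
- move=> u u01; rewrite lee_fin /dG ler_wpM2l//; first by apply: mulr_ge0 => //; exact: sqr_ge0.
  by apply: HK => //; exact: (tau_itv al0 be0 ab1 T0 tauE).
Qed.

Lemma var_dist : exists2 K, 0 <= K & forall ep, 0 < ep -> ep <= al * be / 8 ->
  H1_dist (var_path ep) (var_vel ep) hooke_path hooke_vel <= ep * Num.sqrt K.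
Proof.
(* The 4 bounds the squared norm of the sum of two points of the unit disc; the 8 is the constant of
   [dlevi_sub]. *)
pose k s := 4 * (xi1 s ^+ 2 + xi2 s ^+ 2) + 8 * (Lam al be T * (lam al be s)^-1) ^+ 2 *
  ((xi1 s ^+ 2 + xi2 s ^+ 2) * lam al be s + (eta1 s ^+ 2 + eta2 s ^+ 2)).
have [K K0 HK] : exists2 K, 0 <= K & forall s, s \in `[- T, T] -> k s <= K.
  have [b1 [b2 b]] := eta_derive.
  have b1P s := (b s).1; have b2P s := (b s).2.
  have [d dP] : exists d : R -> R, forall s : R, is_derive s 1 (lam al be) (d s).
    by eexists => s; rewrite /lam.
  by apply: continuous_itv_bound => s; rewrite /k; eexists.
exists K => // ep e0 eab.
rewrite -[ep * _]ger0_norm ?mulr_ge0 ?sqrtr_ge0 ?(ltW e0)// -sqrtr_sqr exprMn sqr_sqrtr//.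
apply: ler_wsqrtr.
have [i0 i1] := H1_dist_integrable hooke_H1 (var_H1 ep).
apply: (@le_trans _ _ (\int[lebesgue_measure]_(s in `[0, 1]) (ep ^+ 2 * K))); last first.
  by rewrite Rintegral_cst_itv// subr0 mulr1.
apply: le_Rintegral => //; [exact: integrable_addr|exact: integrable_cst_itv|].
move=> u u01; apply: (@le_trans _ _ (ep ^+ 2 * k (tau u))); last first.
  by rewrite ler_wpM2l ?sqr_ge0// HK//; exact: (tau_itv al0 be0 ab1 T0 tauE).
have /andP[_ z1] := variation_itv (tau u) e0 eab.
have w1 : (al * cos (tau u)) ^+ 2 + (be * sin (tau u)) ^+ 2 < 1.
  by rewrite hooke_sq ltrBlDr ltrDl lam_gt0.
rewrite /k mulrDr; apply: lerD.
  rewrite /var_path /hooke_path /arc_path levi_sub// !enorm_sq /=.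
  set A := al * _ in w1 z1 *; set B := be * _ in w1 z1 *; set X := xi1 _ in w1 z1 *;
    set Y := xi2 _ in w1 z1 *.
  have -> : (A + ep * X - A) ^+ 2 + (B + ep * Y - B) ^+ 2 = ep ^+ 2 * (X ^+ 2 + Y ^+ 2) by ring.
  rewrite -mulrA ler_wpM2l ?sqr_ge0// mulrC ler_wpM2r ?addr_ge0 ?sqr_ge0//.
  have := sqr_ge0 (ep * X); have := sqr_ge0 (ep * Y); nra.
rewrite /var_vel /hooke_vel /arc_vel.
set r := Lam al be T * _; set Z := (al * cos _, be * sin _); set W := (- _ * _, be * cos _ * _).
set Z' := (al * _ + _, _); set W' := (_ * r, _ * r).
have -> : Z' = Z + (ep * xi1 (tau u), ep * xi2 (tau u)) by [].
have -> : W' = W + (ep * eta1 (tau u) * r, ep * eta2 (tau u) * r).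
  by rewrite /W /W' /=; congr (_, _) => /=; ring.
apply: (le_trans (dlevi_sub _ _ _ _ v1 e1)); rewrite !enorm_sq /=.
have -> : ((- (al * sin (tau u))) * r) ^+ 2 + (be * cos (tau u) * r) ^+ 2 =
  lam al be (tau u) * r ^+ 2.
  by rewrite /lam; ring.
set A := _ ^+ 2 + _ ^+ 2 in z1 *; set X := xi1 _; set Y := xi2 _; set E1 := eta1 _;
  set E2 := eta2 _.
set l := lam _ _ _.
have -> : ep ^+ 2 * (8 * r ^+ 2 * ((X ^+ 2 + Y ^+ 2) * l + (E1 ^+ 2 + E2 ^+ 2))) =
  8 * (((ep * X) ^+ 2 + (ep * Y) ^+ 2) * (l * r ^+ 2)
    + 1 * ((ep * E1 * r) ^+ 2 + (ep * E2 * r) ^+ 2)) by ring.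
by rewrite ler_wpM2l// lerD2l ler_wpM2r ?addr_ge0 ?sqr_ge0// ltW.
Qed.

Theorem hooke_not_local_min : cos T < al ->
  ~ energy_local_min (hooke_path 0) (hooke_path 1) hooke_path.
Proof.
move=> cT [dg [[Hg _ _ _] [d d0 Hmin]]].
have [K K0 HK] := var_energy; have [M M0 HM] := var_dist.
have LT0 := Lam_gt0 al0 be0 ab1 T0.
pose D := - ((bdry T - bdry (- T)) / Lam al be T).
have D0 : 0 < D by rewrite oppr_gt0 pmulr_llt0 ?invr_gt0// bdry_gap.
have ab0 : 0 < al * be / 8 by rewrite divr_gt0// mulr_gt0.
(* [eK] makes the gain D ep^2 exceed the error K ep^3, and [eM] puts the variation strictly inside
   the given neighbourhood. *)
have [ep [e0 eab ep1 eK eM]] : exists ep : R, [/\ 0 < ep, ep <= al * be / 8, ep <= 1,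
    ep * (K + 1) <= D & ep * (2 * (Num.sqrt M + 1)) <= d].
  have K1 : 0 < K + 1 by lra.
  have M1 : 0 < 2 * (Num.sqrt M + 1) by have := sqrtr_ge0 M; lra.
  exists (Num.min (Num.min (al * be / 8) 1) (Num.min (D / (K + 1)) (d / (2 * (Num.sqrt M + 1))))).
  rewrite -!ler_pdivlMr// !lt_min ab0 ltr01 !divr_gt0//.
  by split; rewrite ?ge_min ?lexx ?orbT.
have := Hmin _ _ (var_admissible e0 eab).
rewrite (H1_dist_ae (var_H1 ep) Hg hooke_H1 (hooke_vel_ae Hg)).
have dd : H1_dist (var_path ep) (var_vel ep) hooke_path hooke_vel < d.
  apply: (le_lt_trans (HM ep e0 eab)); apply: lt_le_trans eM.
  by rewrite ltr_pM2l//; have := sqrtr_ge0 M; lra.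
move=> /(_ dd) /le_trans/(_ (HK ep e0 eab ep1)).
rewrite (hooke_energy_weak Hg) lee_fin -/D.
have -> : (bdry T - bdry (- T)) / Lam al be T = - D by rewrite /D opprK.
have L4 : 0 < 4 * Lam al be T ^+ 2 by rewrite mulr_gt0// exprn_gt0.
rewrite -subr_ge0; rewrite [X in 0 <= X](_ : _ = 4 * Lam al be T ^+ 2 * (ep ^+ 2 * (ep * K - D)));
  last by ring.
rewrite pmulr_rge0// pmulr_rge0 ?exprn_gt0// => H.
by have := e0; lra.
Qed.

End variation.

(** * Calibration *)

Section calibration.
Context {R : realType}.

Definition calib (x : R) : R := (x * Num.sqrt (1 - x ^+ 2) + asin x) / 2.

Lemma calib_derive (x : R) : -1 < x < 1 -> is_derive x 1 calib (Num.sqrt (1 - x ^+ 2)).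
Proof.
move=> x1; have x2 : 0 < 1 - x ^+ 2 by case/andP: x1 => *; nra.
have da := is_derive1_asin x1.
have ds : is_derive x 1 (fun y => Num.sqrt (1 - y ^+ 2))
  ((2 * Num.sqrt (1 - x ^+ 2))^-1 * (- (2 * x))).
  apply: (@is_derive1_comp _ Num.sqrt (fun y => 1 - y ^+ 2)).
    exact: is_derive1_sqrt.
  by apply: is_derive_eq; rewrite /GRing.scale/=; ring.
rewrite /calib; apply: is_derive_eq; rewrite /GRing.scale/=.
have s0 : Num.sqrt (1 - x ^+ 2) != 0 by rewrite gt_eqF// sqrtr_gt0.
have : Num.sqrt (1 - x ^+ 2) ^+ 2 = 1 - x ^+ 2 by rewrite sqr_sqrtr// ltW.
move: s0; set r := Num.sqrt _ => r0 r2.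
transitivity (2^-1 * ((1 - x ^+ 2) / r + r)); first by field.
by rewrite -r2; field.
Qed.

Lemma calib_diff (x y : R) : -1 < x < 1 -> -1 < y < 1 ->
  exists xi, [/\ Num.min x y <= xi, xi <= Num.max x y, xi ^+ 2 <= 1 &
    calib y - calib x = Num.sqrt (1 - xi ^+ 2) * (y - x)].
Proof.
wlog xy : x y / x <= y.
  move=> H x1 y1; have /orP[xy|yx] := le_total x y; first exact: H.
  have [xi [a b c d]] := H y x yx y1 x1; exists xi; split => //.
  - by rewrite minC.
  - by rewrite maxC.
  - by rewrite -opprB d; ring.
move=> x1 y1; rewrite (min_idPl xy) (max_idPr xy).
have I z : z \in `[x, y] -> -1 < z < 1.
  rewrite in_itv/= => /andP[xz zy]; move: x1 y1 => /andP[? ?] /andP[? ?].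
  by apply/andP; split; lra.
have [||c cxy E] := @MVT_segment R calib (fun z => Num.sqrt (1 - z ^+ 2)) x y xy.
- by move=> z /subset_itv_oo_cc/I; exact: calib_derive.
- apply: derivable_within_continuous => z /I /calib_derive[] //.
exists c; split => //; [by move: cxy; rewrite in_itv/= => /andP[]..|].
by have /andP[? ?] := I c cxy; nra.
Qed.

Definition calib2 (Z : R * R) : R := calib (Z.1 + Z.2) - calib (Z.1 - Z.2).

(** Increment form of the eikonal inequality: the mean value theorem in the variables Z.1 + Z.2 and
    Z.1 - Z.2, then Cauchy-Schwarz. This change of variables doubles squared lengths, so for Z = Z'
    the factor (2 - xi^2 - eta^2) 2 would be 4 (1 - |Z|^2). *)
Lemma calib2_diff (Z Z' : R * R) :
  -1 < Z.1 + Z.2 < 1 -> -1 < Z.1 - Z.2 < 1 ->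
  -1 < Z'.1 + Z'.2 < 1 -> -1 < Z'.1 - Z'.2 < 1 ->
  exists xi eta, [/\ Num.min (Z.1 + Z.2) (Z'.1 + Z'.2) <= xi <= Num.max (Z.1 + Z.2) (Z'.1 + Z'.2),
    Num.min (Z.1 - Z.2) (Z'.1 - Z'.2) <= eta <= Num.max (Z.1 - Z.2) (Z'.1 - Z'.2) &
    (calib2 Z' - calib2 Z) ^+ 2 <= (2 - xi ^+ 2 - eta ^+ 2) * (2 * enorm (Z' - Z) ^+ 2)].
Proof.
move=> p1 m1 p2 m2.
have [xi [x1 x2 x3 xE]] := calib_diff p1 p2.
have [eta [y1 y2 y3 yE]] := calib_diff m1 m2.
exists xi, eta; split; [exact/andP|exact/andP|].
have -> : calib2 Z' - calib2 Z = (calib (Z'.1 + Z'.2) - calib (Z.1 + Z.2)) -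
   (calib (Z'.1 - Z'.2) - calib (Z.1 - Z.2)) by rewrite /calib2; ring.
rewrite xE yE enorm_sq /=.
have X2 : Num.sqrt (1 - xi ^+ 2) ^+ 2 = 1 - xi ^+ 2 by rewrite sqr_sqrtr// subr_ge0.
have Y2 : Num.sqrt (1 - eta ^+ 2) ^+ 2 = 1 - eta ^+ 2 by rewrite sqr_sqrtr// subr_ge0.
have -> : 2 - xi ^+ 2 - eta ^+ 2 = Num.sqrt (1 - xi ^+ 2) ^+ 2 + Num.sqrt (1 - eta ^+ 2) ^+ 2.
  by rewrite X2 Y2; ring.
set a := Num.sqrt _; set b := Num.sqrt _.
set u := Z'.1 - Z.1; set w := Z'.2 - Z.2.
have -> : Z'.1 + Z'.2 - (Z.1 + Z.2) = u + w by rewrite /u /w; ring.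
have -> : Z'.1 - Z'.2 - (Z.1 - Z.2) = u - w by rewrite /u /w; ring.
have := sqr_ge0 (a * (u - w) + b * (u + w)); nra.
Qed.

Lemma sqr_near_ge (a x M d : R) :
  `|a| <= M -> `|x - a| <= d -> a ^+ 2 - 2 * M * d <= x ^+ 2.
Proof.
move=> aM xd; have : - (M * d) <= a * (x - a).
  have := ler_pM (normr_ge0 _) (normr_ge0 _) aM xd.
  by rewrite -normrM ler_norml => /andP[].
move=> H; rewrite -subr_ge0.
have -> : x ^+ 2 - (a ^+ 2 - 2 * M * d) = (x - a) ^+ 2 + 2 * (a * (x - a) - - (M * d)).
  by ring.
by rewrite addr_ge0 ?sqr_ge0// mulr_ge0// subr_ge0.
Qed.

Lemma between_near (a b u x d : R) : `|a - u| <= d -> `|b - u| <= d ->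
  Num.min a b <= x <= Num.max a b -> `|x - u| <= d.
Proof.
rewrite !ler_norml ge_min le_max => /andP[a1 a2] /andP[b1 b2].
by move=> /andP[/orP[h1|h1] /orP[h2|h2]]; apply/andP; split; lra.
Qed.

Lemma norm_coord_le (Z : R * R) (d : R) : 0 <= d -> enorm Z ^+ 2 <= d ^+ 2 ->
  `|Z.1| <= d /\ `|Z.2| <= d.
Proof.
have H (x : R) : 0 <= d -> x ^+ 2 <= d ^+ 2 -> `|x| <= d.
  by move=> d0 xd; rewrite -(@ler_pXn2r _ 2) ?nnegrE// real_normK ?num_real.
rewrite enorm_sq => d0 Zd; split; apply: H => //; apply: le_trans Zd.
  by rewrite lerDl sqr_ge0.
by rewrite lerDr sqr_ge0.
Qed.

Lemma enorm_near_ge (U Z : R * R) (d : R) : enorm U ^+ 2 <= 1 ->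
  `|Z.1 - U.1| <= d -> `|Z.2 - U.2| <= d ->
  enorm U ^+ 2 - 4 * d <= enorm Z ^+ 2.
Proof.
move=> U1 d1 d2; rewrite -(expr1n _ 2) in U1.
have [u1 u2] := norm_coord_le ler01 U1.
have := sqr_near_ge u1 d1; have := sqr_near_ge u2 d2.
by rewrite !enorm_sq; lra.
Qed.

Lemma enorm_sum_near_ge (U Z Z' : R * R) (d : R) : enorm U ^+ 2 <= 1 ->
  `|Z.1 + Z'.1 - 2 * U.1| <= d -> `|Z.2 + Z'.2 - 2 * U.2| <= d ->
  4 * enorm U ^+ 2 - 8 * d <= enorm (Z + Z') ^+ 2.
Proof.
move=> U1 d1 d2; rewrite -(expr1n _ 2) in U1.
have n2 (x : R) : `|x| <= 1 -> `|2 * x| <= 2.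
  by rewrite normrM ger0_norm// => x1; rewrite -[leRHS]mulr1 ler_wpM2l.
have [/n2 u1 /n2 u2] := norm_coord_le ler01 U1.
have := sqr_near_ge u1 d1; have := sqr_near_ge u2 d2.
by rewrite !enorm_sq /= !exprMn; lra.
Qed.

(* Compare the density of the metric at [U] with the slope of the calibration
   between the nearby points [Z] and [Z']. *)
Lemma calib_slope (Z Z' U : R * R) (eps rho d xi eta : R) :
  0 < rho -> rho <= enorm U ^+ 2 -> enorm U ^+ 2 < 1 -> 0 < eps -> 0 < d ->
  4 * d * (1 + rho^-1 + eps) <= eps * rho ->
  `|Z.1 - U.1| <= d -> `|Z.2 - U.2| <= d ->
  `|Z'.1 - U.1| <= d -> `|Z'.2 - U.2| <= d ->
  Num.min (Z.1 + Z.2) (Z'.1 + Z'.2) <= xi <= Num.max (Z.1 + Z.2) (Z'.1 + Z'.2) ->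
  Num.min (Z.1 - Z.2) (Z'.1 - Z'.2) <= eta <= Num.max (Z.1 - Z.2) (Z'.1 - Z'.2) ->
  (2 - xi ^+ 2 - eta ^+ 2) * 2 <=
  ((enorm U ^+ 2)^-1 - 1 + eps) * enorm (Z + Z') ^+ 2.
Proof.
move=> rho0 rU U1 eps0 d0 dE z1 z2 z1' z2' H1 H2.
have tri (a b : R) : `|a| <= d -> `|b| <= d -> `|a + b| <= 2 * d.
  by move=> ad bd; rewrite (le_trans (ler_normD _ _))// mulr_natl mulr2n lerD.
have triB (a b : R) : `|a| <= d -> `|b| <= d -> `|a - b| <= 2 * d.
  by move=> ad bd; apply: tri => //; rewrite normrN.
have X1 : `|xi - (U.1 + U.2)| <= 2 * d.
  by apply: between_near H1; rewrite opprD addrACA tri.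
have X2 : `|eta - (U.1 - U.2)| <= 2 * d.
  by apply: between_near H2; rewrite opprD addrACA -opprD triB.
have L2 : 4 * enorm U ^+ 2 - 8 * (2 * d) <= enorm (Z + Z') ^+ 2.
  apply: enorm_sum_near_ge; first exact: ltW.
    by rewrite mulr_natl mulr2n opprD addrACA tri.
  by rewrite mulr_natl mulr2n opprD addrACA tri.
have U1' := ltW U1; rewrite -(expr1n _ 2) in U1'.
have [u1 u2] := norm_coord_le ler01 U1'.
have two (a b : R) : `|a| <= 1 -> `|b| <= 1 -> `|a + b| <= 2.
  by move=> a1 b1; rewrite (le_trans (ler_normD _ _))// (le_trans (lerD a1 b1)).
have uD := two _ _ u1 u2.
have uB : `|U.1 - U.2| <= 2 by apply: two => //; rewrite normrN.
have L1 : (2 - xi ^+ 2 - eta ^+ 2) * 2 <= 4 * (1 - enorm U ^+ 2) + 32 * d.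
  have := sqr_near_ge uD X1; have := sqr_near_ge uB X2.
  by rewrite enorm_sq; lra.
apply: (le_trans L1).
have r0 : 0 < enorm U ^+ 2 by exact: lt_le_trans rU.
move: rU U1 L2 r0; set r := enorm U ^+ 2 => rU U1 L2 r0.
have ri : r^-1 <= rho^-1 by rewrite lef_pV2.
have r1 : 1 <= r^-1 by rewrite invf_ge1// ltW.
apply: (@le_trans _ _ ((r^-1 - 1 + eps) * (4 * r - 8 * (2 * d)))); last first.
  by rewrite ler_wpM2l//; lra.
(* After this expansion the claim is 16 d (1 + 1/r + eps) <= 4 eps r, which the assumed smallness of
   [d] provides. *)
have -> : (r^-1 - 1 + eps) * (4 * r - 8 * (2 * d)) =
    4 - 4 * r + 4 * eps * r - 16 * d * (r^-1 - 1 + eps).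
  by field; rewrite gt_eqF.
have H5 : d * r^-1 <= d * rho^-1 by rewrite ler_wpM2l// ltW.
have H6 : eps * rho <= eps * r by rewrite ler_wpM2l// ltW.
by lra.
Qed.

End calibration.

(** * From local to global inequalities, and integrability of the energy density *)

Section min_tools.
Context {R : realType}.
Notation mu := (@lebesgue_measure R).

Lemma local_le_global (f : R -> R) (eta : R) : 0 < eta ->
  (forall s t, 0 <= s -> s <= t -> t <= 1 -> t - s <= eta -> f s <= f t) -> f 0 <= f 1.
Proof.
move=> eta0 H.
have K (n : nat) : forall t, 0 <= t -> t <= 1 -> t <= n%:R * eta -> f 0 <= f t.
  elim: n => [|n IH] t t0 t1 tn.
    by rewrite mul0r in tn; have -> : t = 0 by apply/eqP; rewrite eq_le t0 tn.
  have [tn'|tn'] := leP t (n%:R * eta); first exact: IH.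
  have s0 : 0 <= n%:R * eta by rewrite mulr_ge0// ltW.
  apply: (le_trans (IH (n%:R * eta) s0 _ (lexx _))); first by lra.
  apply: H => //; first exact: ltW.
  by move: tn; rewrite -natr1 mulrDl mul1r; lra.
have /archi_boundP : 0 <= eta^-1 by rewrite invr_ge0 ltW.
set n := Num.bound _ => nE; apply: (K n) => //.
by rewrite -ler_pdivrMr// div1r ltW.
Qed.

Lemma weight_bounds (h : R -> R * R) (rho : R) : 0 < rho ->
  {within `[0, 1], continuous (fun s => (h s).1)} ->
  {within `[0, 1], continuous (fun s => (h s).2)} ->
  (forall s, s \in `[0, 1] -> rho <= enorm (h s)) ->
  measurable_fun (`[0, 1] : set R) (fun s => weight (h s)).
Proof.
move=> rho0 /subspace_continuousP c1 /subspace_continuousP c2 hr.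
apply: subspace_continuous_measurable_fun => //.
apply/subspace_continuousP => x x01; apply: cvgB; last exact: cvg_cst.
apply: cvgV; first by rewrite gt_eqF// (lt_le_trans rho0)// hr.
apply: (@cvg_comp _ _ _ (fun s => (h s).1 ^+ 2 + (h s).2 ^+ 2) Num.sqrt);
  last exact: sqrt_continuous.
by apply: cvgD; apply: cvgM; first [exact: c1 | exact: c2].
Qed.

Lemma weight_integrable (h dh : R -> R * R) (rho : R) : 0 < rho -> H1_path h dh ->
  (forall s, s \in `[0, 1] -> hill (h s)) ->
  (forall s, s \in `[0, 1] -> rho <= enorm (h s)) ->
  mu.-integrable `[0, 1] (EFin \o (fun s => enorm (dh s) ^+ 2 * weight (h s))).
Proof.
move=> rho0 Hh hh hr; have [d1 d2 _] := Hh.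
have [c1 c2] := H1_path_continuous Hh.
have i := sqint_enorm d1 d2.
have i' := integrable_scaler rho^-1 (measurable_itv `[0, 1]) i.
apply: (le_integrable _ _ _ i') => //.
  apply/measurable_EFinP; apply: measurable_funM; last exact: weight_bounds rho0 c1 c2 hr.
  by apply: measurable_enorm_sq; [case: d1|case: d2].
move=> s s01 /=; rewrite lee_fin.
have [h0 h1] := hh s s01; have hs := hr s s01.
have w0 : 0 <= weight (h s) by rewrite subr_ge0 invf_ge1 ?(lt_le_trans rho0)// ltW.
have w1 : weight (h s) <= rho^-1.
  by rewrite lerBlDr (@le_trans _ _ rho^-1)// ?lerDl// lef_pV2// posrE (lt_le_trans rho0).
have n1 : 0 <= enorm (dh s) ^+ 2 * weight (h s) by apply: mulr_ge0 => //; exact: sqr_ge0.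
rewrite (ger0_norm n1) mulrC; apply: (le_trans _ (ler_norm _)).
by rewrite ler_wpM2r// sqr_ge0.
Qed.

End min_tools.

(** * Minimality of the arc by calibration *)

Section hooke_min.
Context {R : realType}.
Notation mu := (@lebesgue_measure R).
Variables (al be T : R).
Hypotheses (al0 : 0 < al) (be0 : 0 < be) (ab1 : al ^+ 2 + be ^+ 2 = 1).
Hypotheses (T0 : 0 < T) (Tpi : T < pi / 2) (alT : al < cos T).

Lemma cos_itv_ge s : s \in `[- T, T] -> cos T <= cos s.
Proof.
wlog s0 : s / 0 <= s => [H|].
  move=> sT; have [/H|/ltW s0] := leP 0 s; first exact.
  rewrite -(cosN s); apply: H; first by rewrite oppr_ge0.
  by move: sT; rewrite !in_itv/= => /andP[? ?]; apply/andP; split; lra.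
have T0' := T0; have Tpi' := Tpi; have pi0 := pi_gt0 R.
rewrite in_itv/= => /andP[_ sT]; rewrite leNgt ltr_cos ?in_itv/=; last 2 first.
- by apply/andP; split; lra.
- by apply/andP; split; lra.
by rewrite -leNgt.
Qed.

(** A quantitative margin: it bounds the distance of the arc from the sides of the square |Z.1| +
    |Z.2| < 1, where the calibration ceases to be smooth. *)
Let D := cos T ^+ 2 - al ^+ 2.

Lemma hooke_gap : 0 < D <= 1.
Proof.
rewrite /D; have c1 := cos_le1 T; have a0 := al0; have a1 := alT.
by apply/andP; split; nra.
Qed.

(** The two slopes have product cos^2 s - al^2 >= D > 0 and positive sum, hence both are positive.
    Both are at most 1, so each is at least their product. Their squares are 1 - (Z.1 + Z.2)^2 and 1
    - (Z.1 - Z.2)^2, in this order. *)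
Lemma hooke_slopes s : s \in `[- T, T] ->
  [/\ D <= be * cos s - al * sin s, D <= be * cos s + al * sin s,
      (al * cos s + be * sin s) ^+ 2 <= 1 - D ^+ 2 & (al * cos s - be * sin s) ^+ 2 <= 1 - D ^+ 2].
Proof.
move=> sT; have cs := cos_itv_ge sT; have /andP[D0 D1] := hooke_gap.
have c0 : 0 < cos s by apply: lt_le_trans cs; exact: lt_trans al0 alT.
have E : (be * cos s - al * sin s) * (be * cos s + al * sin s) = cos s ^+ 2 - al ^+ 2.
  transitivity ((al ^+ 2 + be ^+ 2) * cos s ^+ 2 - al ^+ 2 * (cos s ^+ 2 + sin s ^+ 2));
    first by ring.
  by rewrite ab1 cos2Dsin2; ring.
have E1 : (be * cos s - al * sin s) ^+ 2 + (al * cos s + be * sin s) ^+ 2 = 1.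
  transitivity ((al ^+ 2 + be ^+ 2) * (cos s ^+ 2 + sin s ^+ 2)); first by ring.
  by rewrite ab1 cos2Dsin2 mulr1.
have E2 : (be * cos s + al * sin s) ^+ 2 + (al * cos s - be * sin s) ^+ 2 = 1.
  transitivity ((al ^+ 2 + be ^+ 2) * (cos s ^+ 2 + sin s ^+ 2)); first by ring.
  by rewrite ab1 cos2Dsin2 mulr1.
have ED : D <= cos s ^+ 2 - al ^+ 2.
  by rewrite lerB// ler_pXn2r// nnegrE ?(ltW c0)// ltW// (lt_trans al0 alT).
have bc : 0 < be * cos s by rewrite mulr_gt0.
rewrite -E in ED; move: E1 E2 ED; set P := be * cos s - al * sin s;
  set Q := be * cos s + al * sin s.
have PQ : 0 < P + Q by rewrite /P /Q; lra.
set X := (al * cos s + be * sin s) ^+ 2; set Y := (al * cos s - be * sin s) ^+ 2.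
have X0 : 0 <= X by exact: sqr_ge0. have Y0 : 0 <= Y by exact: sqr_ge0.
move=> E1 E2 ED.
have PQD : 0 < P * Q by exact: lt_le_trans ED.
have P0 : 0 < P.
  rewrite ltNge; apply/negP => Pn; have Qp : 0 < Q by lra.
  by have := mulr_le0_ge0 Pn (ltW Qp); lra.
have Q0 : 0 < Q by rewrite -(pmulr_rgt0 _ P0).
have P1 : P <= 1 by nra.
have Q1 : Q <= 1 by nra.
have DP : D <= P by nra.
have DQ : D <= Q by nra.
by split => //; nra.
Qed.

(** Along the arc S grows exactly at the rate 2 lam of [Lam]: the slopes being positive, the square
    roots in the derivative of [calib] are the slopes themselves, and the sum of their squares is 2
    lam. *)
Lemma calib2_hooke :
  calib2 (al * cos T, be * sin T) - calib2 (al * cos (- T), be * sin (- T)) = 2 * Lam al be T.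
Proof.
have /andP[D0 D1] := hooke_gap.
pose f s := calib2 (al * cos s, be * sin s) - Lam al be s.
have lt1 (x : R) : x ^+ 2 <= 1 - D ^+ 2 -> -1 < x < 1.
  by move=> x1; apply/andP; split; nra.
have f' s : s \in `[- T, T] -> is_derive s 1 f 0.
  move=> sT; have [s1 s2 s3 s4] := hooke_slopes sT.
  have c1 := calib_derive (lt1 _ s3); have c2 := calib_derive (lt1 _ s4).
  have g1 : is_derive s 1 (fun s => al * cos s + be * sin s) (be * cos s - al * sin s).
    by apply: is_derive_eq; rewrite /GRing.scale/=; ring.
  have g2 : is_derive s 1 (fun s => al * cos s - be * sin s) (- (be * cos s + al * sin s)).
    by apply: is_derive_eq; rewrite /GRing.scale/=; ring.
  have k1 := @is_derive1_comp R calib (fun s => al * cos s + be * sin s) s _ _ c1 g1.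
  have k2 := @is_derive1_comp R calib (fun s => al * cos s - be * sin s) s _ _ c2 g2.
  have k3 := is_derive_Lam ab1 s.
  rewrite (_ : f = ((calib \o (fun s => al * cos s + be * sin s)) -
     (calib \o (fun s => al * cos s - be * sin s))) - Lam al be); last by [].
  apply: is_derive_eq.
  have E1 : 1 - (al * cos s + be * sin s) ^+ 2 = (be * cos s - al * sin s) ^+ 2.
    transitivity ((al ^+ 2 + be ^+ 2) * (cos s ^+ 2 + sin s ^+ 2) - (al * cos s + be * sin s) ^+ 2).
      by rewrite ab1 cos2Dsin2 mulr1.
    by ring.
  have E2 : 1 - (al * cos s - be * sin s) ^+ 2 = (be * cos s + al * sin s) ^+ 2.
    transitivity ((al ^+ 2 + be ^+ 2) * (cos s ^+ 2 + sin s ^+ 2) - (al * cos s - be * sin s) ^+ 2).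
      by rewrite ab1 cos2Dsin2 mulr1.
    by ring.
  rewrite E1 E2 !sqrtr_sqr ger0_norm ?(le_trans (ltW D0))// ger0_norm ?(le_trans (ltW D0))//.
  by rewrite /lam; ring.
have TT : - T <= T by have := T0; lra.
have cf : {within `[- T, T], continuous f}.
  by apply: derivable_within_continuous => s /f'[].
have [c _] := MVT_segment TT (fun s sT => f' s (subset_itv_oo_cc sT)) cf.
rewrite mul0r /f (LamN al be T) => /eqP; rewrite subr_eq0 => /eqP E.
have -> : calib2 (al * cos T, be * sin T) =
  - - Lam al be T + calib2 (al * cos (- T), be * sin (- T)) + Lam al be T.
  by lra.
by ring.
Qed.

Variables (v : R * R) (e : R).
Hypotheses (v1 : enorm v = 1) (e1 : e ^+ 2 = 1).

(** Of the two roots Z and - Z, the one in the half-plane of the reference point is chosen at each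
    [u] separately. No regularity is claimed here; it is recovered in [Zh_modulus]. *)
Lemma levi_lift (h zeta : R -> R * R) : exists Zh : R -> R * R, forall u,
  levi v e (Zh u) = h u /\ 0 <= (Zh u).1 * (zeta u).1 + (Zh u).2 * (zeta u).2.
Proof.
have /choice : forall u, exists Z, levi v e Z = h u /\ 0 <= Z.1 * (zeta u).1 + Z.2 * (zeta u).2.
  move=> u; have [Z ZE] := levi_surj (h u) v1 e1.
  have [Z0|Z0] := leP 0 (Z.1 * (zeta u).1 + Z.2 * (zeta u).2); first by exists Z.
  exists (- Z); split; last by rewrite /= !mulNr; lra.
  by rewrite -ZE /levi /= !sqrrN mulrNN.
by case=> Zh; exists Zh.
Qed.

(** The half-plane condition gives |Z + zeta| >= |zeta| >= al be, so [levi_sub] can be divided by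
    it. The case d = 0 shows that the lift equals zeta wherever the two paths agree, in particular
    at the end points. *)
Lemma levi_lift_close (Z zeta : R * R) (d : R) : 0 <= d ->
  0 <= Z.1 * zeta.1 + Z.2 * zeta.2 -> (al * be) ^+ 2 <= enorm zeta ^+ 2 ->
  enorm (levi v e Z - levi v e zeta) <= d * (al * be) ->
  `|Z.1 - zeta.1| <= d /\ `|Z.2 - zeta.2| <= d.
Proof.
move=> d0 dot m0 H.
have ab0 : 0 < al * be by rewrite mulr_gt0.
have : enorm (levi v e Z - levi v e zeta) ^+ 2 <= (d * (al * be)) ^+ 2.
  by rewrite ler_pXn2r// nnegrE ?enorm_ge0// mulr_ge0// ltW.
rewrite levi_sub// exprMn => {}H.
have m1 : (al * be) ^+ 2 <= enorm (Z + zeta) ^+ 2.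
  apply: (le_trans m0); rewrite !enorm_sq /=.
  have := sqr_ge0 Z.1; have := sqr_ge0 Z.2; lra.
have {}H : enorm (Z - zeta) ^+ 2 <= d ^+ 2.
  rewrite -(ler_pM2r (exprn_gt0 2 ab0)); apply: le_trans H.
  by rewrite ler_wpM2l// sqr_ge0.
exact: (norm_coord_le (Z := Z - zeta) d0 H).
Qed.

Variable tau : R -> R.
Hypothesis tauE : forall u, Lam al be (tau u) = (2 * u - 1) * Lam al be T.
Hypothesis tau' : forall u : R,
  is_derive u 1 tau (Lam al be T * (lam al be (tau u))^-1).

Let zeta u := (al * cos (tau u), be * sin (tau u)).

Let m0 := (al * be) ^+ 2.

Lemma zeta_sq u : m0 <= enorm (zeta u) ^+ 2.
Proof.
have := @lam_ge R be al (etrans (addrC _ _) ab1) (tau u).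
by rewrite /m0 exprMn enorm_sq /= /lam !exprMn; lra.
Qed.

Lemma zeta_le1 u : enorm (zeta u) ^+ 2 <= 1.
Proof.
by rewrite enorm_sq /= (hooke_sq ab1) lerBlDr lerDl ltW// lam_gt0.
Qed.

Lemma zeta_lipschitz : exists2 C, 0 < C & forall s t,
  `|(zeta t).1 - (zeta s).1| <= C * `|t - s| /\ `|(zeta t).2 - (zeta s).2| <= C * `|t - s|.
Proof.
have L0 := Lam_gt0 al0 be0 ab1 T0.
have m00 : 0 < m0 by rewrite exprn_gt0// mulr_gt0.
pose r u := Lam al be T * (lam al be (tau u))^-1.
have rle u : `|r u| <= Lam al be T * m0^-1.
  have l0 := lam_gt0 al0 be0 ab1 (tau u).
  have r0 : 0 <= r u by rewrite mulr_ge0 ?invr_ge0 ?ltW.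
  rewrite (ger0_norm r0) ler_wpM2l ?(ltW L0)// lef_pV2 ?posrE//.
  by rewrite /m0 exprMn; exact: lam_ge.
have [a1 b1] : al <= 1 /\ be <= 1.
  by have := ab1; have := al0; have := be0 => ? ? ?; split; nra.
have nM (a x y C : R) : 0 < a -> a <= 1 -> `|x| <= 1 -> `|y| <= C -> `|a * x * y| <= C.
  move=> ? ? ? yC; rewrite !normrM (gtr0_norm (_ : 0 < a))//.
  rewrite -[leRHS]mul1r ler_pM ?mulr_ge0 ?(ltW (_ : 0 < a))//.
  by rewrite -[leRHS]mul1r ler_pM// ltW.
exists (Lam al be T * m0^-1); first by rewrite mulr_gt0 ?invr_gt0.
have lip (f df : R -> R) : (forall u : R, is_derive u 1 f (df u)) ->
    (forall u, `|df u| <= Lam al be T * m0^-1) ->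
    forall s t, `|f t - f s| <= Lam al be T * m0^-1 * `|t - s|.
  move=> f' fb s t; wlog st : s t / s <= t.
    by move=> H; have /orP[/H//|/H] := le_total s t; rewrite distrC (distrC s t).
  have [c _ ->] := MVT_segment st (fun u _ => f' u) (continuous_within (is_derive_continuous f')).
  by rewrite normrM ler_wpM2r.
have d1 (u : R) : is_derive u 1 (fun u => (zeta u).1) (al * - sin (tau u) * r u).
  by rewrite /zeta /=; apply: is_derive_eq; rewrite /GRing.scale/= /r; ring.
have d2 (u : R) : is_derive u 1 (fun u => (zeta u).2) (be * cos (tau u) * r u).
  by rewrite /zeta /=; apply: is_derive_eq; rewrite /GRing.scale/= /r; ring.
move=> s t; split.
  apply: (lip _ _ d1) => u; apply: nM => //; rewrite normrN ler_norml.
  by rewrite sin_geN1 sin_le1.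
apply: (lip _ _ d2) => u; apply: nM => //; rewrite ler_norml.
by rewrite cos_geN1 cos_le1.
Qed.

(** * Lifts of competitors close to the arc *)

Section competitor.
Variables h dh Zh : R -> R * R.
Hypotheses (Hh : H1_path h dh) (hillh : forall u, u \in `[0, 1] -> hill (h u)).
Hypothesis ZhE : forall u, levi v e (Zh u) = h u.

(** Two needs in one radius: 8 d0 <= D^2 keeps the lift in the open square where the calibration is
    differentiable, and 8 d0 <= m0 keeps it away from 0. *)
Let d0 := D ^+ 2 * m0 / 8.

Hypothesis close : forall u, u \in `[0, 1] ->
  `|(Zh u).1 - (zeta u).1| <= d0 /\ `|(Zh u).2 - (zeta u).2| <= d0.

Lemma d0_bounds : [/\ 0 < d0, 8 * d0 <= D ^+ 2, 8 * d0 <= m0 & 0 < m0 <= 1].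
Proof.
have /andP[D0 D1] := hooke_gap.
have m00 : 0 < m0 by rewrite exprn_gt0// mulr_gt0.
have m1 : m0 <= 1 := le_trans (zeta_sq 0) (zeta_le1 0).
have D2 : 0 < D ^+ 2 by rewrite exprn_gt0.
have D3 : D ^+ 2 <= 1 by rewrite exprn_ile1// ltW.
rewrite /d0; split; [by rewrite divr_gt0// mulr_gt0|nra|nra|exact/andP].
Qed.

Lemma Zh_box u : u \in `[0, 1] ->
  -1 < (Zh u).1 + (Zh u).2 < 1 /\ -1 < (Zh u).1 - (Zh u).2 < 1.
Proof.
move=> u01; have [] := close u01; have [p1 p2 _ _] := d0_bounds.
have /andP[D0 D1] := hooke_gap.
have [_ _ s3 s4] := hooke_slopes (tau_itv al0 be0 ab1 T0 tauE u01).
rewrite !ler_norml => /andP[a1 a2] /andP[b1 b2].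
have D2 : 0 < D ^+ 2 by rewrite exprn_gt0.
have D3 : D ^+ 2 <= 1 by rewrite exprn_ile1// ltW.
have box (P x : R) : P ^+ 2 <= 1 - D ^+ 2 -> P - 2 * d0 <= x -> x <= P + 2 * d0 -> -1 < x < 1.
  move=> P2 x1 x2; apply/andP; split.
    rewrite ltNge; apply/negP => x3.
    have P1 : P <= -1 + 2 * d0 by lra.
    have := mulr_le0 (_ : P - 1 <= 0) (_ : P + 1 - 2 * d0 <= 0); nra.
  rewrite ltNge; apply/negP => x3.
  have P1 : 1 - 2 * d0 <= P by lra.
  nra.
split; [apply: (box _ _ s3)|apply: (box _ _ s4)]; move: a1 a2 b1 b2; rewrite /zeta /=; lra.
Qed.

Lemma Zh_sq u : u \in `[0, 1] -> m0 / 2 <= enorm (Zh u) ^+ 2 < 1.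
Proof.
move=> u01; have [] := close u01; have [p1 _ p2 _] := d0_bounds.
rewrite -(enorm_levi (Zh u) v1 e1) ZhE; have [_ ->] := hillh u01; rewrite andbT.
rewrite -ZhE enorm_levi// => c1 c2.
have := enorm_near_ge (zeta_le1 u) c1 c2; have := zeta_sq u.
by move: p2; lra.
Qed.

(** Uniform continuity of the lift. For close parameters both lifted points are near the same zeta,
    so |Zh t + Zh s|^2 >= m0, and dividing in [levi_sub] turns the Hölder estimate for [h] into one
    for [Zh]. *)
Lemma Zh_modulus (d : R) : 0 < d -> exists2 eta, 0 < eta & forall s t,
  0 <= s -> s <= t -> t <= 1 -> t - s <= eta ->
  `|(Zh t).1 - (Zh s).1| <= d /\ `|(Zh t).2 - (Zh s).2| <= d.
Proof.
move=> dgt0; have [C C0 HC] := zeta_lipschitz.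
have [p1 _ p2 /andP[m00 m01]] := d0_bounds.
set M := \int[mu]_(u in `[0, 1]) (enorm (dh u) ^+ 2).
have M0 : 0 <= M by apply: Rintegral_ge0 => u _; exact: sqr_ge0.
have M1 : 0 < M + 1 by lra.
exists (Num.min (d0 / C) (d ^+ 2 * m0 / (M + 1))).
  rewrite lt_min; apply/andP; split; apply: divr_gt0 => //.
  by apply: mulr_gt0 => //; exact: exprn_gt0.
move=> s t s0 st t1; rewrite le_min => /andP[]; rewrite (ler_pdivlMr _ _ C0) (ler_pdivlMr _ _ M1).
move=> ts1 ts2.
have s01 : s \in `[0, 1] by rewrite in_itv/= s0 (le_trans st).
have t01 : t \in `[0, 1] by rewrite in_itv/= t1 (le_trans s0).
have [cs1 cs2] := close s01; have [ct1 ct2] := close t01; have [L1 L2] := HC s t.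
have [q1 q2] : `|(zeta t).1 - (zeta s).1| <= d0 /\ `|(zeta t).2 - (zeta s).2| <= d0.
  have E : C * `|t - s| <= d0 by rewrite ger0_norm ?subr_ge0// mulrC.
  by split; [exact: le_trans L1 E|exact: le_trans L2 E].
have m1 : m0 <= enorm (Zh t + Zh s) ^+ 2.
  (* The deviation 3 d0 leaves 4 m0 - 24 d0 >= m0, since 8 d0 <= m0. *)
  have tri (a b a' b' : R) : `|b - a| <= d0 -> `|b' - a'| <= d0 -> `|a' - a| <= d0 ->
      `|b' + b - 2 * a| <= 3 * d0.
    move=> h1 h2 h3.
    have -> : b' + b - 2 * a = b' - a' + (b - a) + (a' - a) by ring.
    have -> : 3 * d0 = d0 + d0 + d0 by ring.
    by rewrite (le_trans (ler_normD _ _))// lerD// (le_trans (ler_normD _ _))// lerD.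
  have := enorm_sum_near_ge (zeta_le1 s) (tri _ _ _ _ cs1 ct1 q1) (tri _ _ _ _ cs2 ct2 q2).
  by have := zeta_sq s; move: p2; lra.
have E := H1_path_holder01 Hh s0 st t1; rewrite -/M -!ZhE levi_sub// in E.
have {}E : enorm (Zh t - Zh s) ^+ 2 <= d ^+ 2.
  rewrite -(ler_pM2r m00); apply: (@le_trans _ _ ((t - s) * M)).
    by apply: le_trans E; rewrite ler_wpM2l// sqr_ge0.
  by apply: le_trans ts2; rewrite ler_wpM2l ?subr_ge0//; lra.
exact: (norm_coord_le (Z := Zh t - Zh s) (ltW dgt0) E).
Qed.

(** The second term is a slack that absorbs the variation of the conformal factor over a short
    interval. *)
Let k eps u := enorm (dh u) ^+ 2 * weight (h u) + eps * enorm (dh u) ^+ 2.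

Lemma k_integrable eps : mu.-integrable `[0, 1] (EFin \o k eps).
Proof.
have [_ _ _ /andP[m00 _]] := d0_bounds.
have [d1 d2 _] := Hh.
apply: integrable_addr => //; last by apply: integrable_scaler => //; exact: sqint_enorm.
apply: (@weight_integrable _ _ _ (m0 / 2)) => //; first by rewrite divr_gt0.
by move=> u u01; rewrite -ZhE enorm_levi//; have /andP[] := Zh_sq u01.
Qed.

(** Increment form of 2 L S' - L^2 <= S'^2 <= energy density. It is linear in the increment of S, so
    it can be summed over consecutive intervals. *)
Lemma calib_local (L eps : R) : 0 < eps -> exists2 eta, 0 < eta & forall s t,
  0 <= s -> s <= t -> t <= 1 -> t - s <= eta ->
  2 * L * (calib2 (Zh t) - calib2 (Zh s)) - L ^+ 2 * (t - s) <=
  \int[mu]_(u in `[s, t]) k eps u.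
Proof.
move=> eps0; have [p1 _ p2 /andP[m00 m01]] := d0_bounds.
pose rho := m0 / 2; have rho0 : 0 < rho by rewrite divr_gt0.
have K0 : 0 < 4 * (1 + rho^-1 + eps) by rewrite mulr_gt0// !addr_gt0// invr_gt0.
pose d := eps * rho / (4 * (1 + rho^-1 + eps)).
have dgt0 : 0 < d by rewrite divr_gt0// mulr_gt0.
have dE : 4 * d * (1 + rho^-1 + eps) <= eps * rho.
  by rewrite mulrAC mulrC -ler_pdivlMr.
have [eta eta0 H] := Zh_modulus dgt0; exists eta => // s t s0 st t1 ts.
have [->|st'] := eqVneq s t.
  by rewrite set_itv1 Rintegral_set1 !subrr !mulr0 subr0.
have {}st' : s < t by rewrite lt_neqAle st' st.
have s01 : s \in `[0, 1] by rewrite in_itv/= s0 (le_trans st).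
have t01 : t \in `[0, 1] by rewrite in_itv/= t1 (le_trans s0).
have [ps ms] := Zh_box s01; have [pt mt] := Zh_box t01.
have [xi [ta [xiE taE SE]]] := calib2_diff ps ms pt mt.
set S := calib2 (Zh t) - calib2 (Zh s) in SE *.
set c := (2 - xi ^+ 2 - ta ^+ 2) * 2; set q := enorm (Zh s + Zh t) ^+ 2.
rewrite mulrA -/c in SE; set A := enorm (Zh t - Zh s) ^+ 2 in SE.
have q0 : 0 <= q by exact: sqr_ge0.
have slope u : u \in `[s, t] -> c <= (weight (h u) + eps) * q.
  rewrite in_itv/= => /andP[su ut].
  have u01 : u \in `[0, 1] by rewrite in_itv/= (le_trans s0 su) (le_trans ut t1).
  have /andP[r1 r2] := Zh_sq u01.
  rewrite -ZhE weight_levi//.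
  have [||a1 a2] := H s u s0 su; [by rewrite (le_trans ut)|by move: ts ut; lra|].
  have [|b1 b2] := H u t (le_trans s0 su) ut t1; first by move: ts su; lra.
  by apply: (calib_slope rho0 r1 r2 eps0 dgt0 dE) => //; rewrite distrC.
have ik := integrable_itvS (k_integrable eps) s0 t1.
have [dh1 dh2 _] := Hh.
have id := integrable_itvS (sqint_enorm dh1 dh2) s0 t1.
set I := Rintegral _ _ _; set J := \int[mu]_(u in `[s, t]) (enorm (dh u) ^+ 2).
have k0 u : u \in `[s, t] -> 0 <= k eps u.
  rewrite in_itv/= => /andP[su ut].
  have u01 : u \in `[0, 1] by rewrite in_itv/= (le_trans s0 su) (le_trans ut t1).
  have /andP[r1 r2] := Zh_sq u01.
  apply: addr_ge0; apply: mulr_ge0; rewrite ?sqr_ge0 ?(ltW eps0)//.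
  by rewrite -ZhE weight_levi// subr_ge0 invf_ge1 ?(lt_le_trans rho0)// ltW.
have I0 : 0 <= I by apply: Rintegral_ge0 => u; exact: k0.
have qI : c * J <= q * I.
  rewrite /I /J -!RintegralZl//; apply: le_Rintegral => //; [exact: integrable_scaler..|].
  move=> u ust; rewrite /k.
  have -> : q * (enorm (dh u) ^+ 2 * weight (h u) + eps * enorm (dh u) ^+ 2) =
    (weight (h u) + eps) * q * enorm (dh u) ^+ 2 by ring.
  by rewrite ler_wpM2r ?sqr_ge0// slope.
have AJ : A * q <= (t - s) * J.
  by rewrite /q (addrC (Zh s)); have := H1_path_holder Hh s0 st t1; rewrite -!ZhE levi_sub.
have A0 : 0 <= A by exact: sqr_ge0.
have ts0 : 0 < t - s by rewrite subr_gt0.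
(* Combines S^2 <= c A with A q <= (t - s) J and c J <= q I; the factor [q] cancels when c > 0, and
   for c <= 0 the sign of [I] is enough. *)
have SI : S ^+ 2 <= (t - s) * I.
  have [c0|c0] := leP c 0.
    apply: (le_trans SE); apply: (@le_trans _ _ 0); last by rewrite mulr_ge0// ltW.
    by rewrite mulr_le0_ge0.
  have qgt0 : 0 < q.
    rewrite lt_neqAle q0 andbT; apply/negP => /eqP q00.
    have := slope s; rewrite in_itv/= lexx st -q00 mulr0 => /(_ isT); move: c0; lra.
  rewrite -(ler_pM2l qgt0); apply: (@le_trans _ _ (c * ((t - s) * J))).
    apply: (@le_trans _ _ (c * (A * q))); last by rewrite ler_wpM2l// ltW.
    have -> : c * (A * q) = q * (c * A) by ring.
    by rewrite ler_wpM2l.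
  have -> : c * ((t - s) * J) = (t - s) * (c * J) by ring.
  have -> : q * ((t - s) * I) = (t - s) * (q * I) by ring.
  by rewrite ler_wpM2l// ltW.
rewrite -(ler_pM2l ts0); apply: le_trans SI.
by have := sqr_ge0 (S - L * (t - s)); lra.
Qed.

End competitor.

Theorem hooke_local_min : energy_local_min (hooke_path al be v e tau 0)
  (hooke_path al be v e tau 1) (hooke_path al be v e tau).
Proof.
exists (hooke_vel al be T v e tau); split; first exact: hooke_admissible.
have [d00 _ _ /andP[m00 m01]] := d0_bounds.
set d0 := D ^+ 2 * m0 / 8 in d00.
have ab0 : 0 < al * be by rewrite mulr_gt0.
exists (d0 * (al * be)); first by rewrite mulr_gt0.
move=> h dh [Hh hillh h0 h1] hd.
have [Zh ZhP] := levi_lift h zeta.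
have ZhE u : levi v e (Zh u) = h u by have [] := ZhP u.
have Hg := hooke_H1 al0 be0 ab1 v e tau'.
have close u : u \in `[0, 1] ->
    `|(Zh u).1 - (zeta u).1| <= d0 /\ `|(Zh u).2 - (zeta u).2| <= d0.
  move=> u01; apply: levi_lift_close; [exact: ltW|by have [] := ZhP u|exact: zeta_sq|].
  rewrite ZhE; apply: le_trans (ltW hd); exact: (H1_dist_sup Hg Hh (esym h0)).
have Zend u : h u = hooke_path al be v e tau u -> Zh u = zeta u.
  move=> hu; have [] := @levi_lift_close (Zh u) (zeta u) 0 (lexx _) _ (zeta_sq u).
  - by have [] := ZhP u.
  - by rewrite ZhE hu subrr mul0r /enorm expr0n/= addr0 sqrtr0.
  rewrite !normr_le0 !subr_eq0 => /eqP E1 /eqP E2.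
  by rewrite [LHS]surjective_pairing E1 E2.
rewrite hooke_energy//.
have [d1 d2 _] := Hh; have iM := sqint_enorm d1 d2.
have iW : mu.-integrable `[0, 1] (EFin \o (fun u => enorm (dh u) ^+ 2 * weight (h u))).
  apply: (@weight_integrable _ _ _ (m0 / 2)) => //; first by rewrite divr_gt0.
  by move=> u u01; rewrite -ZhE enorm_levi//; have /andP[] := Zh_sq hillh ZhE close u01.
pose Eh := \int[mu]_(u in `[0, 1]) (enorm (dh u) ^+ 2 * weight (h u)).
have -> : energy h dh = Eh%:E.
  by rewrite /Eh /Rintegral fineK//; exact: integrable_fin_num.
rewrite lee_fin.
pose M := \int[mu]_(u in `[0, 1]) (enorm (dh u) ^+ 2).
have M0 : 0 <= M by apply: Rintegral_ge0 => u _; exact: sqr_ge0.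
(* The length and constant speed of the arc. It is also the increment of S between the end points,
   so the summed bound 2 L L - L^2 is the energy 4 Lam^2 of the arc. *)
pose L := 2 * Lam al be T.
have H eps : 0 < eps -> 4 * Lam al be T ^+ 2 <= Eh + eps * M.
  move=> eps0; have [eta eta0 loc] := calib_local Hh hillh ZhE close L eps0.
  have ik := k_integrable Hh hillh ZhE close eps.
  pose k u := enorm (dh u) ^+ 2 * weight (h u) + eps * enorm (dh u) ^+ 2.
  pose f t := \int[mu]_(u in `[0, t]) k u - (2 * L * calib2 (Zh t) - L ^+ 2 * t).
  have : f 0 <= f 1.
    apply: (local_le_global eta0) => s t s0 st t1 ts.
    rewrite -subr_ge0; have -> : f t - f s =
        \int[mu]_(u in `[0, t]) k u - \int[mu]_(u in `[0, s]) k u -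
        (2 * L * (calib2 (Zh t) - calib2 (Zh s)) - L ^+ 2 * (t - s)) by rewrite /f; ring.
    by rewrite (Rintegral_itv_diff ik s0 st t1) subr_ge0; exact: loc.
  rewrite /f set_itv1 Rintegral_set1 (Zend 0 h0) (Zend 1 h1) /zeta (tau0 al0 be0 ab1 tauE)
    (tau1 al0 be0 ab1 tauE).
  have -> : \int[mu]_(u in `[0, 1]) k u = Eh + eps * M.
    rewrite RintegralD//; last exact: integrable_scaler.
    by rewrite RintegralZl.
  have := calib2_hooke; rewrite /L; set c1 := calib2 _; set c0 := calib2 _ => cE.
  have -> : c1 = 2 * Lam al be T + c0 by rewrite -cE; ring.
  lra.
rewrite leNgt; apply/negP => lt.
have M1 : 0 < 2 * (M + 1) by lra.
have := H ((4 * Lam al be T ^+ 2 - Eh) / (2 * (M + 1))).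
rewrite divr_gt0 ?subr_gt0// => /(_ isT).
rewrite -lerBlDl mulrAC ler_pdivlMr//; nra.
Qed.

End hooke_min.

(** * From Kepler solutions to oscillator arcs *)

Section kepler.
Context {R : realType}.

Lemma is_derive_cvg (V : normedModType R) (f : R -> V) (t : R) (d : V) :
  is_derive t 1 f d <-> h^-1 *: (f (h + t) - f t) @[h --> 0^'] --> d.
Proof.
have E : (fun h : R => h^-1 *: (f (h + t) - f t)) =
         (fun h : R => h^-1 *: ((f \o shift t) (h *: 1) - f t)).
  by apply/funext => h /=; rewrite /GRing.scale/= mulr1.
rewrite E; split => [[df <-]|H]; first exact: df.
split; first by apply/cvg_ex; exists d.
exact/cvg_lim.
Qed.

Lemma is_derive_pair (f : R -> R * R) (t : R) (d : R * R) : is_derive t 1 f d ->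
  is_derive t 1 (fun t => (f t).1) d.1 /\ is_derive t 1 (fun t => (f t).2) d.2.
Proof.
move=> /is_derive_cvg H; split; apply/is_derive_cvg.
  apply: (@cvg_comp _ _ _ (fun h => h^-1 *: (f (h + t) - f t)) fst _ _ _ H).
  exact: cvg_fst.
apply: (@cvg_comp _ _ _ (fun h => h^-1 *: (f (h + t) - f t)) snd _ _ _ H).
exact: cvg_snd.
Qed.

Lemma within_continuous_pair (A : set R) (f : R -> R * R) : {within A, continuous f} ->
  {within A, continuous (fun t => (f t).1)} /\ {within A, continuous (fun t => (f t).2)}.
Proof.
move=> cf; split => t.
  by apply: (cvg_comp _ _ (cf t)); exact: cvg_fst.
by apply: (cvg_comp _ _ (cf t)); exact: cvg_snd.
Qed.

Lemma derive_zero_cst (f : R -> R) (a b : R) :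
  (forall t : R, t \in `]a, b[ -> is_derive t 1 f 0) -> {within `[a, b], continuous f} ->
  forall t, t \in `[a, b] -> f t = f a.
Proof.
move=> f' cf t; rewrite in_itv/= => /andP[at_ tb].
have ct : {within `[a, t], continuous f}.
  by apply: continuous_subspaceW cf; apply: subset_itv; rewrite bnd_simp.
have f't (u : R) : u \in `]a, t[ -> is_derive u 1 f ((fun=> 0) u).
  rewrite in_itv/= => /andP[au ut]; apply: f'; rewrite in_itv/= au.
  exact: lt_le_trans ut tb.
have [c _] := MVT_segment at_ f't ct.
by rewrite mul0r => /eqP; rewrite subr_eq0 => /eqP.
Qed.

Lemma enorm_polar (r phi : R) : 0 < r -> enorm (polar r phi) = r.
Proof.
move=> r0; rewrite /enorm /polar /=.
have -> : (r * cos phi) ^+ 2 + (r * sin phi) ^+ 2 = r ^+ 2 * (cos phi ^+ 2 + sin phi ^+ 2) by ring.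
by rewrite cos2Dsin2 mulr1 sqrtr_sqr gtr0_norm.
Qed.

(** Scalar form, with D = x . v, so that r' = D / r. From the equation D' = |v|^2 - 1/r, which the
    energy relation turns into 1/r - 2. The equations live on the open interval; continuity on the
    closed one will carry their integrals to the end points. *)
Lemma kepler_scalar (p q : R * R) (w : R) (x : R -> R * R) (c : R) :
  kepler_solution p q w x -> angular_momentum w x c ->
  exists D phi : R -> R, let r t := enorm (x t) in
  [/\ {within `[- w, w], continuous r}, {within `[- w, w], continuous D} &
      {within `[- w, w], continuous phi}] /\
  [/\ (forall t, t \in `[- w, w] -> 0 < r t /\ x t = polar (r t) (phi t)),
      (forall t : R, t \in `]- w, w[ -> is_derive t 1 r (D t / r t)),
      (forall t : R, t \in `]- w, w[ -> is_derive t 1 D ((r t)^-1 - 2)),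
      (forall t : R, t \in `]- w, w[ -> is_derive t 1 phi (c / r t ^+ 2)) &
      (forall t, t \in `]- w, w[ -> D t ^+ 2 + c ^+ 2 = 2 * r t - 2 * r t ^+ 2)].
Proof.
move=> [w0 [_ [_ [_ [v [a [[cx cv ca xv'] aE vE]]]]]]] [rr [phi [dphi [cphi xE phi']]]].
have rE t : t \in `[- w, w] -> enorm (x t) = rr t.
  by move=> tw; have [r0 ->] := xE t tw; exact: enorm_polar.
pose D t := (x t).1 * (v t).1 + (x t).2 * (v t).2.
have [cx1 cx2] := within_continuous_pair cx; have [cv1 cv2] := within_continuous_pair cv.
have oc t : t \in `]- w, w[ -> t \in `[- w, w] by exact: subset_itv_oo_cc.
have r0 t : t \in `[- w, w] -> 0 < enorm (x t).
  by move=> tw; rewrite rE//; have [] := xE t tw.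
have r' (t : R) : t \in `]- w, w[ -> is_derive t 1 (fun t => enorm (x t)) (D t / enorm (x t)).
  move=> tw; have [/is_derive_pair[d1 d2] _] := xv' t tw.
  have rt := r0 t (oc t tw).
  have s0 : 0 < (x t).1 ^+ 2 + (x t).2 ^+ 2 by rewrite -enorm_sq exprn_gt0.
  have ds := is_derive1_sqrt s0.
  have di : is_derive t 1 (fun t => (x t).1 ^+ 2 + (x t).2 ^+ 2) (2 * D t).
    by apply: is_derive_eq; rewrite /GRing.scale/= /D; ring.
  have := @is_derive1_comp R Num.sqrt (fun t => (x t).1 ^+ 2 + (x t).2 ^+ 2) t _ _ ds di.
  move=> H; apply: is_derive_eq; rewrite -/(enorm (x t)); field.
  by rewrite gt_eqF.
have D' (t : R) : t \in `]- w, w[ -> is_derive t 1 D ((enorm (x t))^-1 - 2).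
  move=> tw; have [/is_derive_pair[d1 d2] /is_derive_pair[e1 e2]] := xv' t tw.
  have rt := r0 t (oc t tw).
  have E := vE t (oc t tw); have rsq := enorm_sq (x t).
  rewrite /D; apply: is_derive_eq; rewrite /GRing.scale/= (aE t tw) /=.
  rewrite enorm_sq in E.
  have V2 : (v t).1 ^+ 2 + (v t).2 ^+ 2 = 2 * (enorm (x t))^-1 - 2 by lra.
  transitivity ((v t).1 ^+ 2 + (v t).2 ^+ 2
    - (enorm (x t) ^+ 3)^-1 * ((x t).1 ^+ 2 + (x t).2 ^+ 2)).
    by rewrite /GRing.scale/=; ring.
  by rewrite V2 -rsq; field; rewrite gt_eqF.
have ph' (t : R) : t \in `]- w, w[ -> is_derive t 1 phi (c / enorm (x t) ^+ 2).
  move=> tw; have [d E] := phi' t tw; apply: is_derive_eq.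
  by rewrite -E rE ?oc//; field; have [/gt_eqF->] := xE t (oc t tw).
exists D, phi => r; split; split => //.
- have cS : {within `[- w, w], continuous (fun t => (x t).1 ^+ 2 + (x t).2 ^+ 2)}.
    by move=> t; apply: cvgD; apply: cvgM; first [exact: cx1 | exact: cx2].
  move=> t; apply: (@cvg_comp _ _ _ (fun t => (x t).1 ^+ 2 + (x t).2 ^+ 2) Num.sqrt _ _ _ (cS t)).
  exact: sqrt_continuous.
- by move=> t; apply: cvgD; apply: cvgM; first [exact: cx1 | exact: cx2 | exact: cv1 | exact: cv2].
- by move=> t tw; split; [exact: r0|rewrite /r rE//; have [] := xE t tw].
- move=> t tw; have [/is_derive_pair[d1 d2] _] := xv' t tw.
  have rt := r0 t (oc t tw).
  have d3 := r' t tw; have d4 := ph' t tw.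
  (* The angular momentum is given through the polar form, so the velocity is computed a second time
     from it; the energy relation then becomes D^2 + c^2 = 2 r - 2 r^2. *)
  have e1 : is_derive t 1 (fun t => (x t).1)
    ((D t / enorm (x t)) * cos (phi t) - enorm (x t) * sin (phi t) * (c / enorm (x t) ^+ 2)).
    apply: (@near_eq_is_derive _ _ _ (fun t => enorm (x t) * cos (phi t))).
      near=> u; have uw : u \in `]- w, w[ by near: u; exact: near_in_itvoo.
      by have [_] := xE u (oc u uw); rewrite (rE u (oc u uw)) => -> /=.
    by apply: is_derive_eq; rewrite /GRing.scale/=; ring.
  have e2 : is_derive t 1 (fun t => (x t).2)
    ((D t / enorm (x t)) * sin (phi t) + enorm (x t) * cos (phi t) * (c / enorm (x t) ^+ 2)).
    apply: (@near_eq_is_derive _ _ _ (fun t => enorm (x t) * sin (phi t))).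
      near=> u; have uw : u \in `]- w, w[ by near: u; exact: near_in_itvoo.
      by have [_] := xE u (oc u uw); rewrite (rE u (oc u uw)) => -> /=.
    by apply: is_derive_eq; rewrite /GRing.scale/=; ring.
  have E := vE t (oc t tw); rewrite enorm_sq in E.
  have [_ E1] := d1; have [_ E1'] := e1; have [_ E2] := d2; have [_ E2'] := e2.
  rewrite -E1 -E2 E1' E2' in E; rewrite /r.
  have V2 : (D t ^+ 2 + c ^+ 2) * (enorm (x t)) ^- 2 = 2 * (enorm (x t))^-1 - 2.
    transitivity ((D t ^+ 2 + c ^+ 2) * (enorm (x t)) ^- 2 * (cos (phi t) ^+ 2 + sin (phi t) ^+ 2)).
      by rewrite cos2Dsin2 mulr1.
    transitivity ((D t / enorm (x t) * cos (phi t)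
      - enorm (x t) * sin (phi t) * (c / enorm (x t) ^+ 2)) ^+ 2 +
      (D t / enorm (x t) * sin (phi t) + enorm (x t) * cos (phi t) * (c / enorm (x t) ^+ 2)) ^+
        2); last by lra.
    by field; rewrite gt_eqF.
  have -> : D t ^+ 2 + c ^+ 2 = (D t ^+ 2 + c ^+ 2) * (enorm (x t)) ^- 2 * enorm (x t) ^+ 2.
    by field; rewrite gt_eqF.
  by rewrite V2; field; rewrite gt_eqF.
Unshelve. all: by end_near. Qed.

(* With [k = 1 / sqrt 2] and the fictitious time [s' = k / r], the square root
   [Z] of the path solves [Z'' = - Z]; since [D' = 1 / r - 2], the fictitious
   time is [k (D + 2 t)] (Kepler's equation). *)
Lemma levi_civita (r D phi : R -> R) (w c k s0 : R) : 0 < w -> k ^+ 2 = 1 / 2 ->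
  {within `[- w, w], continuous r} -> {within `[- w, w], continuous D} ->
  {within `[- w, w], continuous phi} ->
  (forall t, t \in `[- w, w] -> 0 < r t) ->
  (forall t : R, t \in `]- w, w[ -> is_derive t 1 r (D t / r t)) ->
  (forall t : R, t \in `]- w, w[ -> is_derive t 1 D ((r t)^-1 - 2)) ->
  (forall t : R, t \in `]- w, w[ -> is_derive t 1 phi (c / r t ^+ 2)) ->
  (forall t, t \in `]- w, w[ -> D t ^+ 2 + c ^+ 2 = 2 * r t - 2 * r t ^+ 2) ->
  let s t := k * (D t + 2 * t) + s0 in
  exists a1 a2 b1 b2 : R, [/\ a1 ^+ 2 + a2 ^+ 2 + b1 ^+ 2 + b2 ^+ 2 = 1,
    a1 * b2 - a2 * b1 = k * c &
    forall t, t \in `[- w, w] ->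
      [/\ Num.sqrt (r t) * cos (phi t / 2) = a1 * cos (s t) + b1 * sin (s t),
        Num.sqrt (r t) * sin (phi t / 2) = a2 * cos (s t) + b2 * sin (s t) &
        D t * k = (a1 * cos (s t) + b1 * sin (s t)) * (b1 * cos (s t) - a1 * sin (s t))
              + (a2 * cos (s t) + b2 * sin (s t)) * (b2 * cos (s t) - a2 * sin (s t))]].
Proof.
move=> w0 k2 cr cD cphi r0 r' D' phi' E s.
have oc t : t \in `]- w, w[ -> t \in `[- w, w] by exact: subset_itv_oo_cc.
pose Q t := Num.sqrt (r t); pose psi t := phi t / 2.
have Q0 t : t \in `[- w, w] -> 0 < Q t by move=> tw; rewrite sqrtr_gt0 r0.
have Q2 t : t \in `[- w, w] -> r t = Q t ^+ 2 by move=> tw; rewrite sqr_sqrtr// ltW// r0.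
pose z1 t := Q t * cos (psi t); pose z2 t := Q t * sin (psi t).
(* (p1, p2) is the derivative of (z1, z2) with respect to the fictitious time. *)
pose p1 t := (D t * cos (psi t) - c * sin (psi t)) * k * (Q t)^-1.
pose p2 t := (D t * sin (psi t) + c * cos (psi t)) * k * (Q t)^-1.
have Q' (t : R) : t \in `]- w, w[ -> is_derive t 1 Q (D t * (2 * Q t ^+ 3)^-1).
  move=> tw; have rt := r0 t (oc t tw).
  have := @is_derive1_comp R Num.sqrt r t _ _ (is_derive1_sqrt rt) (r' t tw).
  move=> H; apply: is_derive_eq; rewrite -/(Q t) (Q2 t (oc t tw)); field.
  by rewrite gt_eqF// Q0// oc.
have psi' (t : R) : t \in `]- w, w[ -> is_derive t 1 psi (c * (2 * Q t ^+ 4)^-1).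
  move=> tw; have d := phi' t tw; rewrite /psi; apply: is_derive_eq.
  rewrite /GRing.scale/= (Q2 t (oc t tw)); field.
  by rewrite gt_eqF// Q0// oc.
have s' (t : R) : t \in `]- w, w[ -> is_derive t 1 s (k * (Q t ^+ 2)^-1).
  move=> tw; have d := D' t tw; rewrite /s; apply: is_derive_eq.
  by rewrite /GRing.scale/= (Q2 t (oc t tw)); ring.
have Qn t : t \in `]- w, w[ -> Q t != 0 by move=> tw; rewrite gt_eqF// Q0// oc.
have D'' (t : R) : t \in `]- w, w[ -> is_derive t 1 D ((Q t ^+ 2)^-1 - 2).
  by move=> tw; rewrite -Q2 ?oc//; exact: D'.
have E' t : t \in `]- w, w[ -> D t ^+ 2 + c ^+ 2 = 2 * Q t ^+ 2 - 2 * Q t ^+ 4.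
  by move=> tw; rewrite E// Q2 ?oc//; ring.
have z1' (t : R) : t \in `]- w, w[ -> is_derive t 1 z1 (p1 t * k * (Q t ^+ 2)^-1).
  move=> tw; have := (Q' t tw, psi' t tw, Qn t tw) => -[[dQ dpsi] Qt].
  rewrite /z1; apply: is_derive_eq; rewrite /GRing.scale/= /p1.
  transitivity ((D t * cos (psi t) - c * sin (psi t)) * k ^+ 2 * (Q t)^-1 ^+ 3); last by field.
  by rewrite k2; field.
have z2' (t : R) : t \in `]- w, w[ -> is_derive t 1 z2 (p2 t * k * (Q t ^+ 2)^-1).
  move=> tw; have := (Q' t tw, psi' t tw, Qn t tw) => -[[dQ dpsi] Qt].
  rewrite /z2; apply: is_derive_eq; rewrite /GRing.scale/= /p2.
  transitivity ((D t * sin (psi t) + c * cos (psi t)) * k ^+ 2 * (Q t)^-1 ^+ 3); last by field.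
  by rewrite k2; field.
have p1' (t : R) : t \in `]- w, w[ -> is_derive t 1 p1 (- (z1 t * k * (Q t ^+ 2)^-1)).
  move=> tw; have := (Q' t tw, psi' t tw, Qn t tw, D'' t tw) => -[[[dQ dpsi] Qt] dD].
  rewrite /p1; apply: is_derive_eq; rewrite /GRing.scale/= /z1.
  transitivity ((2 * Q t ^+ 2 - 4 * Q t ^+ 4 - (D t ^+ 2 + c ^+ 2)) * cos (psi t) * k *
    (2 * Q t ^+ 5)^-1).
    by field.
  by rewrite E'//; field.
have p2' (t : R) : t \in `]- w, w[ -> is_derive t 1 p2 (- (z2 t * k * (Q t ^+ 2)^-1)).
  move=> tw; have := (Q' t tw, psi' t tw, Qn t tw, D'' t tw) => -[[[dQ dpsi] Qt] dD].
  rewrite /p2; apply: is_derive_eq; rewrite /GRing.scale/= /z2.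
  transitivity ((2 * Q t ^+ 2 - 4 * Q t ^+ 4 - (D t ^+ 2 + c ^+ 2)) * sin (psi t) * k *
    (2 * Q t ^+ 5)^-1).
    by field.
  by rewrite E'//; field.
have cM (f g : R -> R) : {within `[- w, w], continuous f} -> {within `[- w, w], continuous g} ->
  {within `[- w, w], continuous (fun t => f t * g t)}.
  by move=> cf cg t; apply: cvgM; [exact: cf|exact: cg].
have cA (f g : R -> R) : {within `[- w, w], continuous f} -> {within `[- w, w], continuous g} ->
  {within `[- w, w], continuous (fun t => f t + g t)}.
  by move=> cf cg t; apply: cvgD; [exact: cf|exact: cg].
have cN (f : R -> R) : {within `[- w, w], continuous f} ->
  {within `[- w, w], continuous (fun t => - f t)}.
  by move=> cf t; apply: cvgN; exact: cf.
have cK (a : R) : {within `[- w, w], continuous (fun=> a)} by move=> t; exact: cvg_cst.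
have cF (f g : R -> R) : continuous f -> {within `[- w, w], continuous g} ->
  {within `[- w, w], continuous (fun t => f (g t))}.
  by move=> cf cg t; apply: (@cvg_comp _ _ _ g f _ _ _ (cg t)); exact: cf.
have cQ : {within `[- w, w], continuous Q} by apply: cF cr; exact: sqrt_continuous.
have cpsi : {within `[- w, w], continuous psi} by apply: cM.
have ccos : {within `[- w, w], continuous (fun t => cos (psi t))} by apply: cF => //;
  exact: continuous_cos.
have csin : {within `[- w, w], continuous (fun t => sin (psi t))} by apply: cF => //;
  exact: continuous_sin.
have cid : {within `[- w, w], continuous (fun t => t)} by apply: continuous_within => t;
  exact: cvg_id.
have cs : {within `[- w, w], continuous s}.
  by apply: (cA) => //; apply: (cM) => //; apply: (cA) => //; exact: cM.
have cs1 : {within `[- w, w], continuous (fun t => cos (s t))} by apply: cF => //;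
  exact: continuous_cos.
have cs2 : {within `[- w, w], continuous (fun t => sin (s t))} by apply: cF => //;
  exact: continuous_sin.
have cV : {within `[- w, w], continuous (fun t => (Q t)^-1)}.
  apply/subspace_continuousP => t tw; apply: cvgV; first by rewrite gt_eqF// Q0.
  by move/subspace_continuousP: cQ; exact.
have cz1 : {within `[- w, w], continuous z1} by exact: cM.
have cz2 : {within `[- w, w], continuous z2} by exact: cM.
have cp1 : {within `[- w, w], continuous p1}.
  by apply: (cM) => //; apply: (cM) => //; apply: cA; [exact: cM|apply: cN; exact: cM].
have cp2 : {within `[- w, w], continuous p2}.
  by apply: (cM) => //; apply: (cM) => //; apply: cA; exact: cM.
have cst (z p : R -> R) : {within `[- w, w], continuous z} -> {within `[- w, w], continuous p} ->
    (forall t : R, t \in `]- w, w[ -> is_derive t 1 z (p t * k * (Q t ^+ 2)^-1)) ->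
    (forall t : R, t \in `]- w, w[ -> is_derive t 1 p (- (z t * k * (Q t ^+ 2)^-1))) ->
    exists a b : R, forall t, t \in `[- w, w] ->
      z t = a * cos (s t) + b * sin (s t) /\ p t = b * cos (s t) - a * sin (s t).
  move=> cz cp z' p'.
  (* Rotating (z, p) back by the angle s gives the two amplitudes, constant because z' = p s' and p'
     = - z s'. *)
  pose A t := z t * cos (s t) + - (p t * sin (s t)); pose B t := z t * sin (s t) + p t * cos (s t).
  exists (A (- w)), (B (- w)) => t tw.
  rewrite -(derive_zero_cst (f := A) _ _ tw); last 2 first.
  - move=> u uw; have := (z' u uw, p' u uw, s' u uw) => -[[? ?] ?].
    by rewrite /A; apply: is_derive_eq; rewrite /GRing.scale/=; ring.
  - by apply: cA; [exact: cM|apply: cN; exact: cM].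
  rewrite -(derive_zero_cst (f := B) _ _ tw); last 2 first.
  - move=> u uw; have := (z' u uw, p' u uw, s' u uw) => -[[? ?] ?].
    by rewrite /B; apply: is_derive_eq; rewrite /GRing.scale/=; ring.
  - by apply: cA; exact: cM.
  split.
    transitivity (z t * (cos (s t) ^+ 2 + sin (s t) ^+ 2)); first by rewrite cos2Dsin2 mulr1.
    by rewrite /A /B; ring.
  transitivity (p t * (cos (s t) ^+ 2 + sin (s t) ^+ 2)); first by rewrite cos2Dsin2 mulr1.
  by rewrite /A /B; ring.
have [a1 [b1 H1]] := cst _ _ cz1 cp1 z1' p1'.
have [a2 [b2 H2]] := cst _ _ cz2 cp2 z2' p2'.
have w00 : (0 : R) \in `]- w, w[ by rewrite in_itv/= oppr_lt0 w0.
exists a1, a2, b1, b2; split.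
(* Both identities compare an invariant of the oscillator with its value at [t = 0]: the energy
   here, the angular momentum next. *)
- have [zE1 pE1] := H1 0 (oc _ w00); have [zE2 pE2] := H2 0 (oc _ w00).
  transitivity ((a1 ^+ 2 + a2 ^+ 2 + b1 ^+ 2 + b2 ^+ 2) * (cos (s 0) ^+ 2 + sin (s 0) ^+ 2)).
    by rewrite cos2Dsin2 mulr1.
  transitivity (z1 0 ^+ 2 + z2 0 ^+ 2 + p1 0 ^+ 2 + p2 0 ^+ 2).
    by rewrite zE1 zE2 pE1 pE2; ring.
  rewrite /z1 /z2 /p1 /p2.
  transitivity ((cos (psi 0) ^+ 2 + sin (psi 0) ^+ 2) *
    (Q 0 ^+ 2 + (D 0 ^+ 2 + c ^+ 2) * k ^+ 2 * (Q 0)^-1 ^+ 2)); first by ring.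
  by rewrite cos2Dsin2 k2 E'//; field; exact: Qn.
- have [zE1 pE1] := H1 0 (oc _ w00); have [zE2 pE2] := H2 0 (oc _ w00).
  transitivity ((a1 * b2 - a2 * b1) * (cos (s 0) ^+ 2 + sin (s 0) ^+ 2)).
    by rewrite cos2Dsin2 mulr1.
  transitivity (z1 0 * p2 0 - z2 0 * p1 0).
    by rewrite zE1 zE2 pE1 pE2; ring.
  rewrite /z1 /z2 /p1 /p2.
  transitivity ((cos (psi 0) ^+ 2 + sin (psi 0) ^+ 2) * (k * c)); first by field; exact: Qn.
  by rewrite cos2Dsin2 mul1r.
- move=> t tw; have [zE1 pE1] := H1 t tw; have [zE2 pE2] := H2 t tw.
  split => //; rewrite -pE1 -pE2 -zE1 -zE2 /z1 /z2 /p1 /p2.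
  transitivity ((cos (psi t) ^+ 2 + sin (psi t) ^+ 2) * (D t * k));
    first by rewrite cos2Dsin2 mul1r.
  by field; rewrite gt_eqF// Q0.
Qed.

Lemma polar_sqrt (r phi : R) : 0 <= r -> polar r phi =
  ((Num.sqrt r * cos (phi / 2)) ^+ 2 - (Num.sqrt r * sin (phi / 2)) ^+ 2,
   2 * (Num.sqrt r * cos (phi / 2) * (Num.sqrt r * sin (phi / 2)))).
Proof.
move=> r0; have E := sqr_sqrtr r0.
rewrite /polar {1 2}(_ : phi = phi / 2 + phi / 2); last by field.
rewrite cosD sinD; congr (_, _); rewrite -{1}E; ring.
Qed.

(** Z(s + pi) = - Z(s) has the same square, so an arc with 2 T >= pi would come back to its starting
    point. *)
Lemma pi_rotate_inj (w T : R) (x : R -> R * R) (s : R -> R) (a1 a2 b1 b2 : R) :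
  0 < w -> self_intersection_free w x -> {within `[- w, w], continuous s} ->
  s (- w) = - T -> s w = T -> 0 < T ->
  (forall t, t \in `[- w, w] -> x t =
     ((a1 * cos (s t) + b1 * sin (s t)) ^+ 2 - (a2 * cos (s t) + b2 * sin (s t)) ^+ 2,
      2 * ((a1 * cos (s t) + b1 * sin (s t)) * (a2 * cos (s t) + b2 * sin (s t))))) ->
  T < pi / 2.
Proof.
move=> w0 inj cs sN sw T0 xE; rewrite ltNge; apply/negP => piT.
have pi0 := pi_gt0 R.
have ww : - w <= w by lra.
have [|t tw tE] := IVT ww cs (v := - T + pi).
  by rewrite sN sw ge_min le_max; apply/andP; split; apply/orP; [left|right]; lra.
have Nw : - w \in `[- w, w] by rewrite in_itv/= lexx ww.
have : t = - w.
  apply: inj => //; rewrite !xE// tE sN cosDpi sinDpi; congr (_, _); ring.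
by move=> tN; move: tE; rewrite tN sN; lra.
Qed.

(** The vectors a and b are orthogonal, hence semi-axes of an ellipse. Then [al] is |a|, [e] is the
    sign of [c], b is e be / al times a turned by a right angle, and [v] is the complex square of a
    / al. *)
Lemma frame (a1 a2 b1 b2 c k : R) : 0 < k -> c != 0 ->
  a1 ^+ 2 + a2 ^+ 2 + b1 ^+ 2 + b2 ^+ 2 = 1 -> a1 * b2 - a2 * b1 = k * c ->
  a1 * b1 + a2 * b2 = 0 ->
  exists al be e : R, exists v : R * R,
    [/\ 0 < al, 0 < be & al ^+ 2 + be ^+ 2 = 1] /\ [/\ enorm v = 1, e ^+ 2 = 1 & 0 < e * c] /\
    [/\ a1 ^+ 2 + a2 ^+ 2 = al ^+ 2, b1 ^+ 2 + b2 ^+ 2 = be ^+ 2 &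
    forall C S, ((a1 * C + b1 * S) ^+ 2 - (a2 * C + b2 * S) ^+ 2,
      2 * ((a1 * C + b1 * S) * (a2 * C + b2 * S))) = levi v e (al * C, be * S)].
Proof.
move=> k0 c0 one det dot.
have kc : k * c != 0 by rewrite mulf_neq0// gt_eqF.
have A0 : 0 < a1 ^+ 2 + a2 ^+ 2.
  rewrite lt_neqAle addr_ge0 ?sqr_ge0// andbT eq_sym; apply: contra kc => /eqP H.
  have : a1 == 0 /\ a2 == 0.
    by move/eqP: H; rewrite paddr_eq0 ?sqr_ge0// !sqrf_eq0 => /andP[].
  by rewrite -det => -[/eqP-> /eqP->]; rewrite !mul0r subr0.
pose al := Num.sqrt (a1 ^+ 2 + a2 ^+ 2).
have al0 : 0 < al by rewrite sqrtr_gt0.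
have al2 : al ^+ 2 = a1 ^+ 2 + a2 ^+ 2 by rewrite sqr_sqrtr// ltW.
pose e := Num.sg c; have e2 : e ^+ 2 = 1 by rewrite sqr_sg c0.
have ec : 0 < e * c by rewrite -normrEsg normr_gt0.
pose be := e * (k * c) / al.
have be0 : 0 < be by rewrite /be mulrCA divr_gt0// mulr_gt0.
have aln : al != 0 by rewrite gt_eqF.
have bE1 : b1 = - (e * be / al) * a2.
  rewrite /be -det; transitivity (- (e ^+ 2 * (a1 * b2 * a2 - a2 ^+ 2 * b1) / al ^+ 2));
    last by field.
  have -> : a1 * b2 * a2 = - (a1 ^+ 2 * b1).
    by transitivity (a1 * (a1 * b1 + a2 * b2) - a1 ^+ 2 * b1); [ring|rewrite dot; ring].
  by rewrite e2 al2; field; rewrite -al2 expf_neq0.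
have bE2 : b2 = (e * be / al) * a1.
  rewrite /be -det; transitivity (e ^+ 2 * (a1 ^+ 2 * b2 - a2 * b1 * a1) / al ^+ 2); last by field.
  have -> : a2 * b1 * a1 = - (a2 ^+ 2 * b2).
    by transitivity (a2 * (a1 * b1 + a2 * b2) - a2 ^+ 2 * b2); [ring|rewrite dot; ring].
  by rewrite e2 al2; field; rewrite -al2 expf_neq0.
have be2 : b1 ^+ 2 + b2 ^+ 2 = be ^+ 2.
  rewrite bE1 bE2; transitivity (e ^+ 2 * be ^+ 2 / al ^+ 2 * (a1 ^+ 2 + a2 ^+ 2)); first by field.
  by rewrite -al2 e2; field.
pose v := ((a1 ^+ 2 - a2 ^+ 2) / al ^+ 2, 2 * (a1 * a2) / al ^+ 2).
exists al, be, e, v; split; first by split => //; rewrite al2 -be2 -one; ring.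
split; split => //.
  rewrite /enorm /v /=.
  have -> : ((a1 ^+ 2 - a2 ^+ 2) / al ^+ 2) ^+ 2 + (2 * (a1 * a2) / al ^+ 2) ^+ 2 = 1.
    transitivity ((a1 ^+ 2 + a2 ^+ 2) ^+ 2 / al ^+ 4); first by field.
    by rewrite -al2; field.
  exact: sqrtr1.
move=> C S; rewrite /levi /v /= bE1 bE2.
have E1 : (be * S) ^+ 2 = e ^+ 2 * (be * S) ^+ 2 by rewrite e2 mul1r.
congr (_, _).
  rewrite E1; transitivity (a1 ^+ 2 / al ^+ 2 * al ^+ 2 * C ^+ 2
    - a2 ^+ 2 / al ^+ 2 * al ^+ 2 * C ^+ 2
    - 4 * a1 * a2 * e * be * S * C / al + (e * be * S / al) ^+ 2 * (a2 ^+ 2 - a1 ^+ 2)).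
    by field.
  by field.
by rewrite E1; field.
Qed.

Theorem kepler_hooke (p q : R * R) (w : R) (x : R -> R * R) (c : R) :
  kepler_solution p q w x -> self_intersection_free w x -> angular_momentum w x c ->
  c != 0 -> enorm p = enorm q ->
  exists al be T e : R, exists (v : R * R) (tau : R -> R),
    [/\ 0 < al, 0 < be & al ^+ 2 + be ^+ 2 = 1] /\ (0 < T /\ T < pi / 2) /\
    [/\ enorm v = 1, e ^+ 2 = 1 & 0 < e * c] /\
    [/\ (forall u, Lam al be (tau u) = (2 * u - 1) * Lam al be T),
      (forall u : R, is_derive u 1 tau (Lam al be T * (lam al be (tau u))^-1)) &
      forall u, u \in `[0, 1] -> geodesic w x u = hooke_path al be v e tau u] /\
    [/\ p = levi v e (al * cos (- T), be * sin (- T)),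
      q = levi v e (al * cos T, be * sin T) & enorm (x 0) = al ^+ 2].
Proof.
move=> Hk inj Ha c0 pq; have [D [phi [[cr cD cphi] [xP r' D' phi' E]]]] := kepler_scalar Hk Ha.
have [w0 [_ [xp [xq _]]]] := Hk.
pose r t := enorm (x t).
have ww : - w <= w by lra.
have oc t : t \in `]- w, w[ -> t \in `[- w, w] by exact: subset_itv_oo_cc.
have Nw : - w \in `[- w, w] by rewrite in_itv/= lexx ww.
have Pw : w \in `[- w, w] by rewrite in_itv/= lexx ww.
have w00 : (0 : R) \in `]- w, w[ by rewrite in_itv/= oppr_lt0 w0.
have r0 t : t \in `[- w, w] -> 0 < r t by move=> /xP[].
have [k k0 k2] : exists2 k : R, 0 < k & k ^+ 2 = 1 / 2.
  by exists (Num.sqrt (1 / 2)); [rewrite sqrtr_gt0; lra|rewrite sqr_sqrtr//; lra].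
(* This shift centres the fictitious time, s(- w) = - s(w); it turns out to be 0 once D is known to
   be odd in s. *)
pose s0 := - (k * (D w + D (- w)) / 2).
pose s t := k * (D t + 2 * t) + s0.
have [a1 [a2 [b1 [b2 [one det H]]]]] := levi_civita s0 w0 k2 cr cD cphi r0 r' D' phi' E.
rewrite -/s in H.
have cs : {within `[- w, w], continuous s}.
  move=> t; apply: cvgD; last exact: cvg_cst.
  apply: cvgM; first exact: cvg_cst.
  apply: cvgD; first exact: cD.
  by apply: cvgM; [exact: cvg_cst|apply: (@continuous_within _ _ id); move=> u; exact: cvg_id].
have s' (t : R) : t \in `]- w, w[ -> is_derive t 1 s (k * (r t)^-1).
  move=> tw; have d := D' t tw; rewrite /s; apply: is_derive_eq.
  by rewrite /GRing.scale/= /r; ring.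
have sN : s (- w) = - s w by rewrite /s /s0; field.
have [T TE] : exists T, s w = T by eexists.
rewrite TE in sN.
have T0 : 0 < T.
  have ww' : - w < w by lra.
  have [u /oc uw] := MVT ww' s' cs.
  rewrite sN TE opprK => H1; have : 0 < T + T by rewrite H1 mulr_gt0 ?divr_gt0 ?r0//; lra.
  lra.
have xE t : t \in `[- w, w] -> x t =
     ((a1 * cos (s t) + b1 * sin (s t)) ^+ 2 - (a2 * cos (s t) + b2 * sin (s t)) ^+ 2,
      2 * ((a1 * cos (s t) + b1 * sin (s t)) * (a2 * cos (s t) + b2 * sin (s t)))).
  move=> tw; have [rt ->] := xP t tw; have [<- <- _] := H t tw.
  by rewrite polar_sqrt// ltW.
have Tpi : T < pi / 2 := pi_rotate_inj w0 inj cs sN TE T0 xE.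
have sT0 : 0 < sin T by rewrite sin_gt0_pi//; apply/andP; split; have := pi_gt0 R; lra.
have cT0 : 0 < cos T by rewrite cos_gt0_pihalf//; apply/andP; split; lra.
have rE t : t \in `[- w, w] -> r t =
  (a1 * cos (s t) + b1 * sin (s t)) ^+ 2 + (a2 * cos (s t) + b2 * sin (s t)) ^+ 2.
  move=> tw; have [<- <- _] := H t tw; rewrite !exprMn sqr_sqrtr; last by rewrite ltW// r0.
  by rewrite -mulrDr cos2Dsin2 mulr1.
(* |Z(T)|^2 - |Z(- T)|^2 = 4 (a . b) cos T sin T, so |p| = |q| makes the amplitude vectors
   orthogonal. *)
have dot : a1 * b1 + a2 * b2 = 0.
  have := pq; rewrite -xp -xq -/(r (- w)) -/(r w) !rE// sN TE sinN cosN => dE.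
  have : (a1 * b1 + a2 * b2) * (4 * cos T * sin T) = 0.
    transitivity ((a1 * cos T + b1 * sin T) ^+ 2 + (a2 * cos T + b2 * sin T) ^+ 2 -
      ((a1 * cos T + b1 * - sin T) ^+ 2 + (a2 * cos T + b2 * - sin T) ^+ 2)); first by ring.
    by rewrite dE subrr.
  by move/eqP; rewrite mulf_eq0 => /orP[/eqP//|]; rewrite gt_eqF// !mulr_gt0.
have [al [be [e [v [[al0 be0 ab1] [[v1 e1 ec] [aE bE F]]]]]]] := frame k0 c0 one det dot.
have xL t : t \in `[- w, w] -> x t = levi v e (al * cos (s t), be * sin (s t)).
  by move=> tw; rewrite xE// F.
have DE t : t \in `[- w, w] -> D t * k = (be ^+ 2 - al ^+ 2) * (sin (s t) * cos (s t)).
  move=> /H[_ _ ->]; rewrite -aE -bE.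
  transitivity ((b1 ^+ 2 + b2 ^+ 2 - (a1 ^+ 2 + a2 ^+ 2)) * (sin (s t) * cos (s t)) +
    (a1 * b1 + a2 * b2) * (cos (s t) ^+ 2 - sin (s t) ^+ 2)); first by ring.
  by rewrite dot mul0r addr0.
have s00 : s0 = 0.
  rewrite /s0; transitivity (- ((D w * k + D (- w) * k) / 2)); first by ring.
  by rewrite !DE// sN TE sinN cosN; ring.
(* D + t has derivative 1/r - 1, the weight, so the arc parameter is an affine function of Lam (s
   t). *)
have LamE t : t \in `[- w, w] -> D t + t = Lam al be (s t) / (2 * k).
  by move=> tw; rewrite /Lam -DE// /s s00; field; rewrite gt_eqF.
(* Kepler's equation at t = 0 says that [Lam] with [al] and [be] exchanged vanishes at s 0. *)
have s_0 : s 0 = 0.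
  apply: (Lam_inj be0 al0 (etrans (addrC _ _) ab1)); rewrite Lam0 /Lam.
  transitivity (s 0 - (be ^+ 2 - al ^+ 2) * (sin (s 0) * cos (s 0))); first by ring.
  by rewrite -DE ?oc// /s s00; ring.
have LT0 := Lam_gt0 al0 be0 ab1 T0.
have cw : {within `[- w, w], continuous (fun t => weight (x t))}.
  apply/subspace_continuousP => t tw; apply: cvgB; last exact: cvg_cst.
  apply: cvgV; first by rewrite gt_eqF// r0.
  by move/subspace_continuousP: cr; exact.
have cDt : {within `[- w, w], continuous (fun t => D t + t)}.
  move=> t; apply: cvgD; first exact: cD.
  by apply: (@continuous_within _ _ id); move=> u; exact: cvg_id.
have intE t : t \in `[- w, w] -> \int[lebesgue_measure]_(u in `[- w, t]) weight (x u) =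
    (Lam al be (s t) + Lam al be T) / (2 * k).
  move=> tw; move: (tw); rewrite in_itv/= => /andP[wt tw'].
  have sub : `[- w, t] `<=` `[- w, w] by apply: subset_itv; rewrite bnd_simp.
  rewrite (_ : Rintegral _ _ _ = (D t + t) - (D (- w) + - w)).
    by rewrite !LamE// sN LamN; ring.
  have dF (u : R) : u \in `]- w, t[ -> is_derive u 1 (fun t => D t + t) (weight (x u)).
    rewrite in_itv/= => /andP[wu ut].
    have uw : u \in `]- w, w[ by rewrite in_itv/= wu (lt_le_trans ut).
    by have d := D' u uw; apply: is_derive_eq; rewrite /weight; ring.
  exact: (Rintegral_derive wt dF (continuous_subspaceW sub cDt) (continuous_subspaceW sub cw)).
have arcE t : t \in `[- w, w] -> arc_param w x t =
  (Lam al be (s t) + Lam al be T) / (2 * Lam al be T).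
  move=> tw; rewrite /arc_param /total_length !intE// TE; field.
  by apply/and3P; split; rewrite gt_eqF// addr_gt0.
have cLam : {within `[- w, w], continuous (fun t => Lam al be (s t))}.
  move=> t; apply: (@cvg_comp _ _ _ s (Lam al be) _ _ _ (cs t)).
  exact: (is_derive_continuous (is_derive_Lam ab1)).
have surj : set_surj `[- w, w] `[0, 1] (arc_param w x).
  move=> u /=; rewrite in_itv/= => /andP[u0 u1].
  have [|t tw tE] := IVT ww cLam (v := (2 * u - 1) * Lam al be T).
    by rewrite sN TE LamN ge_min le_max; apply/andP; split; apply/orP; [left|right]; nra.
  by exists t => //; rewrite arcE// tE; field; rewrite gt_eqF.
have [tau [tauE tau']] := reparametrization al0 be0 ab1 T.
exists al, be, T, e, v, tau; do 3![split => //].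
split; split => //.
(* Surjectivity of [arc_param] makes the partial inverse a right inverse, and injectivity of [Lam]
   then identifies s t with tau u. *)
- move=> u u01; rewrite /geodesic; set t := 'pinv_(fun=> 0) _ _ u.
  have tw : t \in `[- w, w].
    have := surjpinv_image_sub (dflt := fun=> 0) surj; apply; exists u => //.
  have : arc_param w x t = u by rewrite /t pinvK// inE; exact: surj.
  rewrite arcE// => tE; rewrite xL// /hooke_path /arc_path.
  have -> : s t = tau u; last by [].
  apply: (Lam_inj al0 be0 ab1); rewrite tauE -tE; field.
  by rewrite gt_eqF.
- by rewrite -xp xL// sN.
- by rewrite -xq xL// TE.
- rewrite xL ?oc// s_0 enorm_levi// enorm_sq /= cos0 sin0; ring.
Qed.

End kepler.

(** * Minimality criterion *)

Section criterion.
Context {R : realType}.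

(** Needed because [geodesic] and [hooke_path] are only known to agree on [[0, 1]]. *)
Lemma energy_local_min_ext (p q : R * R) (g h : R -> R * R) :
  (forall s, s \in `[0, 1] -> g s = h s) -> energy_local_min p q g -> energy_local_min p q h.
Proof.
move=> gh [dg [[[d1 d2 gE] hg g0 g1] [d d0 H]]].
have in0 : (0 : R) \in `[0, 1] by rewrite in_itv/= lexx ler01.
have in1 : (1 : R) \in `[0, 1] by rewrite in_itv/= lexx ler01.
exists dg; split.
  split; [|by move=> s s01; rewrite -gh//; exact: hg|by rewrite -gh|by rewrite -gh].
  by split => // s s01; rewrite -!gh//; exact: gE.
exists d => // k dk Hk kd.
have -> : energy h dg = energy g dg.
  by apply: eq_integral => s; rewrite inE/= => s01; rewrite gh.
apply: H => //; apply: le_lt_trans kd; rewrite /H1_dist.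
rewrite (_ : Rintegral _ _ _ = \int[lebesgue_measure]_(s in `[0, 1])
              (enorm (k s - h s) ^+ 2 + enorm (dk s - dg s) ^+ 2))//.
by apply: eq_Rintegral => s; rewrite inE/= => s01; rewrite gh.
Qed.

Lemma kepler_criterion (p q : R * R) (phi0 w : R) (x : R -> R * R) (c : R) :
  p <> 0 -> enorm p = enorm q -> 0 < 2 * phi0 < 2 * pi -> q = rotate_by (2 * phi0) p ->
  kepler_solution p q w x -> self_intersection_free w x -> angular_momentum w x c ->
  c != 0 ->
  exists A C e : R, [/\ 0 < A < 1, 0 < C < 1, e ^+ 2 = 1 & 0 < e * c] /\
    [/\ enorm (x 0) = A, enorm p = A * C + (1 - A) * (1 - C) &
        A * C - (1 - A) * (1 - C) = e * enorm p * cos phi0] /\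
    [/\ A < C -> local_minimizer p q w x & C < A -> ~ local_minimizer p q w x].
Proof.
move=> p0 pq phi01 qp Hk inj Ha c0.
have [al [be [T [e [v [tau [[al0 be0 ab1]
  [[T0 Tpi] [[v1 e1 ec] [[tauE tau' gE] [pE qE x0]]]]]]]]]]] :=
  kepler_hooke Hk inj Ha c0 pq.
have pi0 := pi_gt0 R.
have sT0 : 0 < sin T by rewrite sin_gt0_pi//; apply/andP; split; lra.
have cT0 : 0 < cos T by rewrite cos_gt0_pihalf//; apply/andP; split; lra.
have sphi : 0 < sin phi0 by move: phi01 => /andP[? ?]; rewrite sin_gt0_pi//; apply/andP; split; lra.
have p_ : hooke_path al be v e tau 0 = p.
  by rewrite pE /hooke_path /arc_path (tau0 al0 be0 ab1 tauE).
have q_ : hooke_path al be v e tau 1 = q.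
  by rewrite qE /hooke_path /arc_path (tau1 al0 be0 ab1 tauE).
exists (al ^+ 2), (cos T ^+ 2), e.
have be2 : be ^+ 2 = 1 - al ^+ 2 by rewrite -ab1 addrAC subrr add0r.
have rho : enorm p = al ^+ 2 * cos T ^+ 2 + (1 - al ^+ 2) * (1 - cos T ^+ 2).
  by rewrite pE enorm_levi// enorm_sq /= cosN sinN -be2 -sin_sq; ring.
split; [split => //|split].
- by rewrite exprn_gt0//=; have := exprn_gt0 2 be0; lra.
- by rewrite exprn_gt0//=; have := exprn_gt0 2 sT0; rewrite sin_sq; lra.
- split => //; rewrite rho -be2 -sin_sq.
  (* As complex numbers p = v (X - i Y) and q = v (X + i Y), so the angle condition makes X + i Y
     equal to |p| e^(i phi0) up to sign; since e Y > 0 and sin phi0 > 0, the sign is [e]. *)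
  set X := al ^+ 2 * cos T ^+ 2 - be ^+ 2 * sin T ^+ 2.
  pose Y := 2 * e * (al * cos T * (be * sin T)).
  have V : v.1 ^+ 2 + v.2 ^+ 2 = 1 by rewrite -enorm_sq v1 expr1n.
  have pXY : p = (v.1 * X + v.2 * Y, v.2 * X - v.1 * Y).
    by rewrite pE /levi /= cosN sinN /X /Y; congr (_, _); ring.
  have qXY : q = (v.1 * X - v.2 * Y, v.2 * X + v.1 * Y).
    by rewrite qE /levi /= /X /Y; congr (_, _); ring.
  move: qp; rewrite pXY qXY /rotate_by /= => -[E1 E2].
  have E3 : X = cos (2 * phi0) * X + sin (2 * phi0) * Y.
    rewrite -[LHS]mul1r -V; transitivity (v.1 * (v.1 * X - v.2 * Y) + v.2 * (v.2 * X + v.1 * Y));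
      first by ring.
    rewrite E1 E2 -[cos _ * X]mul1r -[sin _ * Y]mul1r -V; ring.
  have c2 : cos (2 * phi0) = 1 - 2 * sin phi0 ^+ 2.
    by rewrite mulr_natl cos_mulr2n sin_sq; ring.
  have s2 : sin (2 * phi0) = 2 * (sin phi0 * cos phi0).
    by rewrite mulr_natl sin_mulr2n; ring.
  have E4 : X * sin phi0 = Y * cos phi0.
    apply: (mulfI (_ : 2 * sin phi0 != 0)); first by rewrite gt_eqF// mulr_gt0.
    by move: E3; rewrite c2 s2; lra.
  have eY : 0 < e * Y.
    rewrite /Y; have -> : e * (2 * e * (al * cos T * (be * sin T))) =
      e ^+ 2 * (2 * (al * cos T * (be * sin T))) by ring.
    by rewrite e1 mul1r !mulr_gt0.
  set r := al ^+ 2 * cos T ^+ 2 + be ^+ 2 * sin T ^+ 2.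
  have r0 : 0 < r by rewrite addr_gt0// mulr_gt0// exprn_gt0.
  have rr : r ^+ 2 = X ^+ 2 + (e * Y) ^+ 2.
    rewrite /r /X /Y; transitivity (X ^+ 2
      + (e ^+ 2) ^+ 2 * (2 * (al * cos T * (be * sin T))) ^+ 2).
      by rewrite e1 /X; ring.
    by rewrite /X; ring.
  have E5 : r * sin phi0 = e * Y.
    apply/eqP; rewrite -(@eqrXn2 _ 2 _ _ isT (mulr_ge0 (ltW r0) (ltW sphi)) (ltW eY)); apply/eqP.
    rewrite exprMn rr mulrDl -exprMn E4 exprMn.
    have -> : Y ^+ 2 = (e * Y) ^+ 2 by rewrite [RHS]exprMn e1 mul1r.
    by rewrite -mulrDr cos2Dsin2 mulr1.
  apply: (mulIf (_ : sin phi0 != 0)); first by rewrite gt_eqF.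
  rewrite E4; have -> : e * r * cos phi0 * sin phi0 = e * (r * sin phi0) * cos phi0 by ring.
  by rewrite E5 mulrA -expr2 e1 mul1r.
- split => [AC|CA].
    have alT : al < cos T by rewrite -(@ltr_pXn2r _ 2)// nnegrE ltW.
    have := hooke_local_min al0 be0 ab1 T0 Tpi alT v1 e1 tauE tau'.
    by rewrite p_ q_; apply: energy_local_min_ext => s s01; rewrite gE.
  have alT : cos T < al by rewrite -(@ltr_pXn2r _ 2)// nnegrE ltW.
  have := hooke_not_local_min al0 be0 ab1 T0 Tpi v1 e1 tauE tau' alT.
  by rewrite p_ q_ => N M; apply: N; apply: energy_local_min_ext M => s s01; rewrite gE.
Qed.

End criterion.

(** * The case distinction on |p| and phi0 *)

Theorem theorem3p3 (R : realType) (p q : R * R) (phi0 : R)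
    (p_neq0 : p <> 0) (q_neq0 : q <> 0) (p_neq_q : p <> q)
    (eq_norm : enorm p = enorm q) (norm_lt1 : enorm p < 1)
    (phi0_bounds : 0 < 2 * phi0 < 2 * pi) (angle_pq : q = rotate_by (2 * phi0) p) :
  (enorm p < 1 / 2 ->
     (forall w x, x_int p q (@Cplus R) w x -> local_minimizer p q w x) /\
     (forall w x, x_int p q (@Cminus R) w x -> local_minimizer p q w x) /\
     (forall w x, x_ext p q (@Cplus R) w x -> ~ local_minimizer p q w x) /\
     (forall w x, x_ext p q (@Cminus R) w x -> ~ local_minimizer p q w x)) /\
  (enorm p = 1 / 2 ->
     (0 < phi0 < pi / 2 ->
        (forall w x, x_circ p q (@Cplus R) w x -> local_minimizer p q w x) /\
        (forall w x, x_int p q (@Cminus R) w x -> local_minimizer p q w x) /\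
        (forall w x, x_circ p q (@Cminus R) w x -> ~ local_minimizer p q w x) /\
        (forall w x, x_ext p q (@Cplus R) w x -> ~ local_minimizer p q w x)) /\
     (pi / 2 < phi0 < pi ->
        (forall w x, x_circ p q (@Cminus R) w x -> local_minimizer p q w x) /\
        (forall w x, x_int p q (@Cplus R) w x -> local_minimizer p q w x) /\
        (forall w x, x_circ p q (@Cplus R) w x -> ~ local_minimizer p q w x) /\
        (forall w x, x_ext p q (@Cminus R) w x -> ~ local_minimizer p q w x))) /\
  (1 / 2 < enorm p < 1 ->
     (0 < phi0 < asin ((1 - enorm p) / enorm p) ->
        (forall w1 x1 w2 x2, x_ext12 p q (@Cplus R) w1 x1 w2 x2 ->
           local_minimizer p q w1 x1 /\ ~ local_minimizer p q w2 x2) /\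
        (forall w1 x1 w2 x2, x_int12 p q (@Cminus R) w1 x1 w2 x2 ->
           local_minimizer p q w2 x2 /\ ~ local_minimizer p q w1 x1)) /\
     (pi - asin ((1 - enorm p) / enorm p) < phi0 < pi ->
        (forall w1 x1 w2 x2, x_ext12 p q (@Cminus R) w1 x1 w2 x2 ->
           local_minimizer p q w1 x1 /\ ~ local_minimizer p q w2 x2) /\
        (forall w1 x1 w2 x2, x_int12 p q (@Cplus R) w1 x1 w2 x2 ->
           local_minimizer p q w2 x2 /\ ~ local_minimizer p q w1 x1))).
Proof.
have pi0 := pi_gt0 R.
have crit w x c := kepler_criterion (w := w) (x := x) (c := c) p_neq0 eq_norm phi0_bounds angle_pq.
have w00 w x : kepler_solution p q w x -> (0 : R) \in `]- w, w[.
  by move=> [w0 _]; rewrite in_itv/= oppr_lt0 w0.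
have e_sq (e : R) : e ^+ 2 = 1 -> e = 1 \/ e = -1.
  by move/eqP; rewrite sqrf_eq1 => /orP[/eqP|/eqP]; [left|right].
pose data (e : R) w x := exists A C : R, [/\ 0 < A < 1, 0 < C < 1, enorm (x 0) = A &
    [/\ enorm p = A * C + (1 - A) * (1 - C),
        A * C - (1 - A) * (1 - C) = e * enorm p * cos phi0,
        A < C -> local_minimizer p q w x & C < A -> ~ local_minimizer p q w x]].
have dplus w x : kepler_solution p q w x -> self_intersection_free w x -> Cplus w x -> data 1 w x.
  move=> Hk Hi [c c0 Ha]; have cn0 : c != 0 by rewrite gt_eqF.
  have [A [C [e [[A01 C01 e1 ec] [[x0 rE XE] [m1 m2]]]]]] := crit w x c Hk Hi Ha cn0.
  exists A, C; split => //; split => //; rewrite XE.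
  by have [->|eN] := e_sq e e1 => //; move: ec; rewrite eN; lra.
have dminus w x : kepler_solution p q w x -> self_intersection_free w x -> Cminus w x ->
  data (-1) w x.
  move=> Hk Hi [c c0 Ha]; have cn0 : c != 0 by rewrite lt_eqF.
  have [A [C [e [[A01 C01 e1 ec] [[x0 rE XE] [m1 m2]]]]]] := crit w x c Hk Hi Ha cn0.
  exists A, C; split => //; split => //; rewrite XE.
  by have [eN|->] := e_sq e e1 => //; move: ec; rewrite eN; lra.
have lt1 e w x : data e w x -> enorm (x 0) < enorm p -> enorm p <= 1 / 2 -> local_minimizer p q w x.
  move=> [A [C [/andP[A0 A1] /andP[C0 C1] -> [-> _ m1 _]]]] h1 h2; apply: m1.
  have A2 : A < 1 / 2 by nra.
  have C2 : 1 / 2 <= C by nra.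
  lra.
have gt1 e w x : data e w x -> enorm p < enorm (x 0) -> enorm p <= 1 / 2 ->
  ~ local_minimizer p q w x.
  move=> [A [C [/andP[A0 A1] /andP[C0 C1] -> [-> _ _ m2]]]] h1 h2; apply: m2.
  have A2 : 1 / 2 < A by nra.
  have C2 : C <= 1 / 2 by nra.
  lra.
(* On a circular arc A = 1/2, and the relation with cos phi0 reduces to C - 1/2 = e cos phi0 / 2. *)
have circ e w x : data e w x -> enorm (x 0) = enorm p -> enorm p = 1 / 2 ->
    (0 < e * cos phi0 -> local_minimizer p q w x) /\
      (e * cos phi0 < 0 -> ~ local_minimizer p q w x).
  move=> [A [C [_ _ -> [pE XE m1 m2]]]] h1 h2; rewrite h1 h2 in XE m1 m2.
  by split => h; [apply: m1|apply: m2]; lra.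
have pair e w1 x1 w2 x2 : data e w1 x1 -> data e w2 x2 -> enorm (x1 0) < enorm (x2 0) ->
    local_minimizer p q w1 x1 /\ ~ local_minimizer p q w2 x2.
  move=> [A [C [_ _ -> [pE XE m1 _]]]] [B [G [_ _ -> [pE' XE' _ m2]]]] AB.
  have S : A + C = B + G by lra.
  have P : A * C = B * G by lra.
  have : (B - A) * (B - C) = 0.
    transitivity (B * (B - (A + C)) + A * C); first by ring.
    by rewrite S P; ring.
  move=> /eqP; rewrite mulf_eq0 !subr_eq0 => /orP[/eqP BA|/eqP BC]; first by move: AB;
    rewrite BA ltxx.
  by split; [apply: m1; lra|apply: m2; lra].
split; [|split].
- move=> /ltW p12; split; [|split; [|split]] => w x [Hk Hi HC /(_ 0 (w00 w x Hk)) x0].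
  + exact: (lt1 1 _ _ (dplus _ _ Hk Hi HC)).
  + exact: (lt1 (-1) _ _ (dminus _ _ Hk Hi HC)).
  + exact: (gt1 1 _ _ (dplus _ _ Hk Hi HC)).
  + exact: (gt1 (-1) _ _ (dminus _ _ Hk Hi HC)).
- move=> p12; have p12' : enorm p <= 1 / 2 by rewrite p12.
  split => /andP[f0 f1].
    have cphi : 0 < cos phi0 by rewrite cos_gt0_pihalf//; apply/andP; split; lra.
    split; [|split; [|split]] => w x [Hk Hi HC /(_ 0 (w00 w x Hk)) x0].
    + by have [] := circ _ _ _ (dplus _ _ Hk Hi HC) x0 p12; rewrite mul1r => + _; apply.
    + exact: (lt1 (-1) _ _ (dminus _ _ Hk Hi HC)).
    + by have [] := circ _ _ _ (dminus _ _ Hk Hi HC) x0 p12; rewrite mulN1r oppr_lt0 => _; apply.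
    + exact: (gt1 1 _ _ (dplus _ _ Hk Hi HC)).
  have cphi : cos phi0 < 0.
    have : 0 < cos (pi - phi0) by rewrite cos_gt0_pihalf//; apply/andP; split; lra.
    by rewrite cosB cospi sinpi mul0r addr0 mulN1r oppr_gt0.
  split; [|split; [|split]] => w x [Hk Hi HC /(_ 0 (w00 w x Hk)) x0].
  + by have [] := circ _ _ _ (dminus _ _ Hk Hi HC) x0 p12; rewrite mulN1r oppr_gt0 => + _; apply.
  + exact: (lt1 1 _ _ (dplus _ _ Hk Hi HC)).
  + by have [] := circ _ _ _ (dplus _ _ Hk Hi HC) x0 p12; rewrite mul1r => _; apply.
  + exact: (gt1 (-1) _ _ (dminus _ _ Hk Hi HC)).
- move=> _; split => _; split => w1 x1 w2 x2 [[Hk1 Hi1 HC1 _] [Hk2 Hi2 HC2 _] lt].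
  + exact: (pair _ _ _ _ _ (dplus _ _ Hk1 Hi1 HC1) (dplus _ _ Hk2 Hi2 HC2) lt).
  (* In [x_int12] the label 2 marks the smaller |x(0)|, hence the exchanged arguments. *)
  + exact: (pair _ _ _ _ _ (dminus _ _ Hk2 Hi2 HC2) (dminus _ _ Hk1 Hi1 HC1) lt).
  + exact: (pair _ _ _ _ _ (dminus _ _ Hk1 Hi1 HC1) (dminus _ _ Hk2 Hi2 HC2) lt).
  + exact: (pair _ _ _ _ _ (dplus _ _ Hk2 Hi2 HC2) (dplus _ _ Hk1 Hi1 HC1) lt).
Qed.
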